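(* Let $(\mathcal N,\mathcal O,\mathfrak l)$ be a plabic network representing a point $[A]\in\mathcal S^{\mathrm{TNN}}_{\mathcal M}\subset Gr^{\mathrm{TNN}}(k,n)$, with orientation $\mathcal O$ associated to the base $I=\{1\le i_1<i_2<\dots<i_k\le n\}$ in $\mathcal M$ and gauge ray direction $\mathfrak l$. Let $e$ be the edge starting at the boundary source $b_{i_r}$ and let $b_j$, $j\in\bar I=[n]\setminus I$, be a boundary sink. Then the number $\mathrm{wind}(F)+\mathrm{int}(F)$ has the same parity for all edge flows $F$ from $b_{i_r}$ to $b_j$ (i.e. all $F\in\mathcal F_{e,b_j}(\mathcal G)$), and this parity is that of the number of boundary sources strictly between $i_r$ and $j$ in the orientation $\mathcal O$, $$N_{rj}=\#\{i_s\in I:\ \min\{i_r,j\}<i_s<\max\{i_r,j\}\}.$$ Therefore, with the choice of the canonical basis vectors of $\mathbb R^n$ as boundary vectors at the sinks, $$(E_e)_j=(-1)^{N_{rj}}\frac{\sum_{F\in\mathcal F_{e,b_j}(\mathcal G)}w(F)}{\sum_{C\in\mathcal C(\mathcal G)}w(C)}=A^r_j,$$ where $A^r_j$ is the entry of the reduced row echelon matrix $A$ of the point $[A]$ with respect to the base $I$.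
   Context: $Gr^{\mathrm{TNN}}(k,n)=GL_k^+\backslash Mat^{\mathrm{TNN}}_{k,n}$, where $Mat^{\mathrm{TNN}}_{k,n}$ is the set of real $k\times n$ matrices of rank $k$ with non-negative maximal minors $\Delta_J$. For a matroid $\mathcal M$, $\mathcal S^{\mathrm{TNN}}_{\mathcal M}=\{[A]:\Delta_J(A)>0\text{ if }J\in\mathcal M,\ \Delta_J(A)=0\text{ if }J\notin\mathcal M\}$. The reduced row echelon matrix with respect to $I$ is the representative whose submatrix in the columns $I$ is the identity. Fix positive integers $k<n$. A plabic graph $\mathcal G$ of type $(k,n)$ is a finite directed graph drawn planarly in a disk, with no component isolated from the boundary, such that: it has $n$ boundary vertices $b_1,\dots,b_n$ labelled clockwise, all on a common straight interval of the boundary of the disk, each of degree 1 (a boundary source if its edge is outgoing, a boundary sink if incoming; exactly $k$ are sources); all other (internal) vertices are strictly inside the disk and are bivalent or trivalent; each internal vertex either has exactly one incoming edge (white) or exactly one outgoing edge (black), bivalent vertices being assigned either colour. Edges are straight segments, regarded as vectors directed by the orientation $\mathcal O$. $I$ indexes the boundary sources. A plabic network $\mathcal N$ is a plabic graph with a positive weight $w_e$ on each edge. $\mathcal N$ represents $[A]$ if $[A]$ is the class of the matrix with identity submatrix in the columns $I$ and entries $A^r_j=(-1)^{\sigma(i_r,j)}\sum_{P:b_{i_r}\to b_j}(-1)^{\mathrm{wind}_{top}(P)}w(P)$ for $j\in\bar I$, where $\sigma(i_r,j)$ is the number of elements of $I$ strictly between $i_r$ and $j$, the sum is over directed walks from $b_{i_r}$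 to $b_j$ (it sums to a rational function of the weights), and $\mathrm{wind}_{top}$ is the topological winding index ($(-1)^{\mathrm{wind}_{top}(P)}=(-1)^{\text{number of loops removed in the loop erasure of }P}$). A gauge ray direction $\mathfrak l$ is an oriented direction such that the ray in direction $\mathfrak l$ from any boundary vertex points inside the disk, no internal edge is parallel to $\mathfrak l$, and the rays starting at boundary vertices contain no internal vertices. $\mathfrak l_i$ is the ray starting at $b_i$. For plane vectors $s(u,v)=+1,0,-1$ if $(u,v)$ is positively (counterclockwise) oriented, parallel, negatively oriented. For consecutive edges, $\mathrm{wind}(e,f)=\pm1$ if $s(e,f)=s(e,\mathfrak l)=s(\mathfrak l,f)=\pm1$, and $0$ otherwise. $\mathrm{int}(e)$ is the number of intersections of $e$ with the rays $\mathfrak l_{i_r}$, $r\in[k]$ (the common starting point of $\mathfrak l_{i_r}$ and the edge at $b_{i_r}$ is not counted). For a directed path $\mathcal P=(e_1,\dots,e_m)$ (edges may repeat): $w(\mathcal P)=\prod w_{e_l}$ with multiplicity, $\mathrm{wind}(\mathcal P)=\sum_{l=1}^{m-1}\mathrm{wind}(e_l,e_{l+1})$, $\mathrm{int}(\mathcal P)=\sum_{l=1}^m\mathrm{int}(e_l)$. The edge vector $E_e\in\mathbb R^n$ (canonical boundary vectors) has components $(E_e)_j=\sum_{\mathcal P:e\to b_j}(-1)^{\mathrm{wind}(\mathcal P)+\mathrm{int}(\mathcal P)}w(\mathcal P)$, the sum over all directed paths with first edge $e$ ending at $b_j$, understood as the rational function of the weights to which it sums (zero if there is no path). An edge flow at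 $e$ is a collection $F$ of distinct edges such that: $e\in F$; at every internal vertex other than the starting vertex $V$ of $e$ the number of edges of $F$ arriving equals the number leaving; at $V$ the number arriving equals the number leaving minus 1; $F$ contains no edges at boundary sources except possibly $e$. $\mathcal F_{e,b_j}(\mathcal G)$ is the set of edge flows at $e$ containing the edge at the sink $b_j$; each such $F$ is the union of a directed path $P_{e,b_j}$ from $e$ to $b_j$ with all edges distinct and a (possibly trivial) conservative flow having no common edges with it. $w(F)$ is the product of the weights of the edges in $F$, $\mathrm{wind}(F)=\mathrm{wind}(P_{e,b_j})$, $\mathrm{int}(F)=\mathrm{int}(P_{e,b_j})$. A conservative flow is a collection $C$ of distinct edges, none incident to the boundary, such that at each internal vertex the numbers of edges of $C$ arriving and leaving coincide; $\mathcal C(\mathcal G)$ is the set of conservative flows, including the empty one with weight 1, and $w(C)$ is the product of the weights of its edges. *)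

(* Defs.v *)
From mathcomp Require Import all_boot all_order all_algebra.
From mathcomp Require Import boolp classical_sets reals topology normedtype.
From mathcomp Require Import -(notations) mpoly.

Set Implicit Arguments.
Unset Strict Implicit.
Unset Printing Implicit Defensive.

Import Order.TTheory GRing.Theory Num.Theory.
Import numFieldNormedType.Exports.

Local Open Scope ring_scope.

(* A k-element subset J of [n] is given by its increasing enumeration
   [J : 'I_k -> 'I_n]; its underlying set is [ran J]. *)

Definition increasing k n (J : 'I_k -> 'I_n) : Prop :=
  forall r s : 'I_k, (r < s)%N -> (J r < J s)%N.

Definition ran k n (J : 'I_k -> 'I_n) : {set 'I_n} := [set J r | r : 'I_k].

Definition maxminor (R : realType) k n (J : 'I_k -> 'I_n) (A : 'M[R]_(k, n)) : R :=
  \det (colsub J A).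

Definition MatTNN (R : realType) k n (A : 'M[R]_(k, n)) : Prop :=
  \rank A = k /\ forall J, increasing J -> 0 <= maxminor J A.

Definition same_point (R : realType) k n (A B : 'M[R]_(k, n)) : Prop :=
  exists2 g : 'M[R]_k, 0 < \det g & A = g *m B.

Definition matroid_bases k n (M : {set {set 'I_n}}) : Prop :=
  [/\ M != finset.set0,
      forall B, B \in M -> #|B| = k &
      forall B1 B2, B1 \in M -> B2 \in M -> forall x, x \in B1 :\: B2 ->
        exists2 y, y \in B2 :\: B1 & y |: (B1 :\ x) \in M].

Definition positroid_cell (R : realType) k n (M : {set {set 'I_n}})
    (A : 'M[R]_(k, n)) : Prop :=
  MatTNN A /\
  forall J, increasing J ->
    (ran J \in M -> 0 < maxminor J A) /\ (ran J \notin M -> maxminor J A = 0).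

Definition rref (R : realType) k n (J : 'I_k -> 'I_n) (A : 'M[R]_(k, n)) :
    'M[R]_(k, n) :=
  invmx (colsub J A) *m A.

Definition nb_between k n (J : 'I_k -> 'I_n) (a j : 'I_n) : nat :=
  #|[set s : 'I_k | (minn a j < J s < maxn a j)%N]|.

(* The vertices are [inl i] (boundary vertex b_i) and [inr v] (internal);
   boundary labels are 0-based. *)

Record digraph (n : nat) := Digraph {
  ivertex : finType;
  nE : nat;
  white : pred ivertex;
  tail : 'I_nE -> 'I_n + ivertex;
  head : 'I_nE -> 'I_n + ivertex
}.
Arguments tail {n} d _.
Arguments head {n} d _.
Arguments white {n} d _.

Definition vertex n (G : digraph n) : finType := ('I_n + ivertex G)%type.
Definition edge n (G : digraph n) : finType := 'I_(nE G).

Section Digraph.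
Variables (n : nat) (G : digraph n).

Definition indeg (x : vertex G) : nat := #|[set e : edge G | head G e == x]|.
Definition outdeg (x : vertex G) : nat := #|[set e : edge G | tail G e == x]|.

Definition internal_edge (e : edge G) : bool :=
  [forall i : 'I_n, (tail G e != inl i) && (head G e != inl i)].

Definition adjacent : rel (vertex G) := fun x y =>
  [exists e : edge G, ((tail G e == x) && (head G e == y))
                   || ((tail G e == y) && (head G e == x))].

Definition plabic k (I : 'I_k -> 'I_n) : Prop :=
  [/\ [/\ increasing I &
         forall i : 'I_n, (outdeg (inl i) == 1%N) = (i \in ran I)],
      forall i : 'I_n, (indeg (inl i) + outdeg (inl i))%N = 1%N,
      forall v : ivertex G, (indeg (inr v) + outdeg (inr v))%N \in [:: 2%N; 3%N],
      forall v : ivertex G,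
        if white G v then indeg (inr v) = 1%N else outdeg (inr v) = 1%N &
      forall v : ivertex G, exists i : 'I_n, connect adjacent (inr v) (inl i)].

Definition follows : rel (edge G) := fun e f => head G e == tail G f.

(* Directed walks with first edge [e] ending at the vertex [y]; edges may
   repeat. *)
Definition walk_from (e : edge G) (y : vertex G) (P : seq (edge G)) : bool :=
  if P is f :: P' then
    [&& f == e, path follows f P' & head G (last f P') == y]
  else false.

Definition walk (x y : vertex G) (P : seq (edge G)) : bool :=
  [exists e : edge G, (tail G e == x) && walk_from e y P].

(* The number of loops removed in the chronological loop erasure of a walk
   visiting the vertices [xs]; [st] is the loop-erased initial part of the
   walk, most recent vertex first. *)
Fixpoint nb_loops_rec (st xs : seq (vertex G)) : nat :=
  if xs is y :: xs' then
    if y \in st then (nb_loops_rec (drop (index y st) st) xs').+1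
    else nb_loops_rec (y :: st) xs'
  else 0%N.

Definition nb_loops (P : seq (edge G)) : nat :=
  if P is e :: _ then nb_loops_rec [:: tail G e] [seq head G f | f <- P] else 0%N.

Definition arriving (F : {set edge G}) (x : vertex G) : nat :=
  #|[set f in F | head G f == x]|.
Definition leaving (F : {set edge G}) (x : vertex G) : nat :=
  #|[set f in F | tail G f == x]|.

Definition conservative_flow (C : {set edge G}) : bool :=
  [forall f in C, internal_edge f] &&
  [forall v : ivertex G, arriving C (inr v) == leaving C (inr v)].

Definition edge_flow (e : edge G) (F : {set edge G}) : bool :=
  [&& e \in F,
      [forall v : ivertex G,
        (inr v != tail G e) ==> (arriving F (inr v) == leaving F (inr v))],
      ((arriving F (tail G e)).+1 == leaving F (tail G e)) &
      [forall f in F, [forall i : 'I_n, (tail G f == inl i) ==> (f == e)]]].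

Definition edge_flow_to (e : edge G) (j : 'I_n) (F : {set edge G}) : bool :=
  edge_flow e F && [exists f in F, head G f == inl j].

(* [P] is the directed path of distinct edges from [e] to b_j contained in the
   edge flow [F], whose complement in [F] is a conservative flow. *)
Definition flow_path (e : edge G) (j : 'I_n) (F : {set edge G})
    (P : seq (edge G)) : Prop :=
  [/\ walk_from e (inl j) P, uniq P &
      exists C : {set edge G}, [/\ conservative_flow C,
        [disjoint [set f in P] & C] & F = [set f in P] :|: C]].

Definition set_weight (R : realType) (w : edge G -> R) (F : {set edge G}) : R :=
  \prod_(f in F) w f.

(* A sum of signed walks is a formal power series in the edge variables, given by
   its coefficients. *)

Definition series (R : realType) := multinom (nE G) -> R.

Definition walk_monomial (P : seq (edge G)) : multinom (nE G) :=
  Multinom [tuple count_mem f P | f < nE G].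

(* The series of the sum of [sgn P * w(P)] over the walks [P] selected by [W];
   a walk with monomial [m] has exactly [mdeg m] edges. *)
Definition walk_series (R : realType) (W : pred (seq (edge G)))
    (sgn : seq (edge G) -> R) : series R := fun m =>
  \sum_(P : (mdeg m).-tuple (edge G) | W P && (walk_monomial P == m)) sgn P.

Definition mul_series (R : realType) (q : mpoly (nE G) R) (S : series R) :
    series R := fun m =>
  \sum_(u <- msupp q | lem u m)
     mcoeff u q * S (mnm_sub m u).

(* [S] is the expansion of a rational function p / q which is regular at the
   weights [w], where it takes the value [v]. *)
Definition sums_rationally (R : realType) (S : series R) (w : edge G -> R)
    (v : R) : Prop :=
  exists p q : mpoly (nE G) R,
    [/\ forall m, mul_series q S m = mcoeff m p,
        meval w q != 0 &
        v = meval w p / meval w q].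

Definition rational_sum (R : realType) (S : series R) (w : edge G -> R) : R :=
  xget 0 (fun v => sums_rationally S w v).

(* (-1)^wind_top(P) is expressed through the loop erasure of P. *)
Definition boundary_series (R : realType) (i j : 'I_n) : series R :=
  walk_series (walk (inl i) (inl j)) (fun P => (-1) ^+ nb_loops P).

Definition represents (R : realType) k (I : 'I_k -> 'I_n) (w : edge G -> R)
    (A : 'M[R]_(k, n)) : Prop :=
  exists2 B : 'M[R]_(k, n), same_point A B &
    colsub I B = 1%:M /\
    forall (r : 'I_k) (j : 'I_n), j \notin ran I ->
      B r j = (-1) ^+ nb_between I (I r) j
              * rational_sum (boundary_series R (I r) j) w.

End Digraph.

Definition cross (R : realType) (u v : R * R) : R := u.1 * v.2 - u.2 * v.1.

Definition orient (R : realType) (u v : R * R) : int := sgz (cross u v).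

(* By the Schoenflies theorem these are exactly the subsets of the plane
   homeomorphic to the closed unit disk. *)
Definition closed_disk (R : realType) (D : set (R * R)) : Prop :=
  exists f g : R * R -> R * R,
    [/\ continuous f, continuous g, cancel f g, cancel g f &
        D = (f @` [set p | p.1 ^+ 2 + p.2 ^+ 2 <= 1])%classic].

Definition on_segment (R : realType) (x y : R * R) (t : R) : R * R :=
  x + t *: (y - x).

(* The open segment ]a, c[ is a part of the boundary of [D] and [D] lies to the
   right of it, i.e. moving from [a] to [c] is moving clockwise around [D]. *)
Definition clockwise_interval (R : realType) (D : set (R * R)) (a c : R * R) :
    Prop :=
  a != c /\
  forall t : R, 0 < t < 1 ->
    [/\ D (on_segment a c t), ~ interior D (on_segment a c t) &
        \forall q \near on_segment a c t,
          (cross (c - a) (q - a) < 0 -> D q) /\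
          (0 < cross (c - a) (q - a) -> ~ D q)].

Section Drawing.
Variables (R : realType) (n : nat) (G : digraph n).
Variables (D : set (R * R)) (pos : vertex G -> R * R).

Definition edge_point (e : edge G) (t : R) : R * R :=
  on_segment (pos (tail G e)) (pos (head G e)) t.

Definition edge_dir (e : edge G) : R * R := pos (head G e) - pos (tail G e).

Definition incident (x : vertex G) (e : edge G) : bool :=
  (tail G e == x) || (head G e == x).

Definition planar_drawing : Prop :=
  [/\ closed_disk D,
      exists (a c : R * R) (t : 'I_n -> R),
        [/\ clockwise_interval D a c,
            forall i, 0 < t i < 1,
            forall i j : 'I_n, (i < j)%N -> t i < t j &
            forall i, pos (inl i) = on_segment a c (t i)],
      forall v : ivertex G, interior D (pos (inr v)),
      forall e (t : R), 0 < t < 1 -> interior D (edge_point e t) &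
      [/\ injective pos,
          forall e : edge G, tail G e != head G e &
          forall e f : edge G, e != f -> forall t u : R,
            0 <= t <= 1 -> 0 <= u <= 1 -> edge_point e t = edge_point f u ->
            exists x : vertex G,
              [/\ incident x e, incident x f & pos x = edge_point e t]]].

Variable l : R * R.

Definition ray_point (i : 'I_n) (t : R) : R * R := pos (inl i) + t *: l.

Definition gauge_ray_direction : Prop :=
  [/\ forall i : 'I_n, exists2 d : R, 0 < d &
        forall t : R, 0 < t < d -> interior D (ray_point i t),
      forall e : edge G, internal_edge e -> cross (edge_dir e) l != 0 &
      forall (i : 'I_n) (v : ivertex G) (t : R),
        0 <= t -> ray_point i t != pos (inr v)].

Definition local_wind (e f : edge G) : int :=
  let s := orient (edge_dir e) (edge_dir f) in
  if (s == orient (edge_dir e) l) && (s == orient l (edge_dir f)) then s else 0.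

Definition wind (P : seq (edge G)) : int :=
  if P is e :: P' then \sum_(x <- zip P P') local_wind x.1 x.2 else 0.

(* An edge meets a gauge ray in at most one point other than the starting point
   of the ray, so the intersections are counted by the rays. *)
Definition edge_int k (I : 'I_k -> 'I_n) (e : edge G) : nat :=
  #|[set r : 'I_k |
      `[< exists t u : R, [/\ 0 < t, 0 <= u <= 1 &
            ray_point (I r) t = edge_point e u] >]]|.

Definition path_int k (I : 'I_k -> 'I_n) (P : seq (edge G)) : nat :=
  (\sum_(e <- P) edge_int I e)%N.

Definition edge_series k (I : 'I_k -> 'I_n) (e : edge G) (j : 'I_n) :
    series G R :=
  walk_series (walk_from e (inl j)) (fun P => (-1) ^ (wind P + path_int I P)).

Definition edge_vector k (I : 'I_k -> 'I_n) (w : edge G -> R) (e : edge G) :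
    'rV[R]_n :=
  \row_j rational_sum (edge_series I e j) w.

End Drawing.

(* Main.v *)
(* Let [par] be the parity of winding plus intersections with the gauge rays.

   A simple cycle has [par] odd: the rays start outside it, so they cross it an
   even number of times, and the number of turns of a simple polygon through a
   given direction is odd. The latter is Hopf's argument modulo 2: among the
   pairs of points with vertical secant, which form segments, those on the
   boundary of the triangle of pairs come in an even number. A simple path from
   b_i to b_j is closed up by the segment [b_j, b_i] of the boundary of the disk.
   Crossing parities with respect to this polygon vanish outside the disk, hence
   just behind each source, which gives the parity of the intersections with
   every gauge ray up to the contributions of the segment; those are exactly the
   sources strictly between i and j. No Jordan curve theorem is needed: crossing
   parity is locally constant and the complement of the disk is connected.

   Since every internal vertex has a single incoming or a single outgoing edge,
   removing a loop from a walk changes [par] exactly by the parity of the loop.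
   Hence [par] and the number of erased loops differ by a constant on walks from
   b_i to b_j.

   Signed walks satisfy a linear system over polynomials in the edge weights.
   Its determinant expands over permutations moving edges to following edges,
   that is over conservative flows, all with sign + because cycles are odd. The
   numerator is the same expansion for the graph closed up by letting the edge
   at b_i follow the edge at b_j. *)

Require Import Defs.
From mathcomp Require Import all_boot all_order all_algebra.
From mathcomp Require Import boolp classical_sets reals topology normedtype.
From mathcomp Require Import prodnormedzmodule all_fingroup zify ring lra.
From mathcomp Require Import -(notations) mpoly.

Set Implicit Arguments.
Unset Strict Implicit.
Unset Printing Implicit Defensive.

Import Order.TTheory GRing.Theory Num.Theory.
Import numFieldNormedType.Exports.
Import Defs.

Local Open Scope ring_scope.

(** * Turning parity of simple polygons *)

(** Two corrections arise at the source of a path and cancel. Its own gauge ray starts on the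
    polygon, so once pushed back it may cross the first edge, according to the side of the ray on
    which that edge lies; the corner between the closing segment and the first edge turns through
    the gauge direction under a condition that involves the same side. The corner at the sink never
    counts, because the last edge points out of the disk and the gauge direction points into it.
    Signs disappear from the determinant because an orbit of length m has sign (-1)^(m-1), while the
    off-diagonal entries of the identity minus the transfer matrix supply (-1)^m and one more sign,
    the odd parity of the cycle. The colours of the vertices make a permutation recoverable from its
    set of moved edges, which turns permutations into flows. Sums over walks may diverge at the
    given weights, so they stay formal series S tied to polynomials by q S = p. At positive weights
    q is at least 1, the weight of the empty flow, so the value p / q always makes sense. *)

Section Segments.
Variable R : realFieldType.
Implicit Types (p q u : R * R) (t : R).

Definition height p q t : R := p.2 + (t - p.1) / (q.1 - p.1) * (q.2 - p.2).

Definition between p q t : bool := (p.1 < t < q.1) || (q.1 < t < p.1).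

Lemma heightC p q t : p.1 != q.1 -> height p q t = height q p t.
Proof.
case: p q => [a b] [c d] /= ac; rewrite /height /=; field.
by rewrite !subr_eq0 ac eq_sym ac.
Qed.

Lemma height_l p q : height p q p.1 = p.2.
Proof. by rewrite /height subrr !mul0r addr0. Qed.

Lemma height_r p q : p.1 != q.1 -> height p q q.1 = q.2.
Proof. by move=> pq; rewrite heightC ?height_l. Qed.

Lemma betweenC p q t : between p q t = between q p t.
Proof. by rewrite /between orbC. Qed.

Lemma between_l p q : between p q p.1 = false.
Proof. by rewrite /between !ltxx andbF. Qed.

Lemma between_r p q : between p q q.1 = false.
Proof. by rewrite betweenC between_l. Qed.

Lemma betweenE p q t : p.1 != t -> q.1 != t ->
  between p q t = (p.1 < t) (+) (q.1 < t).
Proof.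
rewrite /between; case: (ltgtP p.1 t) => // _ _; case: (ltgtP q.1 t) => //.
Qed.

Lemma height_root p q p' q' s t : s <= t ->
  (0 < height p' q' s - height p q s) != (0 < height p' q' t - height p q t) ->
  exists2 c, s <= c <= t & height p q c = height p' q' c.
Proof.
set d := fun t => height p' q' t - height p q t.
have [a [b dE]] : exists a b, forall t, d t = a + b * t.
  exists (p'.2 - p'.1 / (q'.1 - p'.1) * (q'.2 - p'.2) -
          (p.2 - p.1 / (q.1 - p.1) * (q.2 - p.2))).
  exists ((q'.2 - p'.2) / (q'.1 - p'.1) - (q.2 - p.2) / (q.1 - p.1)).
  by move=> u; rewrite /d /height; ring.
move=> st; rewrite -!/(d _) => dst.
have b0 : b != 0 by apply: contraNneq dst => b0; rewrite !dE b0 !mul0r.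
pose c := - a / b; have aE : a = - (b * c).
  by rewrite /c mulrCA divff // mulr1 opprK.
have dc : d c = 0 by rewrite dE aE addNr.
exists c; last by apply/esym/subr0_eq.
move: dst; rewrite !dE aE !(addrC (- _)) -!mulrBr.
have [bp|bn|/eqP] := ltgtP b 0; last by rewrite (negPf b0).
- rewrite !nmulr_rgt0 // !subr_lt0.
  by case: (ltP s c) (ltP t c) => h1 [] h2 //= _; rewrite ?(ltW h1) ?(ltW h2) ?h1 ?h2 //; lra.
rewrite !pmulr_rgt0 // !subr_gt0.
by case: (ltP c s) (ltP c t) => h1 [] h2 //= _; rewrite ?(ltW h1) ?(ltW h2) ?h1 ?h2 //; lra.
Qed.

(** Non-vertical segments are graphs over intervals of abscissae, so disjointness need only be
    tested where these intervals overlap. *)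
Definition disjoint_segments p q p' q' : Prop := forall t,
  (p.1 <= t <= q.1) || (q.1 <= t <= p.1) ->
  (p'.1 <= t <= q'.1) || (q'.1 <= t <= p'.1) ->
  height p q t != height p' q' t.

Definition above p q u := between p q u.1 && (u.2 < height p q u.1).
Definition below p q u := between p q u.1 && (height p q u.1 < u.2).

Lemma aboveC p q u : p.1 != q.1 -> above p q u = above q p u.
Proof. by move=> pq; rewrite /above betweenC heightC. Qed.
Lemma belowC p q u : p.1 != q.1 -> below p q u = below q p u.
Proof. by move=> pq; rewrite /below betweenC heightC. Qed.

(** Both sides together count the ends of the common interval of abscissae at which the second
    segment is the higher one. By [height_root] the order of the two segments is constant there, so
    the count is 0 or 2. *)
Lemma disjoint_segments_parity p q p' q' :
  p.1 != q.1 -> p'.1 != q'.1 -> p.1 != p'.1 -> p.1 != q'.1 ->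
  q.1 != p'.1 -> q.1 != q'.1 -> disjoint_segments p q p' q' ->
  above p' q' p (+) above p' q' q = below p q p' (+) below p q q'.
Proof.
wlog pq : p q / p.1 < q.1 => [hw|].
  move=> pq; move: (pq); rewrite neq_lt => /orP[/hw|/hw {}hw p'q' n1 n2 n3 n4 D].
    exact.
  rewrite addbC (hw _ p'q' n3 n4 n1 n2) 1?eq_sym //.
    by rewrite (belowC _ pq) (belowC q' pq).
  by move=> t t1 t2; rewrite -heightC // D // orbC.
wlog pq' : p' q' / p'.1 < q'.1 => [hw|].
  move=> npq npq'; move: (npq').
  rewrite neq_lt => /orP[/hw|/hw {}hw n1 n2 n3 n4 D]; first exact.
  rewrite [RHS]addbC -(hw npq _ n2 n1 n4 n3) 1?eq_sym //.
    by rewrite (aboveC _ npq') (aboveC q npq').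
  by move=> t t1 t2; rewrite -[height q' _ _]heightC // D // orbC.
move=> npq npq' n1 n2 n3 n4 D.
pose d t := 0 < height p' q' t - height p q t.
have dD s t : s <= t -> p.1 <= s -> t <= q.1 -> p'.1 <= s -> t <= q'.1 ->
    d s = d t.
  move=> st *; apply/eqP; apply: contraT => /height_root[] // c /andP[sc ct] /eqP.
  by rewrite (negPf (D _ _ _))//; apply/orP; left; apply/andP; split; lra.
have Ep : above p' q' p = between p' q' p.1 && d p.1.
  by rewrite /above /d height_l subr_gt0.
have Eq : above p' q' q = between p' q' q.1 && d q.1.
  by rewrite /above /d height_r // subr_gt0.
have Ep' : below p q p' = between p q p'.1 && d p'.1.
  by rewrite /below /d height_l subr_gt0.
have Eq' : below p q q' = between p q q'.1 && d q'.1.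
  by rewrite /below /d height_r // subr_gt0.
rewrite Ep Eq Ep' Eq' /between !(ltNge q'.1 _) !(ltNge q.1 _) !(ltNge _ q.1).
rewrite !(ltNge _ q'.1).
(* In each consistent order of the four abscissae, either there is no overlap or its two ends are
   among them, and [dD] identifies the values of [d] at these ends. *)
case: (ltgtP p.1 p'.1) n1 => // c1 _; case: (ltgtP p.1 q'.1) n2 => // c2 _;
case: (ltgtP q.1 p'.1) n3 => // c3 _; case: (ltgtP q.1 q'.1) n4 => // c4 _ /=;
rewrite ?(leNgt q'.1) ?(leNgt q.1) ?pq ?pq' ?c1 ?c2 ?c3 ?c4 /= ?andbF ?andbT ?orbF ?orFb /=
  ?addbF ?addFb;
try (exfalso; lra); rewrite ?addbb //.
all: try by apply: dD; rewrite // ltW.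
all: try by apply/esym; apply: dD; rewrite // ltW.
  have -> : d p'.1 = d q'.1 by apply: dD; rewrite // ltW.
  by rewrite addbb.
have -> : d p.1 = d q.1 by apply: dD; rewrite // ltW.
by rewrite addbb.
Qed.

(* Whether the shorter turn from [q - p] to [u - q] passes through the upward
   vertical direction; then [q] is a local extremum of the first coordinate. *)
Definition turn p q u : bool :=
  let c := (q.1 - p.1) * (u.2 - q.2) - (q.2 - p.2) * (u.1 - q.1) in
  [&& p.1 < q.1, u.1 < q.1 & 0 < c] || [&& q.1 < p.1, q.1 < u.1 & c < 0].

(** Unless [q] is a local extremum of the abscissa, neither edge overlaps the other. If it is one,
    exactly one of [p] and [u] lies over the other edge, and the difference of heights there is the
    cross product divided by a signed width. *)
Lemma turnE p q u : p.1 != q.1 -> q.1 != u.1 -> p.1 != u.1 ->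
  above q u p (+) below p q u = turn p q u.
Proof.
case: p q u => [p1 p2] [q1 q2] [u1 u2]; rewrite /above /below /turn /between /=.
rewrite /height /= => pq qu pu.
have -> : q2 + (p1 - q1) / (u1 - q1) * (u2 - q2) =
  p2 + ((q1 - p1) * (u2 - q2) - (q2 - p2) * (u1 - q1)) / (q1 - u1).
  by field; rewrite !subr_eq0 qu eq_sym qu.
have -> : p2 + (u1 - p1) / (q1 - p1) * (q2 - p2) = u2 -
   ((q1 - p1) * (u2 - q2) - (q2 - p2) * (u1 - q1)) / (q1 - p1).
  by field; rewrite !subr_eq0 eq_sym pq.
set c := _ - _ * _; rewrite ltrDl ltrBlDr ltrDl.
have [pq'|pq'|] := ltgtP p1 q1; last by move/eqP: pq.
- have -> : (0 < c / (q1 - p1)) = (0 < c) by rewrite pmulr_lgt0 ?invr_gt0 ?subr_gt0.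
  have [qu'|qu'|] := ltgtP q1 u1; last by move/eqP: qu.
  + have -> : (u1 < p1) = false by apply/negbTE; rewrite -leNgt; lra.
    by rewrite andbF.
  have -> : (0 < c / (q1 - u1)) = (0 < c) by rewrite pmulr_lgt0 ?invr_gt0 ?subr_gt0.
  by have [pu'|pu'|] := ltgtP p1 u1; rewrite ?andbF ?orbF ?addbF //=; move/eqP: pu.
have -> : (0 < c / (q1 - p1)) = (c < 0) by rewrite nmulr_lgt0 ?invr_lt0 ?subr_lt0.
have [qu'|qu'|] := ltgtP q1 u1; last by move/eqP: qu.
  have -> : (0 < c / (q1 - u1)) = (c < 0) by rewrite nmulr_lgt0 ?invr_lt0 ?subr_lt0.
  by have [pu'|pu'|] := ltgtP p1 u1; rewrite ?andbF ?orbF ?addbF //=; move/eqP: pu.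
have -> : (p1 < u1) = false by apply/negbTE; rewrite -leNgt; lra.
by rewrite /= ?andbF.
Qed.

End Segments.

Lemma addb_telescope (f : nat -> bool) n :
  \big[addb/false]_(i < n) (f i (+) f i.+1) = f 0 (+) f n.
Proof.
elim: n => [|n IH]; first by rewrite big_ord0 addbb.
by rewrite big_ord_recr /= IH -addbA [f n (+) _]addbA addbb addFb.
Qed.

(** For fixed [i] the index [j] runs from [i.+1] to [n.-1], and the sum over [j] telescopes. *)
Lemma addb_triangle (f : nat -> nat -> bool) n :
  \big[addb/false]_(j < n) \big[addb/false]_(i < j) (f j i (+) f j.+1 i) =
  \big[addb/false]_(i < n) (f n i (+) f i.+1 i).
Proof.
elim: n => [|n IH]; first by rewrite !big_ord0.
rewrite big_ord_recr /= {}IH [RHS]big_ord_recr /= addbb addbF -big_split /=.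
by apply: eq_bigr => i _; rewrite addbACA addbb addFb addbC.
Qed.

Section Polygon.
Variables (R : realFieldType) (v : nat -> R * R) (N : nat).

Hypothesis closed : v N.+3 = v 0.
Hypothesis inj_v : forall i j, (i < j < N.+3)%N -> (v i).1 != (v j).1.
Hypothesis disj_v : forall i j, (i.+1 < j < N.+3)%N -> ~~ ((i == 0) && (j == N.+2)) ->
  disjoint_segments (v i) (v i.+1) (v j) (v j.+1).
(** Adjacent edges share a vertex and so escape [disj_v]. This hypothesis and the next one replace
    it around [v 0], where the sums leave a remainder. *)
Hypothesis disj_v01 : between (v 1) (v 2) (v 0).1 ->
  height (v 1) (v 2) (v 0).1 != (v 0).2.
Hypothesis disj_v0 : forall t, t != (v 0).1 ->
  between (v 0) (v 1) t || (t == (v 1).1) ->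
  between (v N.+2) (v 0) t || (t == (v N.+2).1) ->
  height (v 0) (v 1) t != height (v N.+2) (v 0) t.

Lemma inj_vn i j : i != j -> (i < N.+3)%N -> (j < N.+3)%N -> (v i).1 != (v j).1.
Proof.
move=> ij i3 j3; case: (ltngtP i j) ij => // ij _; first by apply: inj_v; rewrite ij.
by rewrite eq_sym; apply: inj_v; rewrite ij.
Qed.

Let A k i := above (v i) (v i.+1) (v k).
Let B k i := below (v i) (v i.+1) (v k).
Let T i j := (A i j (+) A i.+1 j) (+) (B j i (+) B j.+1 i).

(* [T i j] is the parity of the number of endpoints of the interval over which
   the edges [i < j] overlap, counted when [j] lies above [i]: it vanishes for
   disjoint edges, and is the turn for consecutive ones. Summing [T i j] by the
   vertices instead, almost everything telescopes. *)
Let T_nonadjacent i j : (i.+1 < j < N.+3)%N -> ~~ ((i == 0) && (j == N.+2)) ->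
  T i j = false.
Proof.
move=> ij n0; have [ij1 j3] := andP ij.
have i3 : (i < N.+3)%N by apply: leq_trans j3; apply: ltnW; apply: ltnW.
have vS : (v j.+1).1 != (v i.+1).1 /\ (v j.+1).1 != (v j).1 /\ (v j.+1).1 != (v i).1.
  move: j3; rewrite ltnS leq_eqVlt => /orP[/eqP jN|j2].
    by rewrite jN closed; split; [|split]; apply: inj_vn; lia.
  by split; [|split]; apply: inj_vn; lia.
case: vS => v1 [v2 v3].
rewrite /T /A /B disjoint_segments_parity ?addbb //; last exact: disj_v.
all: rewrite 1?[_ == (v j.+1).1]eq_sym //.
all: by apply: inj_vn; lia.
Qed.

Let A_id k : A k k = false.
Proof. by rewrite /A /above between_l. Qed.
Let B_id k : B k k = false.
Proof. by rewrite /B /below between_l. Qed.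
Let B_S k : B k.+1 k = false.
Proof. by rewrite /B /below between_r. Qed.

Let T_adjacent i : (i < N.+2)%N -> T i i.+1 = turn (v i) (v i.+1) (v i.+2).
Proof.
move=> i2; rewrite /T A_id B_S addbF addFb /A /B.
move: i2; rewrite leq_eqVlt => /orP[/eqP [->]|i2]; last first.
  by apply: turnE; apply: inj_vn; lia.
by rewrite closed; apply: turnE; apply: inj_vn; lia.
Qed.

Let sum_T : \big[addb/false]_(j < N.+3) \big[addb/false]_(i < j) T i j =
  \big[addb/false]_(j < N.+3) (A 0 j (+) B 0 j).
Proof.
rewrite /T; under eq_bigr do rewrite big_split /= (addb_telescope (A^~ _)) A_id addbF.
rewrite [LHS]big_split /= [RHS]big_split /=; congr addb.
rewrite addb_triangle; apply: eq_bigr => i _.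
by rewrite B_S addbF /B closed.
Qed.

Lemma aboveDbelow (p q u : R * R) :
  (between p q u.1 -> height p q u.1 != u.2) ->
  above p q u (+) below p q u = between p q u.1.
Proof.
by rewrite /above /below; case: between => //= /(_ isT); case: ltgtP.
Qed.

(** The sum of all [T i j] consists of the turns away from [v 0] and of the pair of edges meeting at
    [v 0]. Summed by vertices it counts the edges passing over or under [v 0], which only depends on
    the sides of [v 0] on which its two neighbours lie. What remains is a statement about three
    points. *)
Theorem turn_parity :
  \big[addb/false]_(i < N.+2) turn (v i) (v i.+1) (v i.+2) (+)
    turn (v N.+2) (v 0) (v 1).
Proof.
have v02 : (v 0).1 != (v N.+2).1 by apply: inj_vn.
have v01 : (v 0).1 != (v 1).1 by apply: inj_vn.
have v12 : (v 1).1 != (v N.+2).1 by apply: inj_vn.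
(* An edge from [v 1] to [v N.+2] straddles the abscissa of [v 0] exactly when its ends lie on
   different sides, so the count telescopes. *)
have: \big[addb/false]_(j < N.+3) (A 0 j (+) B 0 j) =
    ((v 1).1 < (v 0).1) (+) ((v N.+2).1 < (v 0).1).
  rewrite big_ord_recl /= A_id B_id addFb big_ord_recr /=.
  rewrite {2}/A {2}/B /above /below closed between_r !addbF.
  rewrite -(addb_telescope (fun j => (v j.+1).1 < (v 0).1)).
  apply: eq_bigr => -[j jN] _ /=; rewrite /A /B /bump /= add1n.
  rewrite aboveDbelow; first by rewrite betweenE //; apply: inj_vn; lia.
  case: j jN => [_|j jN]; first exact: disj_v01.
  move=> b0; rewrite eq_sym -{1}(height_l (v 0) (v 1)).
  apply: (@disj_v 0 j.+2); [lia|lia|by rewrite lexx /=; case: ltgtP v01|].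
  by move: b0; rewrite /between; case/orP => /andP[/ltW-> /ltW->]; rewrite ?orbT.
rewrite -sum_T big_ord_recl big_ord0 addFb.
rewrite (eq_bigr (fun j : 'I_N.+2 => \big[addb/false]_(i < j) T i j.+1 (+)
   turn (v j) (v j.+1) (v j.+2))); last first.
  move=> j _; rewrite -T_adjacent //=; exact: big_ord_recr.
rewrite big_split /= big_ord_recr /= big1 ?addFb; last first.
  move=> [j jN] _; apply: big1 => -[i iN] _ /=; apply: T_nonadjacent => /=; move: iN => /=; lia.
rewrite big_ord_recl /= big1 ?addbF; last first.
  by move=> [i iN] _; apply: T_nonadjacent; rewrite /bump /=; lia.
set S := \big[_/_]_(i < _) _; move=> ST.
have -> : S = T 0 N.+2 (+) (((v 1).1 < (v 0).1) (+) ((v N.+2).1 < (v 0).1)).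
  by rewrite -ST addbA addbb addFb.
have TE : T 0 N.+2 = A 1 N.+2 (+) B N.+2 0.
  have A0 : A 0 N.+2 = false by rewrite /A /above closed between_r.
  have B0 : B N.+3 0 = false by rewrite /B /below closed between_l.
  by rewrite /T A0 B0 addbF.
rewrite TE /A /B -turnE // 1?eq_sym // closed.
have E1 : above (v N.+2) (v 0) (v 1) (+) below (v N.+2) (v 0) (v 1) =
    between (v N.+2) (v 0) (v 1).1.
  apply: aboveDbelow => b1; rewrite -(height_r v01) eq_sym.
  by apply: disj_v0; rewrite 1?eq_sym // ?eqxx ?orbT ?b1.
have E2 : above (v 0) (v 1) (v N.+2) (+) below (v 0) (v 1) (v N.+2) =
    between (v 0) (v 1) (v N.+2).1.
  apply: aboveDbelow => b1; rewrite -(height_l (v N.+2) (v 0)).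
  by apply: disj_v0; rewrite 1?eq_sym // ?eqxx ?orbT ?b1.
rewrite (addbC (above (v 0) _ _)) addbA -[X in X (+) _]addbA.
have v21 : (v N.+2).1 != (v 1).1 by rewrite eq_sym.
move: E1 E2; rewrite !betweenE // => E1 E2.
(* Of three distinct abscissae exactly one lies between the other two. This is where the odd parity
   comes from. *)
have : (above (v N.+2) (v 0) (v 1) (+) below (v N.+2) (v 0) (v 1)) (+)
   (above (v 0) (v 1) (v N.+2) (+) below (v 0) (v 1) (v N.+2)) (+)
   (((v 1).1 < (v 0).1) (+) ((v N.+2).1 < (v 0).1)).
  rewrite E1 E2; case: (ltgtP (v 0).1 (v 1).1) v01 => //;
  case: (ltgtP (v 0).1 (v N.+2).1) v02 => //;
  by case: (ltgtP (v 1).1 (v N.+2).1) v12 => //.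
by do !case: (_ < _); do !case: above; do !case: below.
Qed.

End Polygon.

(** * Turns through an arbitrary direction *)

Section Umlaufsatz.
Variable R : realType.
Implicit Types (p q u e f l : R * R).

Definition wind_odd l e f : bool :=
  let s := orient e f in [&& s == orient e l, s == orient l f & s != 0].

Definition dot e f : R := e.1 * f.1 + e.2 * f.2.

(* Coordinates, up to a factor, in which [l] is the upward vertical. *)
Definition frame l p : R * R := (cross p l, dot p l).

Lemma dot_gt0 l : l != 0 -> 0 < dot l l.
Proof.
case: l => a b; rewrite /dot -!expr2 /= => h.
rewrite lt_neqAle addr_ge0 ?sqr_ge0 // andbT eq_sym paddr_eq0 ?sqr_ge0 //.
by rewrite !sqrf_eq0; apply: contra h => /andP[/eqP-> /eqP->].
Qed.

Lemma frame_inj l : l != 0 -> injective (frame l).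
Proof.
move=> /dot_gt0; case: l => a b; rewrite /dot /= => h [p1 p2] [q1 q2].
rewrite /frame /cross /dot /= => -[E1 E2].
have : (p1 - q1) * (a * a + b * b) = 0.
  transitivity (b * ((p1 * b - p2 * a) - (q1 * b - q2 * a)) +
    a * ((p1 * a + p2 * b) - (q1 * a + q2 * b))); first by ring.
  by rewrite E1 E2 !subrr !mulr0 addr0.
have : (p2 - q2) * (a * a + b * b) = 0.
  transitivity (b * ((p1 * a + p2 * b) - (q1 * a + q2 * b)) -
    a * ((p1 * b - p2 * a) - (q1 * b - q2 * a))); first by ring.
  by rewrite E1 E2 !subrr !mulr0 subr0.
move=> /eqP; rewrite mulf_eq0 (gt_eqF h) orbF subr_eq0 => /eqP->.
by move=> /eqP; rewrite mulf_eq0 (gt_eqF h) orbF subr_eq0 => /eqP->.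
Qed.

Lemma frame_on_segment l p q t :
  frame l (on_segment p q t) = on_segment (frame l p) (frame l q) t.
Proof.
case: p q l => [p1 p2] [q1 q2] [a b]; rewrite /frame /on_segment /cross /dot /=.
by congr pair; rewrite /=  /GRing.scale /=; ring.
Qed.

Lemma on_segment_height p q (t : R) : p.1 != q.1 ->
  on_segment p q ((t - p.1) / (q.1 - p.1)) = (t, height p q t).
Proof.
case: p q => [p1 p2] [q1 q2] /= h; rewrite /on_segment /height.
congr pair => /=; rewrite /GRing.scale /=; field; by rewrite subr_eq0 eq_sym.
Qed.

Lemma on_segment0 p q : on_segment p q 0 = p.
Proof. by rewrite /on_segment scale0r addr0. Qed.

Lemma on_segment1 p q : on_segment p q 1 = q.
Proof. by rewrite /on_segment scale1r addrC subrK. Qed.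

Lemma turn_frame l p q u : l != 0 ->
  turn (frame l p) (frame l q) (frame l u) = wind_odd l (q - p) (u - q).
Proof.
move=> l0; rewrite /turn /wind_odd /orient.
have -> : ((frame l q).1 - (frame l p).1) * ((frame l u).2 - (frame l q).2) -
  ((frame l q).2 - (frame l p).2) * ((frame l u).1 - (frame l q).1) =
  dot l l * cross (q - p) (u - q).
  by case: p q u l {l0} => [p1 p2] [q1 q2] [u1 u2] [a b]; rewrite /frame /cross /dot /=; ring.
rewrite pmulr_rgt0 ?dot_gt0 // pmulr_rlt0 ?dot_gt0 //.
have -> : (frame l p).1 < (frame l q).1 = (0 < cross (q - p) l).
  by rewrite -subr_gt0; congr (_ < _); case: p q l {l0} => [? ?] [? ?] [? ?];
    rewrite /frame /cross /=; ring.
have -> : (frame l q).1 < (frame l p).1 = (cross (q - p) l < 0).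
  by rewrite -subr_lt0; congr (_ < _); case: p q l {l0} => [? ?] [? ?] [? ?];
    rewrite /frame /cross /=; ring.
have -> : (frame l u).1 < (frame l q).1 = (0 < cross l (u - q)).
  by rewrite -subr_gt0; congr (_ < _); case: u q l {l0} => [? ?] [? ?] [? ?];
    rewrite /frame /cross /=; ring.
have -> : (frame l q).1 < (frame l u).1 = (cross l (u - q) < 0).
  by rewrite -subr_lt0; congr (_ < _); case: u q l {l0} => [? ?] [? ?] [? ?];
    rewrite /frame /cross /=; ring.
by case: (sgzP (cross (q - p) l)); case: (sgzP (cross l (u - q)));
   case: (sgzP (cross (q - p) (u - q))).
Qed.

Lemma small_perturbation (s : seq (R * R)) : 0 \notin s ->
  exists2 eps : R, 0 < eps & forall d, 0 < d <= eps -> forall a, a \in s ->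
    a.1 + d * a.2 != 0 /\ (a.1 != 0 -> sgz (a.1 + d * a.2) = sgz a.1).
Proof.
elim: s => [|a s IH]; first by exists 1.
rewrite in_cons negb_or => /andP[a0 /IH[eps eps0 H]].
have [a1|a1] := eqVneq a.1 0.
  exists eps => // d dP b; rewrite in_cons => /orP[/eqP->|]; last exact: H.
  rewrite a1 eqxx add0r mulf_neq0 //; first by case/andP: dP => /gt_eqF->.
  by apply: contraNneq a0 => a2; apply/eqP; case: a a1 a2 => ? ? /= -> ->.
have b0 : 0 < `|a.2| + 1 by rewrite ltr_wpDl.
have e0 : 0 < `|a.1| / (`|a.2| + 1) by rewrite divr_gt0 ?normr_gt0.
(* The bound keeps [d * a.2] strictly smaller than [a.1] in absolute value; adding 1 makes this
   strict and covers [a.2 = 0]. *)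
exists (Num.min eps (`|a.1| / (`|a.2| + 1))); first by rewrite lt_min eps0.
move=> d /andP[d0]; rewrite le_min => /andP[d1 d2] b.
rewrite in_cons => /orP[/eqP->|]; last by apply: H; rewrite d0.
have lt : `|d * a.2| < `|a.1|.
  rewrite normrM gtr0_norm //.
  apply: (@lt_le_trans _ _ (d * (`|a.2| + 1))); first by rewrite ltr_pM2l // ltrDl.
  by rewrite -ler_pdivlMr.
move: lt; rewrite ltr_norml; set x := d * _; case/andP => lt1 lt2.
have [h|h|/eqP] := ltgtP a.1 0; last by rewrite (negPf a1).
  rewrite ltr0_norm // in lt1 lt2; split; first by rewrite lt_eqF //; lra.
  by move=> _; rewrite !ltr0_sgz //; lra.
rewrite gtr0_norm // in lt1 lt2; split; first by rewrite gt_eqF //; lra.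
by move=> _; rewrite !gtr0_sgz //; lra.
Qed.

Lemma segment_param (a b t : R) : a != b -> (a <= t <= b) || (b <= t <= a) ->
  0 <= (t - a) / (b - a) <= 1.
Proof.
have [ab|ab|//] := ltgtP a b.
  move=> _ h; have {}h : a <= t <= b by case/orP: h => // h; lra.
  by rewrite divr_ge0 ?ler_pdivrMr ?subr_gt0 //=; lra.
move=> _ h; have {}h : b <= t <= a by case/orP: h => // h; lra.
by rewrite -mulrNN -invrN !opprB divr_ge0 ?ler_pdivrMr ?subr_gt0 //=; lra.
Qed.

Lemma between_xor (a b t : R) : (a <= t) (+) (b <= t) -> (a <= t <= b) || (b <= t <= a).
Proof.
case: (lerP a t); case: (lerP b t) => //= h1 h2 _; first by rewrite (ltW h1).
by rewrite (ltW h2) ?orbT.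
Qed.

Lemma orientC e f : orient f e = - orient e f.
Proof. by rewrite /orient -sgzN; congr sgz; rewrite /cross; ring. Qed.

Section Polygon.
Variables (v : nat -> R * R) (N : nat) (l : R * R).
Hypothesis closed : v N.+3 = v 0.
Hypothesis inj_v : forall i j, (i < j < N.+3)%N -> v i != v j.
Hypothesis not_parallel : forall i, (i < N.+3)%N -> cross (v i.+1 - v i) l != 0.
Hypothesis simple : forall i j, (i < j < N.+3)%N -> forall s t : R,
  0 <= s <= 1 -> 0 <= t <= 1 ->
  on_segment (v i) (v i.+1) s = on_segment (v j) (v j.+1) t ->
  (j = i.+1 /\ on_segment (v i) (v i.+1) s = v j) \/
  ([/\ i = 0, j = N.+2 & on_segment (v i) (v i.+1) s = v 0])%N.

(* [umlaufsatz] is reduced to polygons whose vertices have distinct abscissae by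
   tilting [l]; the edges keep their position with respect to [l]. *)
Lemma generic_direction : exists l' : R * R, [/\ l' != 0,
  forall i j, (i < j < N.+3)%N -> cross (v i - v j) l' != 0 &
  forall i, (i < N.+3)%N -> orient (v i.+1 - v i) l' = orient (v i.+1 - v i) l].
Proof.
(* [l2] is [l] turned by a right angle. The products of a nonzero vector with [l] and [l2] do not
   both vanish, so a small multiple of [l2] added to [l] makes all of them nonzero. *)
pose l2 : R * R := (- l.2, l.1).
pose f (i j : nat) : R * R := (cross (v i - v j) l, cross (v i - v j) l2).
pose s := [seq f i j | i <- iota 0 N.+4, j <- [seq j <- iota 0 N.+4 | v i != v j]].
have l0 : l != 0.
  apply: contraTneq (not_parallel (ltn0Sn _)) => ->; rewrite negbK.
  by rewrite /cross /= !mulr0 subrr.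
have crossl2 p : cross p l2 = dot p l by rewrite /cross /dot /=; ring.
have : 0 \notin s.
  apply/negP => /allpairsPdep[i [j [_]]]; rewrite mem_filter => /andP[vij _].
  rewrite /f crossl2 => E; have : frame l (v i - v j) = frame l 0.
    by rewrite /frame -E /cross /dot /= !mul0r subrr addr0.
  by move/(frame_inj l0)/eqP; rewrite subr_eq0 (negPf vij).
case/small_perturbation => eps eps0 /(_ eps); rewrite lexx eps0 => /(_ isT) H.
have crossE p : cross p (l + eps *: l2) = cross p l + eps * cross p l2.
  by rewrite /cross /= /GRing.scale /=; ring.
have Hc i j : (i < N.+4)%N -> (j < N.+4)%N -> v i != v j ->
    cross (v i - v j) (l + eps *: l2) != 0 /\ (cross (v i - v j) l != 0 ->
    orient (v i - v j) (l + eps *: l2) = orient (v i - v j) l).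
  move=> i4 j4 vij; rewrite /orient !crossE; apply: (H (f i j)).
  by apply/allpairsPdep; exists i, j; rewrite mem_filter vij !mem_iota.
have vS i : (i < N.+3)%N -> v i.+1 != v i.
  move=> i3; rewrite -subr_eq0; apply: contraNneq (not_parallel i3) => ->.
  by rewrite /cross /= !mul0r subrr.
exists (l + eps *: l2); split.
- apply: contraTneq (vS 0 isT) => E; rewrite negbK; apply: contraT => n.
  by have [] := Hc 1 0 isT isT n; rewrite E /cross /= !mulr0 subrr eqxx.
- move=> i j ij; have [i4 j4] : (i < N.+4 /\ j < N.+4)%N by lia.
  by case: (Hc i j i4 j4 (inj_v ij)).
by move=> i i3; have [||//|_] := Hc i.+1 i; [lia|lia|exact: vS|apply; exact: not_parallel].
Qed.

Theorem umlaufsatz :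
  \big[addb/false]_(i < N.+2) wind_odd l (v i.+1 - v i) (v i.+2 - v i.+1) (+)
    wind_odd l (v 0 - v N.+2) (v 1 - v 0).
Proof.
have [l' [l'0 inj' orient']] := generic_direction.
pose V i := frame l' (v i).
have V1 i j : (i < j < N.+3)%N -> (V i).1 != (V j).1.
  move=> /inj'; apply: contraNneq; rewrite /V /frame /= => E.
  by apply/eqP; move: E; rewrite /cross /=; lra.
have VS i : (i < N.+3)%N -> (V i).1 != (V i.+1).1.
  rewrite ltnS leq_eqVlt => /orP[/eqP->|iN]; last by apply: V1; lia.
  by have -> : V N.+3 = V 0 by [rewrite /V closed]; rewrite eq_sym; apply: V1; lia.
have orient_wind i j : (i < N.+3)%N -> (j < N.+3)%N ->
    wind_odd l' (v i.+1 - v i) (v j.+1 - v j) = wind_odd l (v i.+1 - v i) (v j.+1 - v j).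
  move=> i3 j3; rewrite /wind_odd !(orientC (_ - _) l) (orientC (v j.+1 - _) l').
  by rewrite !orient'.
(* In the new frame all sides are graphs over the abscissa, so equal heights at [t] give a common
   point, to which [simple] applies. *)
have meet i j t : (i < j < N.+3)%N ->
    ((V i).1 <= t <= (V i.+1).1) || ((V i.+1).1 <= t <= (V i).1) ->
    ((V j).1 <= t <= (V j.+1).1) || ((V j.+1).1 <= t <= (V j).1) ->
    height (V i) (V i.+1) t = height (V j) (V j.+1) t ->
    (j = i.+1 /\ t = (V j).1) \/ [/\ i = 0, j = N.+2 & t = (V 0).1]%N.
  move=> ij ti tj E; have [i3 j3] : (i < N.+3 /\ j < N.+3)%N by lia.
  have := simple ij (segment_param (VS i i3) ti) (segment_param (VS j j3) tj).
  have Ei : frame l' (on_segment (v i) (v i.+1) ((t - (V i).1) / ((V i.+1).1 - (V i).1))) =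
      (t, height (V i) (V i.+1) t) by rewrite frame_on_segment on_segment_height ?VS.
  have Ej : frame l' (on_segment (v j) (v j.+1) ((t - (V j).1) / ((V j.+1).1 - (V j).1))) =
      (t, height (V j) (V j.+1) t) by rewrite frame_on_segment on_segment_height ?VS.
  case; first by apply: (frame_inj l'0); rewrite Ei Ej E.
    by case=> -> vj; left; split=> //; rewrite /V -vj Ei.
  by case=> i0 jN v0; right; split=> //; rewrite /V -v0 Ei.
have := turn_parity (v := V) (N := N).
rewrite /V !closed !turn_frame // -!/(V _) => H.
have V0 t : between (V 0) (V 1) t || (t == (V 1).1) ->
    ((V 0).1 <= t <= (V 1).1) || ((V 1).1 <= t <= (V 0).1).
  by case/orP => [/orP[]/andP[/ltW-> /ltW->]|/eqP->]; rewrite ?lexx ?orbT ?andbT //; case: ltgtP.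
have V2 t : between (V N.+2) (V 0) t || (t == (V N.+2).1) ->
    ((V N.+2).1 <= t <= (V 0).1) || ((V 0).1 <= t <= (V N.+2).1).
  by case/orP => [/orP[]/andP[/ltW-> /ltW->]|/eqP->]; rewrite ?lexx ?orbT ?andbT //; case: ltgtP.
have := orient_wind N.+2 0%N (ltnSn _) isT; rewrite closed => <-.
have -> : \big[addb/false]_(i < N.+2) wind_odd l (v i.+1 - v i) (v i.+2 - v i.+1) =
    \big[addb/false]_(i < N.+2) turn (V i) (V i.+1) (V i.+2).
  apply: eq_bigr => -[i iN] _ /=; rewrite turn_frame //.
  by apply/esym/orient_wind => //; lia.
apply: H => //.
- move=> i j ij n0 t ti tj; apply/eqP => E.
  have ij' : (i < j < N.+3)%N by lia.
  case: (meet i j t ij' ti tj E) => [[]|[i0 jN _]]; first lia.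
  by rewrite i0 jN !eqxx in n0.
- move=> b; apply/eqP => E.
  have t0 : ((V 0%N).1 <= (V 0%N).1 <= (V 1%N).1) || ((V 1%N).1 <= (V 0%N).1 <= (V 0%N).1).
    by rewrite lexx /=; case: ltgtP.
  have t1 : ((V 1%N).1 <= (V 0%N).1 <= (V 2%N).1) || ((V 2%N).1 <= (V 0%N).1 <= (V 1%N).1).
    by move: b; rewrite /between; case/orP => /andP[/ltW-> /ltW->]; rewrite ?orbT.
  case: (meet 0%N 1%N _ isT t0 t1); first by rewrite E height_l.
    by case=> _ /eqP; rewrite (negPf (V1 0%N 1%N isT)).
  by case.
move=> t t0 /V0 b0 /V2 b2; apply/eqP => E.
have := meet 0%N N.+2 t; have -> : V N.+3 = V 0%N by [rewrite /V closed].
move=> /(_ _ b0 b2 E) [|[]|[_ _ E2]].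
- lia.
- lia.
by rewrite E2 eqxx in t0.
Qed.
End Polygon.

End Umlaufsatz.

(** * Parity of the crossings of a ray with a polygon *)

Section Crossings.
Variable R : realType.
Implicit Types (p q u e f l : R * R).

Lemma affine_continuous (a b c : R) : continuous (fun q : R * R => a + b * q.1 + c * q.2).
Proof.
move=> q; apply: cvgD; first apply: cvgD.
- exact: cvg_cst.
- apply: cvgM; [exact: cvg_cst|exact: cvg_fst].
- apply: cvgM; [exact: cvg_cst|exact: cvg_snd].
Qed.

Lemma near_affine_lt (a b c : R) (q0 : R * R) : 0 < a + b * q0.1 + c * q0.2 ->
  \forall q \near q0, 0 < a + b * q.1 + c * q.2.
Proof.

by move=> h; have := cvgr_gt _ (@affine_continuous a b c q0); apply.
Qed.

(* Whether the upward ray from [q] meets the edge [p p']. A vertex exactly above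
   [q] counts as lying to the left of the ray, so that a ray through a vertex
   crosses a polygon there as often as its neighbours do modulo 2. *)
Definition crosses p p' q : bool :=
  ((p.1 <= q.1) (+) (p'.1 <= q.1)) && (q.2 < height p p' q.1).

(* The change of parity due to a vertex above [q0] cancels between its two edges. *)
Let jump q0 p q : bool := [&& p.1 == q0.1, q0.2 < p.2 & q.1 < q0.1].

Let near_le p q0 : p.1 != q0.1 ->
  \forall q \near q0, (p.1 <= q.1) = (p.1 <= q0.1).
Proof.
have [h _|h _|//] := ltgtP p.1 q0.1.
  have := @near_affine_lt (- p.1) 1 0 q0; rewrite mul0r addr0 mul1r addrC subr_gt0.
  move=> /(_ h); apply: filterS => q; rewrite mul0r addr0 mul1r addrC subr_gt0.
  by move=> /ltW.
have := @near_affine_lt p.1 (-1) 0 q0; rewrite mul0r addr0 mulN1r subr_gt0.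
move=> /(_ h); apply: filterS => q; rewrite mul0r addr0 mulN1r subr_gt0.
by move=> pq; apply/negbTE; rewrite -ltNge.
Qed.

Let near_height p p' q0 : height p p' q0.1 != q0.2 ->
  \forall q \near q0, (q.2 < height p p' q.1) = (q0.2 < height p p' q0.1).
Proof.
set a := p.2 - p.1 / (p'.1 - p.1) * (p'.2 - p.2).
set b := (p'.2 - p.2) / (p'.1 - p.1).
have hE t : height p p' t = a + b * t by rewrite /height /a /b; ring.
rewrite !hE => n0; have [h|h|E] := ltgtP q0.2 (a + b * q0.1); last by rewrite E eqxx in n0.
  have := @near_affine_lt a b (-1) q0; rewrite mulN1r subr_gt0.
  by move=> /(_ h); apply: filterS => q; rewrite mulN1r subr_gt0 hE.
have := @near_affine_lt (-a) (-b) 1 q0; rewrite mul1r mulNr -opprD addrC subr_gt0.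
move=> /(_ h); apply: filterS => q; rewrite mul1r mulNr -opprD addrC subr_gt0 hE.
by move=> hq; apply/negbTE; rewrite -leNgt ltW.
Qed.

(** If [q0] is on the line of the edge, it lies beyond its ends and the edge is crossed from no
    nearby point. Otherwise the comparison of heights is stable, and only an end straight above [q0]
    can change the outcome, which [jump] records. *)
Let near_crosses p p' q0 : p.1 != p'.1 ->
  (forall t, 0 <= t <= 1 -> on_segment p p' t != q0) ->
  \forall q \near q0, crosses p p' q =
    crosses p p' q0 (+) (jump q0 p q (+) jump q0 p' q).
Proof.
move=> pp' off; have [H|H] := eqVneq (height p p' q0.1) q0.2.
  have out : (p.1 < q0.1 /\ p'.1 < q0.1) \/ (q0.1 < p.1 /\ q0.1 < p'.1).
    have nin : ~~ ((p.1 <= q0.1 <= p'.1) || (p'.1 <= q0.1 <= p.1)).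
      apply/negP => h; have := off _ (segment_param pp' h).
      by rewrite on_segment_height // H; case: (q0) => ? ?; rewrite eqxx.
    by move: nin; case: (ltgtP p.1 q0.1); case: (ltgtP p'.1 q0.1) => /=; auto.
  have [n1 n2] : p.1 != q0.1 /\ p'.1 != q0.1.
    by case: out => -[h1 h2]; rewrite !neq_lt h1 h2 ?orbT.
  move: (near_le n1) (near_le n2); apply: filterS2 => q E1 E2.
  rewrite /crosses /jump E1 E2 (negPf n1) (negPf n2) /= addbF.
  have -> : (p.1 <= q0.1) (+) (p'.1 <= q0.1) = false; last by [].
  by case: out => -[h1 h2]; [rewrite !ltW | rewrite !leNgt h1 h2].
move: (near_height H); have [E|n1] := eqVneq p.1 q0.1.
  have n2 : p'.1 != q0.1 by rewrite -E eq_sym.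
  move: (near_le n2); apply: filterS2 => q E2 EH.
  rewrite /crosses /jump E2 EH E lexx eqxx (negPf n2) /= addbF -E height_l.
  by rewrite [q.1 < _]ltNge; move: (_ <= _) (_ <= _) (_ < _) => [] [] [].
have [E|n2] := eqVneq p'.1 q0.1.
  move: (near_le n1); apply: filterS2 => q E2 EH.
  rewrite /crosses /jump E2 EH E lexx eqxx (negPf n1) /= -E height_r //.
  by rewrite [q.1 < _]ltNge; move: (_ <= _) (_ <= _) (_ < _) => [] [] [].
move: (near_le n1) (near_le n2); apply: filterS3 => q E1 E2 EH.
by rewrite /crosses /jump E1 E2 EH (negPf n1) (negPf n2) addbF.
Qed.

Definition crossing_parity (v : nat -> R * R) m q : bool :=
  \big[addb/false]_(i < m) crosses (v i) (v i.+1) q.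

Lemma crossing_parity_near (v : nat -> R * R) m q0 :
  v m = v 0%N -> (forall i, (i < m)%N -> (v i).1 != (v i.+1).1) ->
  (forall i, (i < m)%N -> forall t, 0 <= t <= 1 -> on_segment (v i) (v i.+1) t != q0) ->
  \forall q \near q0, crossing_parity v m q = crossing_parity v m q0.
Proof.
move=> closed nv off.
have : forall n, (n <= m)%N -> \forall q \near q0,
    crossing_parity v n q = crossing_parity v n q0 (+) (jump q0 (v 0%N) q (+) jump q0 (v n) q).
  elim=> [_|n IH nm].
    by near=> q; rewrite /crossing_parity !big_ord0 addbb.
  have := near_crosses (nv _ nm) (off _ nm); move: (IH (ltnW nm)).
  apply: filterS2 => q E1 E2; rewrite /crossing_parity !big_ord_recr /=.
  rewrite -!/(crossing_parity v n _) E1 E2.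
  move: (crossing_parity _ _ _) (crosses _ _ _) (jump _ _ _) (jump _ _ _) (jump _ _ _).
  by move=> [] [] [] [] [].
move=> /(_ m (leqnn m)); apply: filterS => q ->.
by rewrite closed addbb addbF.
Unshelve. all: by end_near. Qed.

End Crossings.

(** * Connectedness of the complement of the disk *)

Section Outside.
Variable R : realType.
Implicit Types (p q u e f l : R * R).
Local Open Scope classical_set_scope.

Lemma on_segment_continuous p q : continuous (on_segment p q).
Proof.
move=> t; apply: cvgD; first exact: cvg_cst.
by apply: cvgZ; [exact: cvg_id | exact: cvg_cst].
Qed.

(** The parameters at which [phi] has its initial value form a relatively open and closed part of
    the connected interval [0, 1]. *)
Lemma locally_constant_segment (phi : R * R -> bool) p q :
  (forall t, 0 <= t <= 1 ->
     \forall z \near on_segment p q t, phi z = phi (on_segment p q t)) ->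
  phi p = phi q.
Proof.
move=> loc; pose A : set R := `[0, 1]%classic.
pose S : set R := [set t | phi (on_segment p q t) = phi p].
have nS t : A t -> \forall s \near t, phi (on_segment p q s) = phi (on_segment p q t).
  rewrite /A /= in_itv /= => /loc h; exact: (@on_segment_continuous p q t _ h).
have SA : A `&` S = A.
  apply: (@segment_connected R 0 1).
  - exists 0; split; first by rewrite /A /= in_itv /= lexx ler01.
    by rewrite /S /= on_segment0.
  - exists S°; first exact: open_interior.
    rewrite eqEsubset; split=> t [At St]; split => //; last exact: interior_subset.
    by move: (nS t At); apply: filterS => s E; rewrite /S /= E.
  exists (~` (~` S)°); first by apply: open_closedC; exact: open_interior.
  rewrite eqEsubset; split=> t [At St]; split => //.
    by move=> /interior_subset.
  apply: contrapT => nSt; apply: St; move: (nS t At); apply: filterS => s E.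
  by rewrite /S /= E.
have /= : (A `&` S) 1 by rewrite SA /A /= in_itv /= lexx ler01.
by case=> _; rewrite /S /= on_segment1.
Qed.

Lemma locally_constant_outside_unit (phi : R * R -> bool) :
  (forall z : R * R, 1 < z.1 ^+ 2 + z.2 ^+ 2 -> \forall z' \near z, phi z' = phi z) ->
  forall p q : R * R, 1 < p.1 ^+ 2 + p.2 ^+ 2 -> 1 < q.1 ^+ 2 + q.2 ^+ 2 -> phi p = phi q.
Proof.
move=> loc.
(* The half-plane where a x + b y > 1 is convex and misses the unit disk when the norm of (a, b) is
   at most 1. *)
have half (a b : R) p q : a ^+ 2 + b ^+ 2 <= 1 -> 1 < a * p.1 + b * p.2 ->
    1 < a * q.1 + b * q.2 -> phi p = phi q.
  move=> ab hp hq; apply: locally_constant_segment => t /andP[t0 t1]; apply: loc.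
  rewrite /on_segment /= /GRing.scale /=.
  set x := p.1 + _; set y := p.2 + _.
  have h : 1 < a * x + b * y.
    have -> : a * x + b * y = (1 - t) * (a * p.1 + b * p.2) + t * (a * q.1 + b * q.2).
      by rewrite /x /y; ring.
    move: hp hq; set P := _ + _; set Q := _ + _ => hp hq.
    have : 0 <= (1 - t) * (P - 1) by apply: mulr_ge0; lra.
    have : 0 <= t * (Q - 1) by apply: mulr_ge0; lra.
    have [->|t0'] := eqVneq t 0; first lra.
    have : 0 < t * (Q - 1) by apply: mulr_gt0; rewrite ?lt_neqAle 1?eq_sym ?t0' //; lra.
    lra.
  have := sqr_ge0 (a - x); have := sqr_ge0 (b - y); rewrite !sqrrB; lra.
have quad p : 1 < p.1 ^+ 2 + p.2 ^+ 2 -> [\/ 1 < p.1, p.1 < -1, 1 < p.2 | p.2 < -1] ->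
    phi p = phi (2, 2).
  move=> p1 [] h.
  - by apply: (half 1 0) => //=; lra.
  - rewrite (half (-1) 0 _ (-2, 2)) /=; [|lra|lra|lra].
    by apply: (half 0 1) => /=; lra.
  - by apply: (half 0 1) => /=; lra.
  - rewrite (half 0 (-1) _ (2, -2)) /=; [|lra|lra|lra].
    by apply: (half 1 0) => /=; lra.
suff all p : 1 < p.1 ^+ 2 + p.2 ^+ 2 -> phi p = phi (2, 2).
  by move=> p q p1 q1; rewrite all ?(all q).
(* A point outside the circle may still lie in the square of side 2 around it, out of reach of
   [quad]. Scaling it outwards moves its abscissa by 2 and takes it out of the square. *)
move=> p1; have radial (c : R) : 1 <= c -> phi p = phi (c *: p).
  move=> c1; apply: locally_constant_segment => t /andP[t0 t1]; apply: loc.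
  have -> : on_segment p (c *: p) t = (1 + t * (c - 1)) *: p.
    rewrite /on_segment; case: (p) => x y; rewrite /GRing.scale /= /scale_pair /=.
    by congr pair; rewrite /GRing.scale /=; ring.
  rewrite /= /GRing.scale /= !exprMn -mulrDr.
  have k1 : 1 <= 1 + t * (c - 1) by nra.
  set k := 1 + _ in k1 *; have : 1 <= k ^+ 2 by nra.
  nra.
have [h|h|h] := ltgtP p.1 0.
- rewrite (radial (1 - 2 / p.1)); last first.
    by rewrite lerDl oppr_ge0 mulr_ge0_le0 // invr_le0 ltW.
  have E : (1 - 2 / p.1) * p.1 = p.1 - 2 by rewrite mulrBl mul1r divfK ?lt_eqF.
  apply: quad; rewrite /= /GRing.scale /= ?E; last by apply: Or42; lra.
  by have := sqr_ge0 ((1 - 2 / p.1) * p.2); set w := _ ^+ 2 => w0; nra.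
- rewrite (radial (1 + 2 / p.1)); last by rewrite lerDl divr_ge0 // ltW.
  have E : (1 + 2 / p.1) * p.1 = p.1 + 2 by rewrite mulrDl mul1r divfK ?gt_eqF.
  apply: quad; rewrite /= /GRing.scale /= ?E; last by apply: Or41; lra.
  by have := sqr_ge0 ((1 + 2 / p.1) * p.2); set w := _ ^+ 2 => w0; nra.
apply: quad => //; move: p1; rewrite h expr0n /= add0r.
have [h2|h2|->] := ltgtP p.2 0; rewrite ?expr0n /= ?ltr10 //.
  by move=> p1; apply: Or44; nra.
by move=> p1; apply: Or43; nra.
Qed.

(** The homeomorphism in [closed_disk] is one of the whole plane, so it carries the outside of the
    unit disk onto the outside of [D]. *)
Lemma locally_constant_outside (D : set (R * R)) (phi : R * R -> bool) :
  closed_disk D -> (forall z, ~ D z -> \forall z' \near z, phi z' = phi z) ->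
  forall p q, ~ D p -> ~ D q -> phi p = phi q.
Proof.
move=> [f [g [cf cg fK gK DE]]] loc p q Dp Dq.
have out z : ~ D z -> 1 < (g z).1 ^+ 2 + (g z).2 ^+ 2.
  move=> Dz; rewrite ltNge; apply/negP => h; apply: Dz; rewrite DE /=.
  by exists (g z).
rewrite -(gK p) -(gK q); move: (out _ Dp) (out _ Dq).
apply: (@locally_constant_outside_unit (phi \o f)) => z z1 /=.
have : ~ D (f z).
  rewrite DE /= => -[z' z'1 /(can_inj fK) E]; move: z'1; rewrite /= E.
  by rewrite leNgt z1.
by move=> /loc h; exact: (cf z _ h).
Qed.

Lemma closed_disk_bounded (D : set (R * R)) : closed_disk D ->
  exists M : R, forall q, D q -> `|q.1| <= M /\ `|q.2| <= M.
Proof.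
move=> [f [g [cf cg fK gK DE]]].
pose K : set (R * R) := `[-1, 1]%classic `*` `[-1, 1]%classic.
have cK : compact (f @` K).
  apply: continuous_compact; first exact: continuous_subspaceT.
  by apply: compact_setX; apply: segment_compact.
have [M [Mr HM]] := compact_bounded cK.
exists (M + 1) => q; rewrite DE => -[p p1 <-].
have Kp : K p.
  have := p1; rewrite /K /= !in_itv /= => h.
  by split; apply/andP; split; nra.
have := HM (M + 1) _ (f p); rewrite ltrDl ltr01 => /(_ isT).
have ffp : (f @` K) (f p) by exists p.
by move=> /(_ ffp) /=; rewrite ProdNormedZmodule.prod_normE ge_max => /andP[].
Qed.

Lemma frame_continuous l : continuous (frame l).
Proof.
have c1 : continuous ((fun z : R * R => cross z l)).
  have -> : (fun z : R * R => cross z l) = (fun q : R * R => 0 + l.2 * q.1 + (- l.1) * q.2).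
    by apply: funext => z; rewrite /cross; ring.
  exact: affine_continuous.
have c2 : continuous ((fun z : R * R => dot z l)).
  have -> : (fun z : R * R => dot z l) = (fun q : R * R => 0 + l.1 * q.1 + l.2 * q.2).
    by apply: funext => z; rewrite /dot; ring.
  exact: affine_continuous.
by move=> q; exact: cvg_pair (c1 q) (c2 q).
Qed.

Lemma height_le p p' (t K : R) : (p.1 <= t) (+) (p'.1 <= t) ->
  p.2 <= K -> p'.2 <= K -> height p p' t <= K.
Proof.
move=> h k k'.
have pp' : p.1 != p'.1 by apply: contraTneq h => ->; rewrite addbb.
have : 0 <= (t - p.1) / (p'.1 - p.1) <= 1.
  exact: segment_param pp' (between_xor h).
by rewrite /height; set s := _ / _ => /andP[s0 s1]; nra.
Qed.

Definition ray_parity l (v : nat -> R * R) m q : bool :=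
  crossing_parity (frame l \o v) m (frame l q).

(** The parity is locally constant off the polygon, hence constant outside [D]. It vanishes at [q1],
    which lies farther in direction [l] than every point of [D], so that its ray meets nothing. *)
Theorem ray_parity_outside (D : set (R * R)) l (v : nat -> R * R) m q :
  closed_disk D -> l != 0 -> v m = v 0%N ->
  (forall i, (i < m)%N -> cross (v i.+1 - v i) l != 0) ->
  (forall i, (i < m)%N -> forall t, 0 <= t <= 1 -> D (on_segment (v i) (v i.+1) t)) ->
  ~ D q -> ray_parity l v m q = false.
Proof.
move=> diskD l0 closed npar inD Dq.
have [M HM] := closed_disk_bounded diskD.
pose K := M * (`|l.1| + `|l.2|).
have DK z : D z -> dot z l <= K.
  move=> /HM[h1 h2]; rewrite /dot /K mulrDr; apply: lerD;
  by apply: le_trans (ler_norm _) _; rewrite normrM ler_wpM2r.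
pose q1 := ((K + 1) / dot l l) *: l.
have q1K : dot q1 l = K + 1.
  have -> : dot q1 l = (K + 1) / dot l l * dot l l.
    by rewrite /q1 /dot /GRing.scale /= /GRing.scale /=; ring.
  by rewrite divfK // gt_eqF // dot_gt0.
have Dq1 : ~ D q1 by move=> /DK; rewrite q1K; lra.
rewrite (locally_constant_outside (phi := ray_parity l v m) diskD _ Dq Dq1).
  rewrite /ray_parity /crossing_parity big1 // => -[i im] _ /=.
  apply/negbTE; rewrite /crosses negb_and -implybE; apply/implyP => h; rewrite -leNgt.
  have vK j : (j <= m)%N -> (frame l (v j)).2 <= K.
    rewrite leq_eqVlt => /orP[/eqP->|jm].
      by rewrite closed -(on_segment0 (v 0%N) (v 1%N)); apply/DK/inD; [lia|rewrite lexx ler01].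
    by rewrite -(on_segment0 (v j) (v j.+1)); apply/DK/inD; [|rewrite lexx ler01].
  apply: (@le_trans _ _ K); last by rewrite /= q1K lerDl.
  apply: height_le; [exact: h|exact/vK/ltnW|exact: vK].
move=> z Dz; suff H : \forall y \near frame l z, crossing_parity (frame l \o v) m y =
    crossing_parity (frame l \o v) m (frame l z) by exact: (@frame_continuous l z _ H).
apply: crossing_parity_near; first by rewrite /= closed.
  move=> i im; rewrite /= -subr_eq0; have := npar _ im; apply: contraNneq.
  by rewrite /cross /=; lra.
move=> i im t t01; rewrite -frame_on_segment; apply/eqP => /(frame_inj l0) E.
by apply: Dz; rewrite -E; apply: inD.
Qed.

End Outside.

(** * Gauge rays in a planar drawing *)

Section SmallReal.
Variable R : realFieldType.

(** Such properties are stable under finite conjunction, so that one displacement of a ray serves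
    all edges at once. *)
Definition for_small (P : R -> Prop) : Prop :=
  exists2 d0 : R, 0 < d0 & forall d, 0 < d <= d0 -> P d.

Lemma for_small_and (P Q : R -> Prop) :
  for_small P -> for_small Q -> for_small (fun d => P d /\ Q d).
Proof.
move=> [d d0 Pd] [e e0 Qe]; exists (Num.min d e); first by rewrite lt_min d0.
by move=> x; rewrite le_min => /and3P[x0 xd xe]; split; [apply: Pd|apply: Qe]; apply/andP.
Qed.

Lemma for_small_forall (T : finType) (P : T -> R -> Prop) :
  (forall x, for_small (P x)) -> for_small (fun d => forall x, P x d).
Proof.
move=> H; have : for_small (fun d => forall x, x \in enum T -> P x d).
  elim: (enum T) => [|x s IH]; first by exists 1.
  have [d d0 Hd] := for_small_and (H x) IH; exists d => // e /Hd[He1 He2] y.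
  by rewrite in_cons => /orP[/eqP->|/He2].
by case=> d d0 Hd; exists d => // e /Hd He x; apply: He; rewrite mem_enum.
Qed.

Lemma for_small_ex (P : R -> Prop) : for_small P -> exists2 d, 0 < d & P d.
Proof. by case=> d d0 Pd; exists d => //; apply: Pd; rewrite d0 lexx. Qed.

End SmallReal.

Lemma near_for_small (R : realType) (P : set (R * R)) (x d : R * R) :
  (\forall z \near x, P z) -> for_small (fun t : R => P (x + t *: d)).
Proof.
move=> nP; have c : {for 0, continuous (fun t : R => x + t *: d)}.
  apply: cvgD; first exact: cvg_cst.
  by apply: cvgZ; [exact: cvg_id | exact: cvg_cst].
have /(c _) : \forall z \near x + 0 *: d, P z by rewrite scale0r addr0.
move=> /nbhs_ballP [e /= e0 He]; exists (e / 2); first by rewrite divr_gt0.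
move=> t /andP[t0 te]; apply: He; rewrite /ball /= sub0r normrN gtr0_norm //.
by apply: le_lt_trans te _; rewrite ltr_pdivrMr // ltr_pMr // ltr1n.
Qed.

Section CrossLemmas.
Variable R : realType.
Implicit Types p q u l : R * R.

Lemma crossC p q : cross p q = - cross q p.
Proof. by rewrite /cross; ring. Qed.
Lemma crossDl p q u : cross (p + q) u = cross p u + cross q u.
Proof. by rewrite /cross /=; ring. Qed.
Lemma crossNl p u : cross (- p) u = - cross p u.
Proof. by rewrite /cross /=; ring. Qed.
Lemma crossBl p q u : cross (p - q) u = cross p u - cross q u.
Proof. by rewrite crossDl crossNl. Qed.
Lemma crossZl (t : R) p u : cross (t *: p) u = t * cross p u.
Proof. by rewrite /cross /= /GRing.scale /=; ring. Qed.
Lemma crossDr p q u : cross u (p + q) = cross u p + cross u q.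
Proof. by rewrite /cross /=; ring. Qed.
Lemma crossNr p u : cross u (- p) = - cross u p.
Proof. by rewrite /cross /=; ring. Qed.
Lemma crossZr (t : R) p u : cross u (t *: p) = t * cross u p.
Proof. by rewrite /cross /= /GRing.scale /=; ring. Qed.
Lemma crossxx p : cross p p = 0.
Proof. by rewrite /cross; ring. Qed.

Lemma dotZl (t : R) p u : dot (t *: p) u = t * dot p u.
Proof. by rewrite /dot /= /GRing.scale /=; ring. Qed.

Lemma cross_eq0 p l : l != 0 -> cross p l = 0 -> exists s : R, p = s *: l.
Proof.
move=> l0 E; exists (dot p l / dot l l); apply: (frame_inj l0).
by rewrite /frame crossZl crossxx mulr0 E dotZl divfK // gt_eqF // dot_gt0.
Qed.
End CrossLemmas.

Section Boundary.
Variables (R : realType) (n : nat) (G : digraph n).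
Implicit Types (e f : edge G) (i j : 'I_n).
Variables (D : set (R * R)) (pos : vertex G -> R * R) (l : R * R).
Hypotheses (hpos : planar_drawing D pos) (hl : gauge_ray_direction D pos l).

(** A direction to the left of the boundary interval leaves [D] at once, and a parallel one stays on
    the interval, which contains no interior points of [D]. *)
Lemma inward_direction (a c : R * R) (t : 'I_n -> R) (i : 'I_n) (d : R * R) :
  clockwise_interval D a c -> 0 < t i < 1 -> pos (inl i) = on_segment a c (t i) ->
  for_small (fun s => interior D (pos (inl i) + s *: d)) -> cross (c - a) d < 0.
Proof.
move=> [ac H] ti Ei inD; have [_ _ near_i] := H _ ti.
rewrite -Ei in near_i.
have ac0 : c - a != 0 by rewrite subr_eq0 eq_sym.
have crossE s : cross (c - a) (pos (inl i) + s *: d - a) = s * cross (c - a) d.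
  rewrite Ei /on_segment addrAC (addrAC a) subrr add0r.
  by rewrite crossDr !crossZr crossxx mulr0 add0r.
have [//|h|h] := ltgtP (cross (c - a) d) 0.
  have [s s0 [/interior_subset Ds [_ ]]] :=
    for_small_ex (for_small_and inD (near_for_small d near_i)).
  by rewrite crossE mulr_gt0 // => /(_ isT)/(_ Ds).
have [s dE] : exists s, d = s *: (c - a).
  by apply: cross_eq0 => //; rewrite crossC h oppr0.
have mov x : pos (inl i) + x *: d = on_segment a c (t i + x * s).
  by rewrite Ei /on_segment dE scalerA scalerDl addrA.
have stay : for_small (fun x : R => 0 < t i + x * s < 1).
  have b0 : 0 < `|s| + 1 by rewrite ltr_wpDl.
  (* Such a displacement moves the parameter by less than its distance to 0 and to 1. *)
  exists (Num.min (t i) (1 - t i) / (2 * (`|s| + 1))).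
    by rewrite divr_gt0 ?mulr_gt0 // lt_min; apply/andP; split; lra.
  move=> x /andP[x0]; rewrite ler_pdivlMr ?mulr_gt0 // le_min => /andP[x1 x2].
  have : `|x * s| < x * (2 * (`|s| + 1)).
    by rewrite normrM gtr0_norm // ltr_pM2l //; have := normr_ge0 s; lra.
  by rewrite ltr_norml => /andP[x3 x4]; apply/andP; split; lra.
have [x x0 [inx tx]] := for_small_ex (for_small_and inD stay).
by have [_ + _] := H _ tx; rewrite -mov.
Qed.

(** [kappa] runs clockwise along the common boundary interval, with the disk on its right. This
    collects all that is used of the interval; the last clause holds because a segment between two
    boundary vertices stays inside it. *)
Lemma boundary_frame (i0 : 'I_n) : exists (kappa b0 : R * R) (t : 'I_n -> R),
  [/\ cross kappa l < 0,
      forall i, pos (inl i) = b0 + t i *: kappa,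
      forall i j : 'I_n, (i < j)%N -> t i < t j &
      [/\ forall i, ~ interior D (pos (inl i)),
         forall i d, for_small (fun s => interior D (pos (inl i) + s *: d)) ->
            cross kappa d < 0,
         forall i d, 0 < cross kappa d -> for_small (fun s => ~ D (pos (inl i) + s *: d)) &
         forall i j x, 0 <= x <= 1 -> D (on_segment (pos (inl i)) (pos (inl j)) x) /\
            ~ interior D (on_segment (pos (inl i)) (pos (inl j)) x)]].
Proof.
have [_ [a [c [t [ac t01 tmono Epos]]]] _ _ _] := hpos.
have [hl1 _ _] := hl.
have inw i d : for_small (fun s => interior D (pos (inl i) + s *: d)) ->
    cross (c - a) d < 0.
  exact: inward_direction.
exists (c - a), a, t; split => //.
- have [d d0 Hd] := hl1 i0; apply: (inw i0); exists (d / 2); first by rewrite divr_gt0.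
  by move=> s /andP[s0 sd]; apply: Hd; apply/andP; split => //; lra.
have [ac0 clock] := ac; split => //.
- by move=> i; rewrite Epos; case: (clock _ (t01 i)).
- move=> i d d0; have [_ _ near_i] := clock _ (t01 i); rewrite -Epos in near_i.
  have [e e0 He] := near_for_small d near_i; exists e => // s sP.
  have [_ ] := He s sP; apply.
  rewrite Epos /on_segment addrAC (addrAC a) subrr add0r crossDr !crossZr crossxx mulr0 add0r.
  by rewrite mulr_gt0 //; case/andP: sP.
move=> i j x /andP[x0 x1].
have -> : on_segment (pos (inl i)) (pos (inl j)) x = on_segment a c ((1 - x) * t i + x * t j).
  rewrite !Epos /on_segment; case: (a) => a1 a2; case: (c) => c1 c2.
  by congr pair; rewrite /= /GRing.scale /=; ring.
have : 0 < (1 - x) * t i + x * t j < 1.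
  have /andP[i0' i1] := t01 i; have /andP[j0 j1] := t01 j.
  have [->|xn1] := eqVneq x 1; first by apply/andP; split; lra.
  have : 0 < (1 - x) * t i by rewrite mulr_gt0 //; lra.
  have : 0 < (1 - x) * (1 - t i) by apply: mulr_gt0; lra.
  have : 0 <= x * t j by apply: mulr_ge0 => //; lra.
  have : 0 <= x * (1 - t j) by apply: mulr_ge0 => //; lra.
  by move=> *; apply/andP; split; lra.
by move=> /clock[].
Qed.

Lemma edge_dir_tail e i : tail G e = inl i ->
  for_small (fun s : R => interior D (pos (inl i) + s *: edge_dir pos e)).
Proof.
move=> ei; have [_ _ _ inD _] := hpos; exists (1 / 2); first by rewrite divr_gt0.
move=> s /andP[s0 s1]; have := inD e s; rewrite /edge_point /on_segment ei.
by rewrite /edge_dir ei; apply; apply/andP; split; lra.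
Qed.

Lemma edge_dir_head e i : head G e = inl i ->
  for_small (fun s : R => interior D (pos (inl i) + s *: (- edge_dir pos e))).
Proof.
move=> ei; have [_ _ _ inD _] := hpos; exists (1 / 2); first by rewrite divr_gt0.
move=> s /andP[s0 s1]; have := inD e (1 - s); rewrite /edge_point /on_segment /edge_dir ei.
have -> : pos (tail G e) + (1 - s) *: (pos (inl i) - pos (tail G e)) =
   pos (inl i) + s *: - (pos (inl i) - pos (tail G e)).
  case: (pos (inl i)) => a1 a2; case: (pos _) => c1 c2.
  by congr pair; rewrite /= /GRing.scale /=; ring.
by apply; apply/andP; split; lra.
Qed.

Lemma l_neq0 (i : 'I_n) : l != 0.
Proof.
have [kappa [b0 [t [kl _ _ _]]]] := boundary_frame i.
by apply: contraTneq kl => ->; rewrite /cross /= !mulr0 subrr ltxx.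
Qed.

(** Its direction would point to the right of [kappa] at the tail and to the left at the head. *)
Lemma no_boundary_edge e i j : tail G e = inl i -> head G e = inl j -> False.
Proof.
move=> ei ej; have [kappa [b0 [t [_ _ _ [_ inw _ _]]]]] := boundary_frame i.
have := inw _ _ (edge_dir_tail ei); have := inw _ _ (edge_dir_head ej).
by rewrite crossNr; lra.
Qed.

(** A boundary edge parallel to [l] would run along the gauge ray of its boundary vertex, since both
    point into the disk, and its other end would be an internal vertex on that ray. *)
Lemma edge_not_parallel e : cross (edge_dir pos e) l != 0.
Proof.
have [_ hl2 hl3] := hl.
have [/hl2//|/forallPn[i]] := boolP (internal_edge e).
have l0 := l_neq0 i.
have [kappa [b0 [t [kl _ _ [_ inw _ _]]]]] := boundary_frame i.
rewrite negb_and !negbK => /orP[] /eqP ei; apply/negP => /eqP E.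
- case ej: (head G e) => [j|v]; first exact: (no_boundary_edge ei ej).
  have [s Es] := cross_eq0 l0 E.
  have := inw _ _ (edge_dir_tail ei); rewrite Es crossZr nmulr_llt0 // => s0.
  have /eqP := hl3 i v s (ltW s0); apply.
  by rewrite /ray_point -Es /edge_dir ei ej addrC subrK.
case ej: (tail G e) => [j|v]; first exact: (no_boundary_edge ej ei).
have [s Es] := cross_eq0 l0 E.
have := inw _ _ (edge_dir_head ei); rewrite Es -scaleNr crossZr nmulr_llt0 // => s0.
have /eqP := hl3 i v (- s) (ltW s0); apply.
by rewrite /ray_point scaleNr -Es /edge_dir ei ej opprB addrC subrK.
Qed.

End Boundary.

Lemma end_param (R : realFieldType) (a b x u : R) :
  a != b -> ~~ ((a <= x) (+) (b <= x)) -> 0 <= u -> u <= 1 -> u * (b - a) = x - a ->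
  u = 0 \/ u = 1.
Proof.
move=> ab xor u0 u1 E.
have D : (u = 0 \/ u = 1) \/ (0 < u /\ u < 1).
  have [->|n0] := eqVneq u 0; first by do 2 left.
  have [->|n1] := eqVneq u 1; first by left; right.
  by right; rewrite !lt_neqAle u0 u1 n1 eq_sym n0.
case: D => // -[{}u0 {}u1]; exfalso.
have [lt|lt|/eqP] := ltgtP a b; last by rewrite (negPf ab).
  have v0 : 0 < u * (b - a) by rewrite mulr_gt0 // subr_gt0.
  have v1 : 0 < (1 - u) * (b - a) by rewrite mulr_gt0 // subr_gt0.
  have E1 : a <= x by lra.
  have E2 : (b <= x) = false by apply/negbTE; rewrite -ltNge; lra.
  by rewrite E1 E2 in xor.
have v0 : 0 < u * (a - b) by rewrite mulr_gt0 // subr_gt0.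
have v1 : 0 < (1 - u) * (a - b) by rewrite mulr_gt0 // subr_gt0.
have E1 : b <= x by lra.
have E2 : (a <= x) = false by apply/negbTE; rewrite -ltNge; lra.
by rewrite E1 E2 in xor.
Qed.

(** * Gauge rays pushed back behind their starting points *)

Section Hits.
Variables (R : realType) (n : nat) (G : digraph n).
Implicit Types (e f : edge G) (i j : 'I_n).
Variables (D : set (R * R)) (pos : vertex G -> R * R) (l : R * R).
Hypotheses (hpos : planar_drawing D pos) (hl : gauge_ray_direction D pos l).

Definition hit i e : bool :=
  `[< exists t u : R, [/\ 0 < t, 0 <= u <= 1 & ray_point pos l i t = edge_point pos e u] >].

Lemma ray_no_vertex i x (t : R) : 0 < t -> ray_point pos l i t != pos x.
Proof.
move=> t0; case: x => [j|v]; last by have [_ _] := hl; apply; exact: ltW.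
have [kappa [b0 [s [kl Eb _ _]]]] := boundary_frame hpos hl i.
apply/eqP => /(congr1 (cross kappa)); rewrite /ray_point !Eb !crossDr !crossZr crossxx.
rewrite !mulr0 !addr0 => /eqP; rewrite -subr_eq0 addrAC subrr add0r mulf_eq0.
by rewrite gt_eqF // lt_eqF.
Qed.

Lemma frame_below i (d : R) : frame l (pos (inl i) + d *: - l) =
  (cross (pos (inl i)) l, dot (pos (inl i)) l - d * dot l l).
Proof.
by case: (pos _) => a b; rewrite /frame /cross /dot /= /GRing.scale /=; congr pair; ring.
Qed.

Lemma frame_ray i (d : R) : frame l (ray_point pos l i d) =
  (cross (pos (inl i)) l, dot (pos (inl i)) l + d * dot l l).
Proof.
rewrite /ray_point; case: (pos _) => a b.
by rewrite /frame /cross /dot /= /GRing.scale /=; congr pair; ring.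
Qed.

Let F e := (frame l (pos (tail G e)), frame l (pos (head G e))).

Let F_neq e : (F e).1.1 != (F e).2.1.
Proof.
have := edge_not_parallel hpos hl e; apply: contraNneq.
by rewrite /edge_dir crossBl /F /= => ->; rewrite subrr.
Qed.

Lemma frame_edge_point e (u : R) : frame l (edge_point pos e u) = on_segment (F e).1 (F e).2 u.
Proof. exact: frame_on_segment. Qed.

Lemma edge_point_tail e : edge_point pos e 0 = pos (tail G e).
Proof. exact: on_segment0. Qed.
Lemma edge_point_head e : edge_point pos e 1 = pos (head G e).
Proof. exact: on_segment1. Qed.

Lemma on_segment_inv p q (u : R) : p.1 != q.1 :> R ->
  u = ((on_segment p q u).1 - p.1) / (q.1 - p.1).
Proof.
case: p q => [a b] [c d] /= ac; rewrite /GRing.scale /=; field.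
by rewrite subr_eq0 eq_sym.
Qed.

(** If the edge does not straddle the line of the ray, it could be hit only at a vertex, which the
    ray avoids. If it does, it meets that line at a height [h] different from that of [b_i], and a
    small step back does not change the order of the two. *)
Lemma crosses_hit i e : ~~ incident (inl i) e ->
  for_small (fun d : R => crosses (F e).1 (F e).2 (frame l (pos (inl i) + d *: - l)) = hit i e).
Proof.
move=> ninc; have l0 := l_neq0 hpos hl i; have ll := dot_gt0 l0.
set x0 := cross (pos (inl i)) l; set y0 := dot (pos (inl i)) l.
have [xor|xor] := boolP (((F e).1.1 <= x0) (+) ((F e).2.1 <= x0)); last first.
  exists 1 => // d _; rewrite frame_below /crosses /= (negPf xor).
  apply/esym/negbTE/asboolPn => -[t [u [t0 /andP[u0 u1] E]]].
  have := congr1 (frame l) E; rewrite frame_ray frame_edge_point => Ef.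
  have Ex := on_segment_inv u (F_neq e); rewrite -Ef /= in Ex.
  have {}Ex : u * ((F e).2.1 - (F e).1.1) = x0 - (F e).1.1.
    by rewrite Ex divfK // subr_eq0 eq_sym F_neq.
  case: (end_param (F_neq e) xor u0 u1 Ex).
    move=> Eu; move: E; rewrite Eu edge_point_tail => /eqP.
    by rewrite (negPf (ray_no_vertex _ _ t0)).
  move=> Eu; move: E; rewrite Eu edge_point_head => /eqP.
  by rewrite (negPf (ray_no_vertex _ _ t0)).
set h := height (F e).1 (F e).2 x0; set u0 := (x0 - (F e).1.1) / ((F e).2.1 - (F e).1.1).
have u01 : 0 <= u0 <= 1 := segment_param (F_neq e) (between_xor xor).
have Eu0 : frame l (edge_point pos e u0) = (x0, h).
  by rewrite frame_edge_point on_segment_height // F_neq.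
have hy : h != y0.
  apply/eqP => hy; have Ep : edge_point pos e u0 = pos (inl i).
    by apply: (frame_inj l0); rewrite Eu0 hy.
  have [_ _ _ inD [inj_pos _ _]] := hpos.
  have [kappa [b0 [s [_ _ _ [nint _ _ _]]]]] := boundary_frame hpos hl i.
  have [E0|n0] := eqVneq u0 0.
    move: Ep ninc; rewrite E0 edge_point_tail => /inj_pos Et.
    by rewrite /incident Et eqxx.
  have [E1|n1] := eqVneq u0 1.
    move: Ep ninc; rewrite E1 edge_point_head => /inj_pos Et.
    by rewrite /incident Et eqxx orbT.
  apply: (nint i); rewrite -Ep; apply: inD; case/andP: u01 => a b.
  by rewrite lt_neqAle eq_sym n0 a lt_neqAle n1.
have hitE : hit i e = (y0 < h).
  apply/asboolP/idP => [[t [u [t0 u1 E]]]|yh].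
    have := congr1 (frame l) E; rewrite frame_ray frame_edge_point => Ef.
    have Ex := on_segment_inv u (F_neq e); rewrite -Ef /= -/u0 in Ex.
    have Eh : dot (pos (inl i)) l + t * dot l l = h.
      have : frame l (edge_point pos e u) = (x0, h) by rewrite Ex Eu0.
      by rewrite -E frame_ray => /(congr1 snd).
    by rewrite -Eh ltrDl mulr_gt0.
  exists ((h - y0) / dot l l), u0; split => //; first by rewrite divr_gt0 ?subr_gt0.
  apply: (frame_inj l0); rewrite frame_ray Eu0 divfK ?gt_eqF //; congr pair.
  by rewrite -/y0 addrC subrK.
have E d : crosses (F e).1 (F e).2 (frame l (pos (inl i) + d *: - l)) = (y0 - d * dot l l < h).
  by rewrite frame_below /crosses /= xor.
have [yh|hy'|/eqP] := ltgtP y0 h; last by rewrite eq_sym (negPf hy).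
  exists 1 => // d /andP[d0 _]; rewrite E hitE yh.
  by apply: (lt_trans _ yh); rewrite gtrDl oppr_lt0 mulr_gt0.
exists ((y0 - h) / dot l l); first by rewrite divr_gt0 ?subr_gt0.
move=> d /andP[d0]; rewrite ler_pdivlMr // E hitE => dh.
by rewrite (ltNge y0) ltW //=; apply/negbTE; rewrite -leNgt; lra.
Qed.

(** The pushed-back ray passes through the tail, which counts as lying on its left, so the edge is
    crossed exactly when its head lies on the right. *)
Lemma crosses_source i e (d : R) : tail G e = inl i -> 0 < d ->
  crosses (F e).1 (F e).2 (frame l (pos (inl i) + d *: - l)) = (0 < cross (edge_dir pos e) l).
Proof.
move=> ei d0; have ll := dot_gt0 (l_neq0 hpos hl i).
rewrite frame_below /crosses /F /= ei lexx.
have -> : height (frame l (pos (inl i))) (frame l (pos (head G e))) (cross (pos (inl i)) l) =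
   dot (pos (inl i)) l by exact: height_l.
by rewrite gtrDl oppr_lt0 mulr_gt0 // andbT addTb -ltNge /edge_dir ei crossBl subr_gt0.
Qed.

Lemma hit_source i e : tail G e = inl i -> hit i e = false.
Proof.
move=> ei; apply/negbTE/asboolPn => -[t [u [t0 _ E]]].
have := congr1 (fun z => cross z l) E; rewrite /= /ray_point /edge_point /on_segment ei.
rewrite !crossDl !crossZl crossxx mulr0 addr0 -[LHS]addr0 => /addrI /esym/eqP.
rewrite mulf_eq0; have := edge_not_parallel hpos hl e; rewrite /edge_dir ei => /negPf ->.
rewrite orbF => /eqP u0; move: E; rewrite u0 edge_point_tail => /eqP.
by rewrite (negPf (ray_no_vertex _ _ t0)).
Qed.

End Hits.

(** * Parity of winding plus intersections *)

Section PathParity.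
Variables (T : Type) (wnd : T -> T -> bool) (itn : T -> bool).

(** Turns and intersections are parameters, so that loop erasure and the determinant are treated
    without geometry. *)
Fixpoint path_parity (e : T) (P : seq T) : bool :=
  itn e (+) (if P is f :: P' then wnd e f (+) path_parity f P' else false).

Definition cycle_parity (c : seq T) : bool :=
  if c is e :: c' then path_parity e c' (+) wnd (last e c') e else false.

Lemma path_parityE x0 e P : path_parity e P =
  \big[addb/false]_(i < size P) wnd (nth x0 (e :: P) i) (nth x0 (e :: P) i.+1) (+)
  \big[addb/false]_(f <- e :: P) itn f.
Proof.
elim: P e => [|f P IH] e /=; first by rewrite big_ord0 big_seq1 addbF.
rewrite big_ord_recl big_cons IH -[X in _ = (_ (+) X) (+) _]/(\big[addb/false]_(i < size P)
   wnd (nth x0 (f :: P) i) (nth x0 (f :: P) i.+1)) /=.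
by rewrite -!addbA !(addbCA _ (itn e)).
Qed.
End PathParity.

Lemma odd_sum (T : Type) (r : seq T) (F : T -> nat) :
  odd (\sum_(x <- r) F x) = \big[addb/false]_(x <- r) odd (F x).
Proof. exact: (big_morph odd oddD). Qed.

Lemma odd_card (T : finType) (A : {set T}) : odd #|A| = \big[addb/false]_x (x \in A).
Proof.
rewrite -sum1_card big_mkcond odd_sum; apply: eq_bigr => x _.
by case: (x \in A).
Qed.

Lemma card1_eq (T : finType) (A : {set T}) x y : #|A| = 1%N -> x \in A -> y \in A -> x = y.
Proof. by move=> /eqP/cards1P[z ->]; rewrite !inE => /eqP-> /eqP->. Qed.

Section Digraphs.
Variables (n : nat) (G : digraph n).
Implicit Types (e f : edge G).

Lemma indeg_gt0 e : (0 < indeg (head G e))%N.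
Proof. by apply/card_gt0P; exists e; rewrite inE. Qed.
Lemma outdeg_gt0 e : (0 < outdeg (tail G e))%N.
Proof. by apply/card_gt0P; exists e; rewrite inE. Qed.

Variables (k : nat) (I : 'I_k -> 'I_n).
Hypothesis hG : plabic G I.

Lemma boundary_no_through e f (i : 'I_n) : head G e = inl i -> tail G f = inl i -> False.
Proof.
case: hG => _ /(_ i) deg _ _ _ ei fi.
by have := indeg_gt0 e; have := outdeg_gt0 f; rewrite ei fi; lia.
Qed.

Lemma source_not_head e (s : 'I_k) : head G e = inl (I s) -> False.
Proof.
case: hG => -[_ /(_ (I s)) src] /(_ (I s)) deg _ _ _ es.
have := indeg_gt0 e; rewrite es; move: src.
have -> : I s \in ran I by apply: imset_f.
by move=> /eqP; lia.
Qed.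

Lemma source_edge_unique e f (s : 'I_k) :
  tail G e = inl (I s) -> tail G f = inl (I s) -> e = f.
Proof.
move=> es fs; have [_ /(_ (I s)) deg _ _ _] := hG.
have E : outdeg (inl (I s) : vertex G) = 1%N by have := outdeg_gt0 e; rewrite es; lia.
by apply: card1_eq E _ _; rewrite inE ?es ?fs.
Qed.

Lemma sink_edge_unique e f (i : 'I_n) : head G e = inl i -> head G f = inl i -> e = f.
Proof.
move=> ei fi; have [_ /(_ i) deg _ _ _] := hG.
have E : indeg (inl i : vertex G) = 1%N by have := indeg_gt0 e; rewrite ei; lia.
by apply: card1_eq E _ _; rewrite inE ?ei ?fi.
Qed.

Lemma source_inj : injective I.
Proof.
case: hG => -[inc _] _ _ _ _ r s E; apply/eqP; apply: contraT.
by rewrite -val_eqE neq_ltn => /orP[] /inc; rewrite E ltnn.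
Qed.

Lemma nth_follows x0 (e : edge G) P i : path (@follows n G) e P -> (i < size P)%N ->
  head G (nth x0 (e :: P) i) = tail G (nth x0 (e :: P) i.+1).
Proof. by move=> /(pathP x0) H /H /eqP. Qed.

Lemma nth_cycle x0 (c : seq (edge G)) i : path.cycle (@follows n G) c -> (i < size c)%N ->
  head G (nth x0 c i) = tail G (nth x0 c (i.+1 %% size c)).
Proof.
case: c => // e c /= /(pathP x0) H; rewrite size_rcons in H.
move=> ic; have /eqP := H i ic; rewrite -rcons_cons nth_rcons ic => ->.
rewrite nth_rcons; move: ic; rewrite ltnS leq_eqVlt => /orP[/eqP->|ic].
  by rewrite ltnn eqxx modnn.
by rewrite ic modn_small.
Qed.

End Digraphs.

Section Parity.
Variables (R : realType) (k n : nat) (G : digraph n) (I : 'I_k -> 'I_n).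
Implicit Types (e f : edge G) (i j : 'I_n).
Variables (D : set (R * R)) (pos : vertex G -> R * R) (l : R * R).
Hypotheses (hG : plabic G I) (hpos : planar_drawing D pos) (hl : gauge_ray_direction D pos l).

Definition wnd e f := wind_odd l (edge_dir pos e) (edge_dir pos f).
Definition itn e := odd (edge_int pos l I e).

Lemma wndE e f : wnd e f = odd `|local_wind pos l e f|%N.
Proof.
rewrite /wnd /wind_odd /local_wind; case: ifP => [/andP[-> ->]|] /=; last first.
  by move/negbT; rewrite negb_and => /orP[] /negPf->; rewrite ?andbF.
by rewrite /orient; case: sgzP.
Qed.

Lemma itnE e : itn e = \big[addb/false]_r hit pos l (I r) e.
Proof. by rewrite /itn /edge_int odd_card; apply: eq_bigr => r _; rewrite inE. Qed.

Lemma odd_abszD (x y : int) : odd `|(x + y)%R|%N = odd `|x|%N (+) odd `|y|%N.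
Proof. by lia. Qed.

Lemma path_parity_wind e P :
  odd `|(wind pos l (e :: P) + (path_int pos l I (e :: P))%:Z)%R|%N = path_parity wnd itn e P.
Proof.
elim: P e => [|f P IH] e.
  by rewrite /wind /path_int /= big_nil big_seq1 add0r addbF.
have -> : wind pos l [:: e, f & P] = local_wind pos l e f + wind pos l (f :: P).
  by rewrite /wind /= big_cons.
have -> : path_int pos l I [:: e, f & P] = (edge_int pos l I e + path_int pos l I (f :: P))%N.
  by rewrite /path_int big_cons.
by rewrite PoszD addrACA odd_abszD IH odd_abszD -wndE [wnd e f (+) _]addbC -addbA.
Qed.

Section Sequences.
Variables (x0 : vertex G) (e0 : edge G) (vs : seq (vertex G)) (es : seq (edge G)).
Hypotheses (uniq_vs : uniq vs) (size_es : (size es <= size vs)%N).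
Hypothesis tail_es : forall i : nat, (i < size es)%N -> tail G (nth e0 es i) = nth x0 vs i.
Hypothesis head_es : forall i : nat, (i < size es)%N ->
  head G (nth e0 es i) = nth x0 vs (i.+1 %% size vs).

(** Planarity yields a common incident vertex, and distinctness of the vertices leaves only
    consecutive positions. Indices modulo [size vs] cover cycles as well as paths, which have one
    edge fewer than vertices. *)
Lemma consecutive_edges_meet (i j : nat) (s t : R) : (i < j < size es)%N ->
  0 <= s <= 1 -> 0 <= t <= 1 ->
  edge_point pos (nth e0 es i) s = edge_point pos (nth e0 es j) t ->
  (j = i.+1 /\ edge_point pos (nth e0 es i) s = pos (nth x0 vs j)) \/
  [/\ i = 0%N, j.+1 = size vs & edge_point pos (nth e0 es i) s = pos (nth x0 vs 0)].
Proof.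
move=> /andP[ij js] s01 t01 E; have is_ := ltn_trans ij js.
have [_ _ _ _ [inj_pos _ meet]] := hpos.
have eq_nth a b : (a < size vs)%N -> (b < size vs)%N -> nth x0 vs a = nth x0 vs b -> a = b.
  by move=> av bv /eqP; rewrite nth_uniq // => /eqP.
have jm : (j < size vs)%N by exact: leq_trans size_es.
have im := ltn_trans ij jm.
have nij : nth e0 es i != nth e0 es j.
  apply: contraTneq ij => /(congr1 (tail G)).
  by rewrite !tail_es // => /eq_nth -> //; rewrite ltnn.
have [x [xi xj xE]] := meet _ _ nij s t s01 t01 E.
move: xi xj; rewrite /incident !tail_es // !head_es // (modn_small (m := i.+1)); last lia.
have im1 : (i.+1 < size vs)%N by lia.
have [jS|jS] := ltnP j.+1 (size vs).
  rewrite modn_small // => /orP[] /eqP Ex /orP[] /eqP; rewrite -Ex => /eq_nth Eq.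
  - by have := Eq jm im; lia.
  - by have := Eq jS im; lia.
  - have ji := Eq jm im1; left; split => //.
    by rewrite -xE -Ex ji.
  - by have := Eq jS im1; lia.
have jE : (j.+1 = size vs)%N by lia.
have m0 : (0 < size vs)%N by lia.
rewrite jE modnn => /orP[] /eqP Ex /orP[] /eqP; rewrite -Ex => /eq_nth Eq.
- by have := Eq jm im; lia.
- have i0 := Eq m0 im; right; split => //.
  by rewrite -xE -Ex -i0.
- have ji := Eq jm im1; left; split => //.
  by rewrite -xE -Ex ji.
- by have := Eq m0 im1; lia.
Qed.

End Sequences.
End Parity.

(** * Simple cycles have odd parity *)

Section Cycles.
Variables (R : realType) (k n : nat) (G : digraph n) (I : 'I_k -> 'I_n).
Implicit Types (e f : edge G) (i j : 'I_n).
Variables (D : set (R * R)) (pos : vertex G -> R * R) (l : R * R).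
Hypotheses (hG : plabic G I) (hpos : planar_drawing D pos) (hl : gauge_ray_direction D pos l).

Lemma edge_in_disk e (t : R) : 0 <= t <= 1 -> D (edge_point pos e t).
Proof.
have [_ [a [c [s [[_ clock] s01 _ Epos]]]] inV inE _] := hpos.
have inP x : D (pos x).
  case: x => [i|v]; last by apply: interior_subset; exact: inV.
  by rewrite Epos; have [Di _ _] := clock _ (s01 i).
move=> /andP[t0 t1].
have [->|n0] := eqVneq t 0; first by rewrite edge_point_tail.
have [->|n1] := eqVneq t 1; first by rewrite edge_point_head.
apply: interior_subset; apply: inE. by rewrite lt_neqAle eq_sym n0 t0 lt_neqAle n1.
Qed.

(* Moving the starting point of the ray slightly backwards takes it out of the
   disk, where [ray_parity_outside] applies, and changes no other intersection. *)
Lemma hits_near_source (s : 'I_k) : for_small (fun d : R =>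
  ~ D (pos (inl (I s)) + d *: - l) /\ forall e, ~~ incident (inl (I s)) e ->
    crosses (frame l (pos (tail G e))) (frame l (pos (head G e)))
      (frame l (pos (inl (I s)) + d *: - l)) = hit pos l (I s) e).
Proof.
apply: for_small_and.
  have [kappa [b0 [t [kl _ _ [_ _ out _]]]]] := boundary_frame hpos hl (I s).
  by apply: out; rewrite crossNr oppr_gt0.
apply: for_small_forall => e; have [inc|ninc] := boolP (incident (inl (I s)) e).
  by exists 1.
have [d d0 Hd] := crosses_hit hpos hl ninc.
by exists d => // x /Hd.
Qed.

(** Two straight edges with the same ends share their midpoint, which is not a vertex. Hence every
    cycle is a polygon with at least three sides. *)
Lemma no_two_cycle e f : head G e = tail G f -> head G f = tail G e -> False.
Proof.
move=> ef fe; have [_ _ _ _ [_ nloop meet]] := hpos.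
have half01 : 0 <= (2^-1 : R) <= 1 by rewrite invr_ge0 invf_le1 // ler0n ler1n.
have nef : e != f by apply: contra_neq (nloop e) => E; rewrite ef -E.
have [|x [xe _ E]] := meet e f nef 2^-1 2^-1 half01 half01.
  rewrite /edge_point ef fe /on_segment; case: (pos _) => a b; case: (pos _) => a' b'.
  by congr pair; rewrite /= /GRing.scale /=; field.
have /eqP := edge_not_parallel hpos hl e; apply.
have {}E := congr1 (fun z => cross z l) E.
move: xe E; rewrite /incident /edge_dir /edge_point /on_segment crossDl crossZl crossBl.
by move=> /orP[] /eqP <-; lra.
Qed.

Section CycleParity.
Variables (e0 : edge G) (c' : seq (edge G)).
Let c := e0 :: c'.
Hypotheses (cycle_c : path.cycle (@follows n G) c) (uniq_c : uniq [seq tail G f | f <- c]).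

Let vs := [seq tail G f | f <- c].
Let x0 := tail G e0.
Let v (i : nat) := pos (nth x0 vs (i %% size c)).

Let size_vs : size vs = size c. Proof. exact: size_map. Qed.

Let tail_es (i : nat) : (i < size c)%N -> tail G (nth e0 c i) = nth x0 vs i.
Proof. by move=> ic; rewrite /vs (nth_map e0). Qed.

Let head_es (i : nat) : (i < size c)%N -> head G (nth e0 c i) = nth x0 vs (i.+1 %% size vs).
Proof. by move=> ic; rewrite size_vs -tail_es ?ltn_mod //; exact: nth_cycle. Qed.

Let v_tail (i : nat) : (i < size c)%N -> v i = pos (tail G (nth e0 c i)).
Proof. by move=> ic; rewrite tail_es // /v modn_small. Qed.

Let v_head (i : nat) : (i < size c)%N -> v i.+1 = pos (head G (nth e0 c i)).
Proof. by move=> ic; rewrite head_es // /v size_vs. Qed.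

Let meet (i j : nat) (s t : R) : (i < j < size c)%N -> 0 <= s <= 1 -> 0 <= t <= 1 ->
  on_segment (v i) (v i.+1) s = on_segment (v j) (v j.+1) t ->
  (j = i.+1 /\ on_segment (v i) (v i.+1) s = v j) \/
  [/\ i = 0%N, j.+1 = size c & on_segment (v i) (v i.+1) s = v 0%N].
Proof.
move=> ij s01 t01; have [i1 j1] : (i < size c /\ j < size c)%N by lia.
rewrite (v_tail i1) (v_head i1) (v_tail j1) (v_head j1) => E.
have [|[]|[i0 jS E0]] := consecutive_edges_meet hpos uniq_c _ tail_es head_es ij s01 t01 E.
- by rewrite size_map.
- by move=> ji E1; left; split => //; rewrite (tail_es j1).
by right; rewrite -size_vs.
Qed.

Let size_c : (2 < size c)%N.
Proof.
have [_ _ _ _ [_ nloop _]] := hpos.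
move: cycle_c; rewrite /c; case: c' => [|f [|g c2]] //=; rewrite /follows !andbT.
  by move=> /eqP E; have := nloop e0; rewrite E eqxx.
by move=> /andP[/eqP ef /eqP fe]; case: (no_two_cycle ef fe).
Qed.

Let N := (size c - 3)%N.
Let sizeN : size c = N.+3. Proof. by rewrite /N; have := size_c; lia. Qed.

Let closed_v : v N.+3 = v 0%N.
Proof. by rewrite /v -sizeN modnn mod0n. Qed.

Let dir_v (i : nat) : (i < size c)%N -> v i.+1 - v i = edge_dir pos (nth e0 c i).
Proof. by move=> ic; rewrite (v_head ic) (v_tail ic). Qed.

Let cycle_wind : \big[addb/false]_(i < N.+2) wnd pos l (nth e0 c i) (nth e0 c i.+1) (+)
  wnd pos l (nth e0 c N.+2) e0.
Proof.
have [_ _ _ _ [inj_pos _ _]] := hpos.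
have -> : wnd pos l (nth e0 c N.+2) e0 = wind_odd l (v 0%N - v N.+2) (v 1%N - v 0%N).
  by rewrite /wnd -closed_v (dir_v (i := N.+2)) ?sizeN // closed_v (dir_v (i := 0%N)).
have -> : \big[addb/false]_(i < N.+2) wnd pos l (nth e0 c i) (nth e0 c i.+1) =
    \big[addb/false]_(i < N.+2) wind_odd l (v i.+1 - v i) (v i.+2 - v i.+1).
  by apply: eq_bigr => -[i iN] _; rewrite /wnd /= !dir_v // sizeN; lia.
apply: umlaufsatz closed_v _ _ _.
- move=> i j ij; apply/eqP => /inj_pos/eqP; rewrite !modn_small ?sizeN; [|lia|lia].
  by rewrite nth_uniq ?size_vs ?sizeN //; [case/andP: ij => /ltn_eqF->|lia|lia].
- by move=> i iN; rewrite dir_v ?sizeN //; apply: edge_not_parallel hpos hl _.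
move=> i j; rewrite -sizeN => ij s t s01 t01 E; have [[jE E1]|[i0 jE E1]] := meet ij s01 t01 E.
  by left.
by right; split => //; move: jE; rewrite sizeN => -[].
Qed.

(** Nothing enters a source, so no source lies on the cycle, and every hit is a crossing of the ray
    that starts just outside the disk. *)
Let cycle_hits (s : 'I_k) : \big[addb/false]_(f <- c) hit pos l (I s) f = false.
Proof.
have [diskD _ _ _ _] := hpos.
have [d d0 [Dq Hd]] := for_small_ex (hits_near_source s).
have l0 := l_neq0 hpos hl (I s).
have closed_c : v (size c) = v 0%N by rewrite -closed_v -sizeN.
have npar (i : nat) : (i < size c)%N -> cross (v i.+1 - v i) l != 0.
  by move=> ic; rewrite dir_v //; apply: edge_not_parallel hpos hl _.
have inD (i : nat) : (i < size c)%N -> forall t, 0 <= t <= 1 -> D (on_segment (v i) (v i.+1) t).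
  by move=> ic t t01; rewrite (v_head ic) (v_tail ic); exact: edge_in_disk.
have := ray_parity_outside diskD l0 closed_c npar inD Dq.
rewrite /ray_parity /crossing_parity => H; rewrite -[RHS]H {H}.
rewrite (big_nth e0) big_mkord; apply: eq_bigr => -[i ic] _ /=.
  rewrite (v_head ic) (v_tail ic) Hd //; apply/norP; split; apply/eqP.
    have /eqP <- := prev_cycle cycle_c (mem_nth e0 ic); exact: source_not_head.
  exact: source_not_head.
Qed.

Lemma gauge_cycle_odd : cycle_parity (wnd pos l) (itn I pos l) c.
Proof.
rewrite /cycle_parity /c (path_parityE _ _ e0).
have Ni : size c' = N.+2 by have := sizeN; rewrite /c /= => -[].
have -> : \big[addb/false]_(f <- e0 :: c') itn I pos l f = false.
  under eq_bigr do rewrite itnE.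
  by rewrite exchange_big big1 // => s _; exact: cycle_hits.
by rewrite addbF Ni -nth_last Ni /=; exact: cycle_wind.
Qed.

End CycleParity.
End Cycles.

Lemma strictly_between_xor (a b c : nat) : b != a -> b != c ->
  (minn a c < b < maxn a c)%N = (b <= c)%N (+) (b <= a)%N.
Proof. by lia. Qed.

Lemma strictly_between_end (a c : nat) : (minn a c < a < maxn a c)%N = false.
Proof. by lia. Qed.

(** * Simple paths from a source to a sink *)

Section Paths.
Variables (R : realType) (k n : nat) (G : digraph n) (I : 'I_k -> 'I_n).
Variables (D : set (R * R)) (pos : vertex G -> R * R) (l : R * R).
Hypotheses (hG : plabic G I) (hpos : planar_drawing D pos) (hl : gauge_ray_direction D pos l).
Variables (e0 : edge G) (P : seq (edge G)) (r : 'I_k) (j : 'I_n).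
Let es := e0 :: P.
Hypotheses (path_P : path (@follows n G) e0 P) (source_e0 : tail G e0 = inl (I r)).
Hypotheses (sink_P : head G (last e0 P) = inl j) (uniq_P : uniq [seq tail G f | f <- es]).

(** The sink is the tail of no edge and is appended. The side of index [size es] of the polygon is
    then the closing segment from the sink back to the source. *)
Let vs := rcons [seq tail G f | f <- es] (inl j).
Let x0 := tail G e0.
Let M := (size es).+1.
Let v (i : nat) := pos (nth x0 vs (i %% M)).

Let size_vs : size vs = M. Proof. by rewrite size_rcons size_map. Qed.

Let size_es : (1 < size es)%N.
Proof.
rewrite /es /=; case: P sink_P => //= he0.
by case: (no_boundary_edge hpos hl source_e0 he0).
Qed.

Let tail_pred f : f \in es -> f = e0 \/ exists g : edge G, head G g = tail G f.
Proof.
rewrite in_cons => /orP[/eqP->|fP]; first by left.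
right; move: path_P; case/splitPr: fP => P1 P2.
by rewrite cat_path /= => /and3P[_ /eqP E _]; exists (last e0 P1).
Qed.

Let uniq_vs : uniq vs.
Proof.
rewrite rcons_uniq uniq_P andbT; apply/mapP => -[f fes E].
exact: (boundary_no_through hG sink_P (esym E)).
Qed.

Let tail_es (i : nat) : (i < size es)%N -> tail G (nth e0 es i) = nth x0 vs i.
Proof. by move=> ic; rewrite nth_rcons size_map ic (nth_map e0). Qed.

Let head_es (i : nat) : (i < size es)%N -> head G (nth e0 es i) = nth x0 vs (i.+1 %% size vs).
Proof.
rewrite size_vs => ic; rewrite modn_small //.
move: (ic); rewrite ltnS leq_eqVlt => /orP[/eqP iE|iP].
  by rewrite iE nth_last /= sink_P nth_rcons size_map /= ltnn eqxx.
by rewrite (nth_follows e0 path_P) // tail_es.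
Qed.

Let v_tail (i : nat) : (i < size es)%N -> v i = pos (tail G (nth e0 es i)).
Proof. by move=> ic; rewrite tail_es // /v modn_small // ltnW. Qed.

Let v_head (i : nat) : (i < size es)%N -> v i.+1 = pos (head G (nth e0 es i)).
Proof. by move=> ic; rewrite head_es // /v size_vs. Qed.

Let v_0 : v 0 = pos (inl (I r)).
Proof. by rewrite v_tail //= source_e0. Qed.

Let v_sink : v (size es) = pos (inl j).
Proof. by rewrite v_head //= nth_last /= sink_P. Qed.

Let closed_v : v M = v 0%N.
Proof. by rewrite /v modnn. Qed.

Let N := (size P).-1.
Let sizeN : size es = N.+2.
Proof. by rewrite /N; have := size_es; rewrite /es /=; lia. Qed.

Let dir_v (i : nat) : (i < size es)%N -> v i.+1 - v i = edge_dir pos (nth e0 es i).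
Proof. by move=> ic; rewrite (v_head ic) (v_tail ic). Qed.

Let closing_in_boundary (t : R) : 0 <= t <= 1 ->
  D (on_segment (v N.+2) (v N.+3) t) /\ ~ interior D (on_segment (v N.+2) (v N.+3) t).
Proof.
have [kappa [b0 [s [_ _ _ [_ _ _ H]]]]] := boundary_frame hpos hl j.
rewrite -sizeN v_sink -/M closed_v v_0; exact: H.
Qed.

Let vM_closed : v N.+3 = v 0%N. Proof. by rewrite -sizeN. Qed.

(** The closing segment has no point interior to [D], so a path edge can meet it only at a boundary
    vertex, that is at the source or at the sink. *)
Let simple (i m : nat) : (i < m < N.+3)%N -> forall s t : R, 0 <= s <= 1 -> 0 <= t <= 1 ->
  on_segment (v i) (v i.+1) s = on_segment (v m) (v m.+1) t ->
  (m = i.+1 /\ on_segment (v i) (v i.+1) s = v m) \/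
  [/\ i = 0%N, m = N.+2 & on_segment (v i) (v i.+1) s = v 0%N].
Proof.
move=> im s t s01 t01; have i1 : (i < size es)%N by rewrite sizeN; lia.
have [mN|mN] := ltnP m N.+2.
  have m1 : (m < size es)%N by rewrite sizeN.
  have im' : (i < m < size es)%N by rewrite sizeN; lia.
  rewrite (v_tail i1) (v_head i1) (v_tail m1) (v_head m1) => E.
  have [|[mE E1]|[_ jS _]] := consecutive_edges_meet hpos uniq_vs _ tail_es head_es im' s01 t01 E.
  - by rewrite size_vs.
  - by left; rewrite (tail_es m1).
  - by move: jS; rewrite size_vs /M sizeN; lia.
have -> : m = N.+2 by lia.
move=> E; have [_ nint] := closing_in_boundary t01.
have [_ _ inV inE _] := hpos.
have vint (x : vertex G) : ~ interior D (pos x) -> exists b, x = inl b.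
  by case: x => [b _|u]; [exists b | case; exact: inV].
move: E nint => <-; rewrite (v_tail i1) (v_head i1) -/(edge_point pos _ s) => nint.
have [s0|s0] := eqVneq s 0.
  rewrite s0 edge_point_tail in nint *; have [b Eb] := vint _ nint.
  have [ei|[g ge]] := tail_pred (mem_nth e0 i1); last first.
    by case: (boundary_no_through hG (etrans ge Eb) Eb).
  have i0 : i = 0%N.
    apply/eqP; rewrite -(nth_uniq x0 (s := vs)) ?size_vs ?ltnS ?(ltnW i1) //.
    by rewrite -tail_es // ei -(tail_es (i := 0%N)).
  by right; split => //; rewrite (v_tail (i := 0%N)) // i0.
have [s1|s1] := eqVneq s 1; last first.
  case: nint; apply: inE; case/andP: s01 => a b.
  by rewrite lt_neqAle eq_sym s0 a lt_neqAle s1.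
rewrite s1 edge_point_head in nint *; have [b Eb] := vint _ nint.
have [iN|iN] := ltnP i N.+1; last first.
  left; have iE : i = N.+1 by rewrite sizeN in i1; lia.
  by split; [rewrite iE | rewrite -(v_head i1) iE].
have i1' : (i.+1 < size es)%N by rewrite sizeN.
case: (boundary_no_through hG Eb (f := nth e0 es i.+1)).
by rewrite tail_es // -Eb head_es // size_vs modn_small // ltnS ltnW.
Qed.

Section Frame.
Variables (kappa b0 : R * R) (t : 'I_n -> R).
Hypotheses (kl : cross kappa l < 0) (Eb : forall i, pos (inl i) = b0 + t i *: kappa).
Hypothesis t_mono : forall i i' : 'I_n, (i < i')%N -> t i < t i'.
Hypothesis inward : forall i d, for_small (fun s : R => interior D (pos (inl i) + s *: d)) ->
            cross kappa d < 0.

Let i0 := I r.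
Let j_neq : j != i0 :> nat.
Proof.
apply/eqP => /val_inj E; case: (boundary_no_through hG (e := last e0 P) (f := e0) (i := j)) => //.
by rewrite E.
Qed.

Let t_le (a b : 'I_n) : (t a <= t b) = (a <= b)%N.
Proof.
have [/t_mono/ltW//||/val_inj ->] := ltngtP a b; last by rewrite lexx.
by move=> /t_mono; rewrite leNgt => ->.
Qed.

Let t_lt (a b : 'I_n) : (t a < t b) = (a < b)%N.
Proof. by rewrite ltNge t_le ltnNge. Qed.

Let close_dir : v 0%N - v N.+2 = (t i0 - t j) *: kappa.
Proof. by rewrite -sizeN v_sink v_0 !Eb opprD addrACA subrr add0r scalerBl. Qed.

Let ti_neq : t i0 - t j != 0.
Proof. by rewrite subr_eq0 neq_lt !t_lt -neq_ltn eq_sym. Qed.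

(** All boundary vertices are on one line, so at the abscissa of [b_s] the closing segment has the
    height of [b_s], above the pushed-back point. Only the order of the labels is left to
    compare. *)
Let close_crosses (s : 'I_n) (d : R) : 0 < d ->
  crosses (frame l (v N.+2)) (frame l (v N.+3)) (frame l (pos (inl s) + d *: - l)) =
  (s <= j)%N (+) (s <= i0)%N.
Proof.
move=> d0; rewrite vM_closed v_0 -sizeN v_sink frame_below /crosses.
have -> : height (frame l (pos (inl j))) (frame l (pos (inl (I r)))) (cross (pos (inl s)) l) =
    dot (pos (inl s)) l.
  rewrite /height /frame /= !Eb !crossDl !crossZl.
  have dotDl p q : dot (p + q) l = dot p l + dot q l by rewrite /dot /=; ring.
  rewrite !dotDl !dotZl -/i0; have ti0 := ti_neq; have kl0 := lt_eqF kl.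
  field; apply/negP => /eqP E; move/eqP: ti0; apply.
  have : (t i0 - t j) * cross kappa l = 0 by rewrite mulrBl; lra.
  by move=> /eqP; rewrite mulf_eq0 kl0 orbF => /eqP.
rewrite gtrDl oppr_lt0 mulr_gt0 ?dot_gt0 ?(l_neq0 hpos hl j) // andbT /=.
by rewrite !Eb !crossDl !crossZl !lerD2l !ler_nM2r // !t_le.
Qed.

(** The last edge points out of the disk and [l] into it, so they lie on opposite sides of the
    closing segment. *)
Let wnd_close_in : wind_odd l (edge_dir pos (last e0 P)) (v 0%N - v N.+2) = false.
Proof.
have := inward (edge_dir_head hpos sink_P); rewrite crossNr oppr_lt0 => h.
rewrite close_dir /wind_odd; set u := edge_dir _ _ in h *; set c := t i0 - t j.
have -> : orient u (c *: kappa) = - orient l (c *: kappa).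
  rewrite /orient !crossZr !(crossC _ kappa) !mulrN !sgzN !sgzM.
  by rewrite (gtr0_sgz h) (ltr0_sgz kl) mulrN1 mulr1 opprK.
have : orient l (c *: kappa) != 0.
  by rewrite /orient sgz_eq0 crossZr mulf_neq0 // crossC oppr_eq0 (lt_eqF kl).
move: (orient l _) => s s_neq0; have -> : (- s == s) = false by lia.
by rewrite andbF.
Qed.

(** The first edge and [l] both point into the disk, so two of the three orientations agree and only
    the order of [l] and the first edge matters. *)
Let wnd_close_out : wind_odd l (v 0%N - v N.+2) (edge_dir pos e0) =
  ~~ ((j < i0)%N (+) (0 < cross (edge_dir pos e0) l)).
Proof.
have h := inward (edge_dir_tail hpos source_e0).
have np := edge_not_parallel hpos hl e0.
rewrite close_dir /wind_odd -t_lt; set u := edge_dir _ _ in h np *.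
rewrite -subr_gt0; set c := t i0 - t j.
have -> : orient (c *: kappa) u = - sgz c.
  by rewrite /orient crossZl sgzM (ltr0_sgz h) mulrN1.
have -> : orient (c *: kappa) l = - sgz c.
  by rewrite /orient crossZl sgzM (ltr0_sgz kl) mulrN1.
rewrite orientC eqxx /orient eqr_opp oppr_eq0 sgz_eq0 ti_neq andbT /=.
by case: (sgzP c) ti_neq => //; case: (sgzP (cross u l)) np => //.
Qed.

Let path_wind : \big[addb/false]_(i < N.+1) wnd pos l (nth e0 es i) (nth e0 es i.+1) =
  (j < i0)%N (+) (0 < cross (edge_dir pos e0) l).
Proof.
have [_ _ _ _ [inj_pos _ _]] := hpos.
have : \big[addb/false]_(i < N.+2) wind_odd l (v i.+1 - v i) (v i.+2 - v i.+1) (+)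
    wind_odd l (v 0%N - v N.+2) (v 1%N - v 0%N).
  apply: umlaufsatz vM_closed _ _ simple.
    move=> i m im; apply/eqP => /inj_pos/eqP; rewrite !modn_small ?/M ?sizeN; [|lia|lia].
    rewrite nth_uniq ?size_vs ?/M ?sizeN //; [|lia|lia].
    by case/andP: im => /ltn_eqF->.
  move=> i; rewrite ltnS leq_eqVlt => /orP[/eqP->|iN]; last first.
    by rewrite dir_v ?sizeN //; apply: edge_not_parallel hpos hl _.
  by rewrite vM_closed close_dir crossZl mulf_neq0 // (lt_eqF kl).
rewrite big_ord_recr /= vM_closed (dir_v (i := N.+1)) ?sizeN //.
have -> : nth e0 es N.+1 = last e0 P.
  by rewrite (last_nth e0); have := sizeN; rewrite /es /= => -[->].
rewrite wnd_close_in addbF (dir_v (i := 0%N)) // wnd_close_out.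
rewrite (eq_bigr (fun i : 'I_N.+1 => wnd pos l (nth e0 es i) (nth e0 es i.+1))).
  by set A := (j < i0)%N; set B := 0 < _; case: (\big[_/_]_(i < _) _); case: A; case: B.
by move=> [i iN] _; rewrite /wnd /= !dir_v // sizeN; lia.
Qed.

Let path_hits (s : 'I_k) : \big[addb/false]_(f <- es) hit pos l (I s) f =
  ((I s <= j)%N (+) (I s <= i0)%N) (+) ((s == r) && (0 < cross (edge_dir pos e0) l)).
Proof.
have [diskD _ _ _ _] := hpos.
have [d d0 [Dq Hd]] := for_small_ex (hits_near_source I hpos hl s).
have l0 := l_neq0 hpos hl (I s).
have npar (i : nat) : (i < M)%N -> cross (v i.+1 - v i) l != 0.
  rewrite ltnS leq_eqVlt => /orP[/eqP->|ic]; last first.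
    by rewrite dir_v //; apply: edge_not_parallel hpos hl _.
  by rewrite sizeN vM_closed close_dir crossZl mulf_neq0 // (lt_eqF kl).
have inD (i : nat) : (i < M)%N -> forall t, 0 <= t <= 1 -> D (on_segment (v i) (v i.+1) t).
  rewrite ltnS leq_eqVlt => /orP[/eqP->|ic] t' t01; last first.
    by rewrite (v_head ic) (v_tail ic); exact: (edge_in_disk hpos).
  by rewrite sizeN; case: (closing_in_boundary t01).
have := ray_parity_outside diskD l0 closed_v npar inD Dq.
rewrite (_ : M = N.+3) ?sizeN //; last by rewrite /M sizeN.
rewrite /ray_parity /crossing_parity big_ord_recr close_crosses //.
rewrite -sizeN (eq_bigr (fun i : 'I_(size es) => hit pos l (I s) (nth e0 es i) (+)
  ((i == 0 :> nat) && ((s == r) && (0 < cross (edge_dir pos e0) l))))); last first.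
  move=> [i ic] _ /=; rewrite (v_head ic) (v_tail ic).
  have [inc|ninc] := boolP (incident (inl (I s)) (nth e0 es i)); last first.
    rewrite Hd //; case: eqP => [i0'|_] /=; last by rewrite addbF.
    case: eqP => [sr|_] /=; last by rewrite addbF.
    by move: ninc; rewrite i0' sr /incident /= source_e0 eqxx.
  case/orP: inc => /eqP E; last by case: (source_not_head hG E).
  have [ei|[g ge]] := tail_pred (mem_nth e0 ic); last first.
    by case: (source_not_head hG (etrans ge E)).
  rewrite (crosses_source hpos hl E d0) (hit_source hpos hl E).
  have sr : s = r by apply: (source_inj hG); move: E; rewrite ei source_e0 => -[].
  have i0' : i = 0%N.
    apply/eqP; rewrite -(nth_uniq x0 (s := vs)) ?size_vs ?ltnS ?(ltnW ic) //.
    by rewrite -tail_es // ei -(tail_es (i := 0%N)).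
  by rewrite sr i0' !eqxx.
rewrite big_split /= (big_nth e0) big_mkord.
set S := \big[_/_]_(i < _) _.
rewrite (bigD1 (Ordinal (ltn_trans (ltn0Sn 0) size_es))) //= big1; last first.
  by move=> i; rewrite -val_eqE /= => /negPf->.
rewrite addbF; set X := _ && _; set a := (I s <= j)%N; set b := (I s <= i0)%N.
by case: S; case: X; case: a; case: b.
Qed.

(** The term for [s = r] in the intersections cancels against the winding: both contain the side of
    the first edge, and what is left compares [j] with [I r]. The other sources count exactly when
    they lie strictly between. *)
Lemma gauge_path_odd_frame : j \notin ran I ->
  path_parity (wnd pos l) (itn I pos l) e0 P = odd (nb_between I (I r) j).
Proof.
move=> jI; rewrite (path_parityE _ _ e0).
have -> : size P = N.+1 by have := sizeN => -[].
rewrite path_wind; set W := _ < cross _ _; rewrite -/i0.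
under eq_bigr do rewrite itnE.
rewrite exchange_big /=; under eq_bigr do rewrite path_hits.
rewrite /nb_between odd_card; under [RHS]eq_bigr do rewrite inE.
rewrite (bigD1 r) //= [RHS](bigD1 r) //= leqnn addbT eqxx.
rewrite strictly_between_end.
rewrite (eq_bigr (fun s : 'I_k => (minn (I r) j < I s < maxn (I r) j)%N)); last first.
  move=> s sr; rewrite (negPf sr) addbF.
  have sj : I s != j by apply: contraNneq jI => <-; apply: imset_f.
  have si : I s != I r by apply: contra_neq sr => /(source_inj hG).
  by rewrite strictly_between_xor.
rewrite ltnNge /i0; set a := (I r <= j)%N; set S := \big[_/_]_(i | _) _.
by rewrite -/W; case: a; case: W; case: S.
Qed.

End Frame.

Theorem gauge_path_odd : j \notin ran I ->
  path_parity (wnd pos l) (itn I pos l) e0 P = odd (nb_between I (I r) j).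
Proof.
have [kappa [b0 [t [kl Eb mono [_ inw _ _]]]]] := boundary_frame hpos hl j.
exact: gauge_path_odd_frame kl Eb mono inw.
Qed.
End Paths.

(** * Loop erasure *)

Section Walks.
Local Open Scope nat_scope.
Variables (n k : nat) (G : digraph n) (I : 'I_k -> 'I_n).
Implicit Types (e f g c d : edge G) (P L : seq (edge G)).
Hypothesis hG : plabic G I.

Lemma internal_through d c : head G d = tail G c -> exists u, tail G c = inr u.
Proof.
move=> E; case Ec: (tail G c) => [i|u]; last by exists u.
by case: (boundary_no_through hG (etrans E Ec) Ec).
Qed.

(** The alternatives are those of a white and of a black vertex. All later uses of the colours but
    [arriving_le1] go through this dichotomy. *)
Lemma in_or_out_unique d f c g : head G d = tail G c -> head G f = tail G c ->
  tail G g = tail G c -> d = f \/ c = g.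
Proof.
move=> dc fc gc; have [u Eu] := internal_through dc.
have [_ _ _ /(_ u) wb _] := hG; move: wb; case: ifP => _ H.
  by left; apply: card1_eq H _ _; rewrite inE -Eu ?dc ?fc.
by right; apply: card1_eq H _ _; rewrite inE -Eu ?gc.
Qed.

Variables (wnd : edge G -> edge G -> bool) (itn : edge G -> bool).
Notation parity := (path_parity wnd itn).

Lemma path_parity_cat e L c P :
  parity e (L ++ c :: P) = parity e L (+) wnd (last e L) c (+) parity c P.
Proof.
elim: L e => [|d L IH] e /=; first by rewrite addbF addbA.
by rewrite IH !addbA.
Qed.

Variables (r : 'I_k) (j : 'I_n) (e0 : edge G) (par : bool).
Hypothesis source_e0 : tail G e0 = inl (I r).
Hypothesis loopless : forall e, tail G e != head G e.
Hypothesis cycle_odd : forall c P, path.cycle (@follows n G) (c :: P) ->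
  uniq [seq tail G f | f <- c :: P] -> cycle_parity wnd itn (c :: P).
Hypothesis path_par : forall P, path (@follows n G) e0 P -> head G (last e0 P) = inl j ->
  uniq [seq tail G f | f <- e0 :: P] -> parity e0 P = par.

Let stack L := head G (last e0 L) :: rev [seq tail G f | f <- e0 :: L].

Let stack_rcons L f : head G (last e0 L) = tail G f ->
  stack (rcons L f) = head G f :: stack L.
Proof. by move=> E; rewrite /stack last_rcons -rcons_cons map_rcons rev_rcons E. Qed.

(* Removing a closed part [c ... f] of the walk at a vertex entered by [d] and
   [f] and left by [c] and [g] does not affect the other turns, because [d = f] or [c = g]. *)
Lemma remove_loop L c M f g P : head G (last e0 L) = tail G c -> head G f = tail G c ->
  tail G g = tail G c -> cycle_parity wnd itn (c :: rcons M f) ->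
  parity e0 (L ++ c :: M ++ f :: g :: P) = ~~ parity e0 (L ++ g :: P).
Proof.
move=> dc fc gc /=; rewrite last_rcons => cyc.
have -> : M ++ f :: g :: P = rcons M f ++ g :: P by rewrite cat_rcons.
rewrite !path_parity_cat last_rcons.
case: (in_or_out_unique dc fc gc) cyc => -> cyc; move: cyc.
  by case: (parity c _); case: (wnd _ _) => //=; case: (parity e0 _); case: (wnd _ _);
     case: (parity g _).
by case: (parity g (rcons _ _)); case: (wnd f g) => //=; case: (parity e0 _);
   case: (wnd _ _); case: (parity g _).
Qed.

(** [e0 :: L] is the part kept by the erasure so far, and [stack L] the corresponding state of
    [nb_loops_rec]. A step either extends [L] or closes a simple cycle, whose removal flips the
    parity and adds one loop. *)
Lemma walk_parity_stack P L : path (@follows n G) e0 (L ++ P) ->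
  head G (last e0 (L ++ P)) = inl j -> uniq (stack L) ->
  parity e0 (L ++ P) = par (+) odd (nb_loops_rec (stack L) [seq head G f | f <- P]).
Proof.
elim: P L => [|f P IH] L.
  rewrite cats0 /= addbF => pL lastL /andP[_]; rewrite rev_uniq => uL.
  exact: path_par.
move=> pth lst uL /=; case: ifP => [in_st|/negbT nst]; last first.
  have E : head G (last e0 L) = tail G f.
    by move: pth; rewrite cat_path => /andP[_ /= /andP[/eqP E _]].
  have := IH (rcons L f); rewrite stack_rcons // cat_rcons; apply => //.
  by rewrite cons_uniq nst.
move: (pth); rewrite cat_path /= => /and3P[pL /eqP fE pP].
(* The loop closes at the tail of an edge [c] of the kept part; [c] is not [e0], since nothing
   enters a source. *)
have : head G f \in [seq tail G g | g <- e0 :: L].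
  move: in_st; rewrite /stack in_cons mem_rev fE => /orP[/eqP E|//].
  by have := loopless f; rewrite E eqxx.
case/mapP => c cL Ec.
have ce0 : c != e0.
  by apply/eqP => E; case: (source_not_head hG (e := f) (s := r)); rewrite Ec E.
move: cL; rewrite in_cons (negPf ce0) /= => cL.
case/splitPr: cL pth lst uL in_st pL fE => L1 L2.
rewrite -catA cat_cons => pth lst uL in_st pL fE.
move: (pL); rewrite cat_path /= => /and3P[pL1 /eqP dc pL2].
(* The walk cannot stop here, because [c] leaves this vertex and nothing leaves [b_j]. So some [g]
   comes after the loop, as [remove_loop] requires. *)
case: P IH pP pth lst => [|g P] IH pP pth lst.
  have lj : head G f = inl j by move: lst; rewrite -cat_cons catA last_cat.
  by case: (boundary_no_through hG lj (f := c)); rewrite -Ec.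
move: pP => /= /andP[/eqP fg pP].
have stE : stack (L1 ++ c :: L2) =
    (head G (last c L2) :: rev [seq tail G f | f <- L2]) ++ stack L1.
  rewrite /stack last_cat last_cons -(cat_cons e0) map_cat rev_cat (map_cons _ c).
  by rewrite rev_cons cat_rcons dc.
have dropE : drop (index (head G f) (stack (L1 ++ c :: L2))) (stack (L1 ++ c :: L2)) = stack L1.
  move: uL; rewrite stE Ec cat_uniq => /and3P[_ /hasPn /(_ (tail G c)) H _].
  have cst : tail G c \in stack L1 by rewrite /stack dc in_cons eqxx.
  rewrite index_cat (negPf (H cst)) drop_cat ltnNge leq_addr /= addnC addnK.
  by rewrite /stack dc /= eqxx drop0.
rewrite dropE (remove_loop (c := c)) //.
- rewrite IH ?addbN //.
    rewrite cat_path pL1 /= /follows dc -fg Ec eqxx; exact: pP.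
  by move: lst; rewrite !(last_cat, last_cons).
  by move: uL; rewrite stE cat_uniq => /and3P[].
- by rewrite -fg.
apply: cycle_odd.
  by rewrite /= !rcons_path pL2 /= /follows last_rcons Ec eqxx andbT -fE last_cat.
move: uL; rewrite /stack fE cons_uniq mem_rev rev_uniq -cat_cons map_cat mem_cat negb_or.
rewrite cat_uniq => /andP[/andP[_ nf] /and3P[_ _ uc]].
by rewrite -rcons_cons map_rcons rcons_uniq nf.
Qed.

Lemma walk_parity P : path (@follows n G) e0 P -> head G (last e0 P) = inl j ->
  parity e0 P = par (+) odd (nb_loops (e0 :: P)).
Proof.
move=> pP lP; rewrite (walk_parity_stack (L := [::])) //=.
  by rewrite inE eq_sym (negPf (loopless e0)).
by rewrite inE eq_sym loopless.
Qed.

End Walks.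

(** * Flows and permutations *)

Section OddPerm.
Variables (T : finType) (s : {perm T}).

Lemma porbits_partition_sum (F : T -> bool) :
  \big[addb/false]_x F x =
  \big[addb/false]_(X in porbits s) \big[addb/false]_(x in X) F x.
Proof.
rewrite (partition_big (porbit s) [in porbits s]) /=; last by move=> x _; exact: imset_f.
apply: eq_bigr => X /imsetP[y _ ->]; apply: eq_bigl => x.
by rewrite eq_porbit_mem.
Qed.

(** The sign of a permutation is the parity of the number of points plus the number of orbits, which
    is a sum over orbits. *)
Lemma odd_perm_sum (F : T -> bool) :
  (forall y, \big[addb/false]_(x in porbit s y) F x = ~~ odd #|porbit s y|) ->
  \big[addb/false]_x F x = s.
Proof.
move=> H; rewrite porbits_partition_sum /odd_perm.
have -> : odd #|T| = \big[addb/false]_(X in porbits s) odd #|X|.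
  rewrite -sum1_card (big_morph odd oddD (erefl : odd 0 = false)) porbits_partition_sum.
  by apply: eq_bigr => X _; rewrite -sum1_card (big_morph odd oddD (erefl : odd 0 = false)).
have -> : odd #|porbits s| = \big[addb/false]_(X in porbits s) true.
  by rewrite -sum1_card (big_morph odd oddD (erefl : odd 0 = false)).
by rewrite -big_split /=; apply: eq_bigr => X /imsetP[y _ ->]; rewrite H addbT.
Qed.

Lemma mem_porbit_step y z : (s z \in porbit s y) = (z \in porbit s y).
Proof. by rewrite -!eq_porbit_mem; have := porbit_perm s 1 z; rewrite expg1 => ->. Qed.

Lemma porbit_moved y z : s y != y -> z \in porbit s y -> s z != z.
Proof.
move=> sy zy; apply: contraNneq sy => sz; move: zy; rewrite porbit_sym => /porbitP[i ->].
have -> : (s ^+ i)%g z = z by elim: i => [|i IH]; rewrite ?expg0 ?perm1 // expgSr permM IH.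
by rewrite sz.
Qed.

Lemma porbit_sum (F : T -> bool) y :
  \big[addb/false]_(z in porbit s y) F z = \big[addb/false]_(i < #|porbit s y|) F (iter i s y).
Proof.
rewrite (eq_bigl _ _ (porbit_traject s y)) -big_uniq ?uniq_traject_porbit //=.
rewrite (big_nth y) size_traject big_mkord; apply: eq_bigr => i _.
by rewrite nth_traject.
Qed.

End OddPerm.

(** * Determinants as sums over permutations along edges *)

Section Determinant.
Variables (A : comNzRingType) (m : nat) (x : 'I_m -> A).
Variables (follow : rel 'I_m) (twist : 'I_m -> 'I_m -> bool).

Definition transfer_mx : 'M[A]_m :=
  \matrix_(f, g) if follow f g then (-1) ^+ twist f g * x f else 0.

Definition follows_perm (s : 'S_m) : bool := [forall f, (s f != f) ==> follow f (s f)].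

Definition moved (s : 'S_m) : {set 'I_m} := [set f | s f != f].

Theorem det_transfer : (forall f, ~~ follow f f) ->
  (forall s y, follows_perm s -> s y != y ->
     \big[addb/false]_(z in porbit s y) twist z (s z)) ->
  \det (1%:M - transfer_mx) = \sum_(s | follows_perm s) \prod_(f in moved s) x f.
Proof.
move=> irr oddc; rewrite /determinant (bigID follows_perm) /= [X in _ + X]big1 ?addr0; last first.
  move=> s /forallPn[f]; rewrite negb_imply => /andP[sf nf].
  by rewrite (bigD1 f) //= !mxE eq_sym (negPf sf) (negPf nf) subr0 mul0r mulr0.
apply: eq_bigr => s sP.
have -> : \prod_i (1%:M - transfer_mx) i (s i) =
    (-1) ^+ (\big[addb/false]_f ((s f != f) && ~~ twist f (s f))) * \prod_(f in moved s) x f.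
  rewrite [X in _ = _ * X]big_mkcond.
  have -> : (-1 : A) ^+ (\big[addb/false]_f ((s f != f) && ~~ twist f (s f))) =
     \prod_f (-1) ^+ ((s f != f) && ~~ twist f (s f)).
    by rewrite (big_morph (fun b : bool => (-1 : A) ^+ b) (@signr_addb A)
      (expr0 (-1) : (-1 : A) ^+ false = 1)).
  rewrite -big_split /=; apply: eq_bigr => f _; rewrite !mxE inE.
  have [sf|sf] := eqVneq (s f) f.
    by rewrite sf (negPf (irr f)) subr0 mul1r.
  have /forallP/(_ f) := sP; rewrite sf /= => ->.
  by rewrite add0r -mulNr; case: twist; rewrite ?expr1 ?expr0 ?opprK.
rewrite (odd_perm_sum (s := s)) ?mulrA -?signr_addb ?addbb ?mul1r //.
move=> y; have [sy|sy] := eqVneq (s y) y.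
  have -> : porbit s y = [set y].
    apply/setP => z; rewrite inE -[z \in _]/(z \in porbit s y).
    apply/porbitP/eqP => [[i ->]|->]; last by exists 0; rewrite expg0 perm1.
    by elim: i => [|i IH]; rewrite ?expg0 ?perm1 // expgSr permM IH.
  by rewrite big_set1 sy eqxx cards1.
transitivity (\big[addb/false]_(z in porbit s y) (true (+) twist z (s z))).
  by apply: eq_bigr => z zy; rewrite (porbit_moved sy zy).
rewrite big_split /= (oddc _ _ sP sy) addbT.
by rewrite -sum1_card (big_morph odd oddD (erefl : odd 0 = false)).
Qed.

End Determinant.

Section Routes.
Local Open Scope nat_scope.
Variables (m : nat) (follow : rel 'I_m).
Hypothesis irr : forall f, ~~ follow f f.

(** Each element of [S] is sent to a follower inside [S] and all others are fixed; uniqueness of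
    predecessors makes this injective. *)
Lemma route_perm (S : {set 'I_m}) :
  (forall f, f \in S -> exists2 g, g \in S & follow f g) ->
  (forall f f' g, f \in S -> f' \in S -> g \in S -> follow f g -> follow f' g -> f = f') ->
  exists2 s : 'S_m, follows_perm follow s & moved s = S.
Proof.
move=> nxt inj; pose h f := if f \in S then odflt f [pick g in S | follow f g] else f.
have hS f : f \in S -> (h f \in S) && follow f (h f).
  move=> fS; rewrite /h fS; case: pickP => [g -> //|] H.
  by have [g gS fg] := nxt f fS; have := H g; rewrite gS fg.
have hN f : f \notin S -> h f = f by rewrite /h => /negPf->.
have h_inj : injective h.
  move=> f f' E; have [fS|fS] := boolP (f \in S); have [fS'|fS'] := boolP (f' \in S).
  - have /andP[g1 fg] := hS f fS; have /andP[_ fg'] := hS f' fS'.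
    by apply: (inj f f' (h f)) => //; rewrite E.
  - by have /andP[g1 fg] := hS f fS; case/negP: (fS'); rewrite -(hN _ fS') -E g1.
  - by have /andP[g1 fg] := hS f' fS'; case/negP: (fS); rewrite -(hN _ fS) E g1.
  - by rewrite -(hN _ fS) -(hN _ fS').
exists (perm h_inj).
  apply/forallP => f; rewrite permE; apply/implyP => hf.
  have [fS|fS] := boolP (f \in S); first by case/andP: (hS f fS).
  by rewrite hN // eqxx in hf.
apply/setP => f; rewrite inE permE; have [fS|fS] := boolP (f \in S); last by rewrite hN ?eqxx.
by apply/eqP => E; have /andP[_] := hS f fS; rewrite E (negPf (irr f)).
Qed.
End Routes.

Lemma sum_over_moved (A : nzSemiRingType) m (Pr : pred 'S_m) (Q : pred {set 'I_m})
    (F : {set 'I_m} -> A) :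
  (forall s, Pr s -> Q (moved s)) -> (forall S, Q S -> exists2 s, Pr s & moved s = S) ->
  (forall s s', Pr s -> Pr s' -> moved s = moved s' -> s = s') ->
  (\sum_(s | Pr s) F (moved s) = \sum_(S | Q S) F S)%R.
Proof.
move=> PQ QP inj; rewrite (partition_big (@moved m) Q) //=.
apply: eq_bigr => S /QP[s0 P0 ms0]; rewrite (big_pred1 s0) ?ms0 // => s /=.
apply/andP/eqP => [[Ps /eqP ms]|->]; last by rewrite P0 ms0.
by apply: inj => //; rewrite ms.
Qed.

(** * Flows as sets of moved edges *)

Section Flows.
Local Open Scope nat_scope.
Variables (n k : nat) (G : digraph n) (I : 'I_k -> 'I_n).
Implicit Types (e f g c d : edge G) (P L : seq (edge G)) (F S : {set edge G}).
Implicit Types (s : 'S_(nE G)).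
Hypothesis hG : plabic G I.
Variables (r : 'I_k) (j : 'I_n) (e0 ej : edge G).
Hypothesis source_e0 : tail G e0 = inl (I r).
Hypothesis sink_ej : head G ej = inl j.
Hypothesis loopless : forall e, tail G e != head G e.
Hypothesis e0_ej : e0 != ej.

Let no_through e f i : head G e = inl i -> tail G f = inl i -> False.
Proof. exact: (boundary_no_through hG). Qed.

Let ej_not_follows g : ~~ follows ej g.
Proof. by apply/eqP => E; apply: (no_through sink_ej (f := g)); rewrite -E. Qed.

Let not_follows_e0 f : ~~ follows f e0.
Proof. by apply/eqP => E; apply: (source_not_head hG (e := f) (s := r)); rewrite E. Qed.

(* The edge to the sink is treated as if it were followed by the edge from the
   source, which turns paths from the source to the sink into cycles. *)
Definition closed_follows : rel (edge G) :=
  fun f g => follows f g || ((f == ej) && (g == e0)).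

Lemma closed_follows_irr f : ~~ closed_follows f f.
Proof.
rewrite negb_or {1}/follows eq_sym loopless /=; apply/negP => /andP[/eqP-> /eqP E].
by move: e0_ej; rewrite E eqxx.
Qed.

Lemma follows_irr f : ~~ follows f f.
Proof. by rewrite /follows eq_sym loopless. Qed.

Let cfP s f : follows_perm closed_follows s -> s f != f ->
  follows f (s f) \/ f = ej /\ s f = e0.
Proof.
move=> /forallP/(_ f)/implyP H /H /orP[->|/andP[/eqP-> /eqP ->]]; first by left.
by right.
Qed.

Let follows_cf s f : follows_perm closed_follows s -> s f != f -> f != ej -> follows f (s f).
Proof. by move=> sP sf fj; case: (cfP sP sf) => // -[fE _]; rewrite fE eqxx in fj. Qed.

Lemma follows_perm_open s :
  follows_perm (@follows n G) s = follows_perm closed_follows s && (s ej != e0).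
Proof.
apply/idP/andP => [sP|[sP sj]].
  split; first by apply/forallP => f; apply/implyP; move/forallP/(_ f)/implyP: sP => H /H;
    rewrite /closed_follows => ->.
  apply/eqP => E; have := forallP sP ej; rewrite E e0_ej /=.
  by rewrite (negPf (ej_not_follows _)).
apply/forallP => f; apply/implyP => sf; case: (cfP sP sf) => // -[fE fE0].
by rewrite -fE fE0 eqxx in sj.
Qed.

(** If the images of [f] differ, then [f] and the predecessor under [s] of [s' f] are two edges
    entering a vertex that two edges leave, against the colours. Only the closing step is not
    governed by a vertex, hence the condition on [ej]. *)
Lemma moved_inj s s' : follows_perm closed_follows s -> follows_perm closed_follows s' ->
  (s ej == e0) = (s' ej == e0) -> moved s = moved s' -> s = s'.
Proof.
move=> sP sP' Ej Em; apply/permP => f.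
have Emf g : (s g != g) = (s' g != g) by have := congr1 (fun S => g \in S) Em; rewrite /= !inE.
have [sf|sf] := boolP (s f != f); last first.
  by have := sf; rewrite Emf; move/negPn/eqP: sf => -> /negPn/eqP ->.
have sf' := sf; rewrite Emf in sf'.
have [fj|fj] := eqVneq f ej.
  rewrite fj in sf sf' *; have [] := cfP sP sf; first by rewrite (negPf (ej_not_follows _)).
  by case=> _ E; move: Ej; rewrite E eqxx => /esym/eqP->.
have ff := follows_cf sP sf fj; have ff' := follows_cf sP' sf' fj.
pose d := (s^-1 (s' f))%g; have sd : s d = s' f by rewrite permKV.
have sdd : s d != d.
  apply/negP => /eqP E; have gd : s' f = d by rewrite -sd.
  have /eqP sd' : s' d == d by rewrite -[_ == _]negbK -Emf E eqxx.
  have df : d = f by apply: (@perm_inj _ s'); rewrite sd' gd.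
  by rewrite gd df eqxx in sf'.
case: (cfP sP sdd) => [fd|[dE dE0]]; last first.
  have E0 : s' ej = e0 by apply/eqP; rewrite -Ej -dE dE0.
  by case/eqP: fj; apply: (@perm_inj _ s'); rewrite E0 -sd dE0.
move: ff ff' fd; rewrite sd /follows => /eqP ff /eqP ff' /eqP fd.
case: (in_or_out_unique hG (d := f) (f := d) (c := s f) (g := s' f)) => //.
- by rewrite fd -ff' ff.
- by rewrite -ff' ff.
by move=> fE; rewrite {1}fE sd.
Qed.

Lemma arriving_moved s x : follows_perm closed_follows s -> x != inl j -> x != inl (I r) ->
  arriving (moved s) x = leaving (moved s) x.
Proof.
move=> sP xj xr; rewrite /arriving /leaving -(card_imset _ (@perm_inj _ s)).
apply: eq_card => g; rewrite !inE; apply/imsetP/andP => [[f]|[gm /eqP gx]].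
  rewrite !inE => /andP[sf /eqP fx] ->; split; first by rewrite (inj_eq perm_inj).
  rewrite -fx eq_sym; apply: follows_cf => //; apply: contraNneq xj => fj.
  by rewrite -fx fj sink_ej.
exists (s^-1 g)%g; last by rewrite permKV.
have sg : s ((s^-1 g)%g) != (s^-1 g)%g.
  by rewrite permKV; apply: contra_neq gm => {1}->; rewrite permKV.
rewrite !inE sg -gx /=.
case: (cfP sP sg) => [|[_]]; first by rewrite permKV /follows.
by rewrite permKV => gE; rewrite -gx gE source_e0 eqxx in xr.
Qed.

Let moved_pred s g : g \in moved s -> exists2 f, s f != f & s f = g.
Proof.
rewrite inE => sg; exists (s^-1 g)%g; last by rewrite permKV.
by rewrite permKV; apply: contra_neq sg => {1}->; rewrite permKV.
Qed.

Lemma conservative_moved s : follows_perm closed_follows s -> s ej != e0 ->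
  conservative_flow (moved s).
Proof.
move=> sP sj; have sP' : follows_perm (@follows n G) s by rewrite follows_perm_open sP.
apply/andP; split; last first.
  by apply/forallP => v; rewrite arriving_moved.
apply/forallP => f; apply/implyP => fm; apply/forallP => i; apply/andP; split; apply/eqP => E.
  have [d sd dE] := moved_pred fm; have := forallP sP' d; rewrite sd dE /follows => /eqP E'.
  exact: (no_through (etrans E' E) E).
move: fm; rewrite inE => sf; have := forallP sP' f; rewrite sf /= => /eqP E'.
by apply: (no_through E (f := s f)); rewrite -E'.
Qed.

Lemma edge_flow_moved s : follows_perm closed_follows s -> s ej = e0 ->
  edge_flow_to e0 j (moved s).
Proof.
move=> sP sj; have e0m : e0 \in moved s.
  by rewrite inE -{2}sj (inj_eq perm_inj).
have ejm : ej \in moved s by rewrite inE sj.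
apply/andP; split; last by apply/existsP; exists ej; rewrite ejm sink_ej eqxx.
apply/and4P; split => //.
- by apply/forallP => v; rewrite arriving_moved // eqxx implybT.
- have -> : arriving (moved s) (tail G e0) = 0.
    apply/eqP; rewrite cards_eq0; apply/eqP/setP => f; rewrite !inE source_e0.
    by apply/negP => /andP[_ /eqP]; exact: source_not_head.
  rewrite eq_sym; apply/cards1P; exists e0; apply/setP => f; rewrite !inE source_e0.
  apply/andP/eqP => [[_ /eqP fE]|->]; first exact: (source_edge_unique hG fE source_e0).
  split; last by rewrite source_e0.
  by move: e0m; rewrite inE.
apply/forallP => f; apply/implyP => fm; apply/forallP => i; apply/implyP => /eqP E.
have [d sd dE] := moved_pred fm; case: (cfP sP sd) => [|[_]]; rewrite dE; last by move=> ->.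
move=> /eqP E'.
by case: (no_through (etrans E' E) E).
Qed.

(** One of the two counts is bounded by 1 by the colour of [v], so a balanced set passes through [v]
    at most once. *)
Lemma arriving_le1 F v : arriving F (inr v) = leaving F (inr v) -> arriving F (inr v) <= 1.
Proof.
move=> E; have [_ _ _ /(_ v) wb _] := hG; move: wb; case: ifP => _ H.
  by rewrite -H; apply: subset_leq_card; apply/fintype.subsetP => f; rewrite !inE => /andP[].
by rewrite E -H; apply: subset_leq_card; apply/fintype.subsetP => f; rewrite !inE => /andP[].
Qed.

Lemma arriving_inj F v f f' : arriving F (inr v) = leaving F (inr v) -> f \in F -> f' \in F ->
  head G f = inr v -> head G f' = inr v -> f = f'.
Proof.
move=> /arriving_le1/card_le1_eqP H fF fF' fv fv'.
by apply: H; rewrite !inE ?fF ?fF' ?fv ?fv' eqxx.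
Qed.

Lemma leaving_ex F v f : arriving F (inr v) = leaving F (inr v) -> f \in F -> head G f = inr v ->
  exists2 g, g \in F & follows f g.
Proof.
move=> E fF fv; have : 0 < leaving F (inr v).
  by rewrite -E; apply/card_gt0P; exists f; rewrite !inE fF fv eqxx.
case/card_gt0P => g; rewrite !inE => /andP[gF /eqP gv]; exists g => //.
by rewrite /follows fv gv.
Qed.

Lemma conservative_perm C : conservative_flow C ->
  exists2 s, follows_perm closed_follows s && (s ej != e0) & moved s = C.
Proof.
move=> /andP[/forallP int /forallP bal].
have intP f : f \in C -> internal_edge f by move=> fC; have := int f; rewrite fC.
have headP_ f : f \in C -> exists v, head G f = inr v.
  move=> /intP/forallP H; case E: (head G f) => [i|v]; last by exists v.
  by have := H i; rewrite E eqxx andbF.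
have [||s sP sC] := @route_perm _ closed_follows closed_follows_irr C.
- move=> f fC; have [v fv] := headP_ f fC.
  by have [g gC fg] := leaving_ex (eqP (bal v)) fC fv; exists g => //; rewrite /closed_follows fg.
- move=> f f' g fC fC' gC.
  have ge0 : g != e0.
    by apply: contraTneq (intP g gC) => ->; apply/forallPn; exists (I r); rewrite source_e0 eqxx.
  rewrite /closed_follows (negPf ge0) !andbF !orbF => /eqP E /eqP E'.
  have [v fv] := headP_ f fC.
  by apply: (arriving_inj (eqP (bal v))) => //; rewrite E' -E.
exists s => //; rewrite sP /=; apply: contraTneq (e0_ej) => E.
have : ej \notin moved s.
  rewrite sC; apply/negP => /intP/forallP/(_ j).
  by rewrite sink_ej eqxx andbF.
by rewrite inE negbK E => /eqP ->; rewrite eqxx.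
Qed.

Lemma edge_flow_perm F : edge_flow_to e0 j F ->
  exists2 s, follows_perm closed_follows s && (s ej == e0) & moved s = F.
Proof.
move=> /andP[/and4P[e0F /forallP bal /eqP src /forallP only] /existsP[ej' /andP[ejF /eqP ejj]]].
have {ej' ejj} ejF : ej \in F by rewrite (sink_edge_unique hG sink_ej ejj).
have bal' v : arriving F (inr v) = leaving F (inr v).
  by apply/eqP; have := bal v; rewrite source_e0.
have onlyP f i : f \in F -> tail G f = inl i -> f = e0.
  by move=> fF E; have := only f; rewrite fF => /forallP/(_ i); rewrite E eqxx => /eqP.
(* Each edge arrives once and leaves once, and internal vertices are balanced, so as many edges
   arrive at the boundary as leave it. Only [e0] leaves it, hence [b_j] is the only sink reached. *)
have sink_only f i : f \in F -> head G f = inl i -> f = ej.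
  have sum_head : \sum_(x : vertex G) arriving F x = #|F|.
    rewrite -sum1_card (partition_big (@head n G) xpredT) //=.
    apply: eq_bigr => x _; rewrite /arriving /leaving -sum1_card.
    by apply: eq_bigl => g; rewrite inE.
  have sum_tail : \sum_(x : vertex G) leaving F x = #|F|.
    rewrite -sum1_card (partition_big (@tail n G) xpredT) //=.
    apply: eq_bigr => x _; rewrite /arriving /leaving -sum1_card.
    by apply: eq_bigl => g; rewrite inE.
  have sum_b : \sum_i arriving F (inl i) = \sum_i leaving F (inl i).
    have := sum_head; rewrite -sum_tail !big_sumType /=.
    by under [X in _ + X = _ -> _]eq_bigr do rewrite bal'; move/addIn.
  have sum_leave : \sum_i leaving F (inl i) = 1.
    rewrite (bigD1 (I r)) //= big1 => [|i' ir].
      rewrite addn0 -source_e0 -src source_e0; congr _.+1; apply/eqP.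
      rewrite cards_eq0; apply/eqP/setP => g; rewrite !inE.
      by apply/negP => /andP[_ /eqP]; exact: (source_not_head hG).
    apply/eqP; rewrite cards_eq0; apply/eqP/setP => g; rewrite !inE.
    apply/negP => /andP[gF /eqP E]; case/eqP: ir.
    by have gE := onlyP _ _ gF E; move: E; rewrite gE source_e0 => -[].
  move=> fF Ef; apply: (sink_edge_unique hG _ sink_ej); rewrite Ef; congr inl.
  apply/eqP; apply: contraT => ij.
  have gt0 g i' : g \in F -> head G g = inl i' -> 0 < arriving F (inl i').
    by move=> gF E; apply/card_gt0P; exists g; rewrite !inE gF E eqxx.
  have := sum_b; rewrite sum_leave (bigD1 j) //= (bigD1 i) //=.
  by have := gt0 _ _ fF Ef; have := gt0 _ _ ejF sink_ej; lia.
have [||s sP sC] := @route_perm _ closed_follows closed_follows_irr F.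
- move=> f fF; case E: (head G f) => [i|v].
    by exists e0 => //; rewrite /closed_follows (sink_only _ _ fF E) !eqxx orbT.
  by have [g gF fg] := leaving_ex (bal' v) fF E; exists g => //; rewrite /closed_follows fg.
- move=> f f' g fF fF' gF; have [->|ge0] := eqVneq g e0.
    by rewrite /closed_follows !(negPf (not_follows_e0 _)) eqxx !andbT => /eqP-> /eqP->.
  rewrite /closed_follows (negPf ge0) !andbF !orbF => /eqP E /eqP E'.
  case Ev: (head G f) => [i|v].
    by case/eqP: ge0; apply: (onlyP _ i) => //; rewrite -E.
  by apply: (arriving_inj (bal' v)) => //; rewrite E' -E.
exists s => //; rewrite sP /=.
have : ej \in moved s by rewrite sC.
rewrite inE => sj; have [|[_ ->]//] := cfP sP sj.
by rewrite (negPf (ej_not_follows _)).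
Qed.
End Flows.

(** * Orbits as cycles and paths *)

Section Orbits.
Local Open Scope nat_scope.
Variables (n k : nat) (G : digraph n) (I : 'I_k -> 'I_n).
Implicit Types (e f g c d : edge G) (P L : seq (edge G)) (F S : {set edge G}).
Implicit Types (s : 'S_(nE G)).
Hypothesis hG : plabic G I.
Variables (wnd : edge G -> edge G -> bool) (itn : edge G -> bool).
Variables (r : 'I_k) (j : 'I_n) (e0 ej : edge G) (par : bool).
Hypothesis source_e0 : tail G e0 = inl (I r).
Hypothesis sink_ej : head G ej = inl j.
Hypothesis loopless : forall e, tail G e != head G e.
Hypothesis e0_ej : e0 != ej.
Hypothesis cycle_odd : forall c P, path.cycle (@follows n G) (c :: P) ->
  uniq [seq tail G f | f <- c :: P] -> cycle_parity wnd itn (c :: P).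
Hypothesis path_par : forall P, path (@follows n G) e0 P -> head G (last e0 P) = inl j ->
  uniq [seq tail G f | f <- e0 :: P] -> path_parity wnd itn e0 P = par.

(** Passing twice through a vertex would use two entering and two leaving edges there, all
    distinct. *)
Lemma uniq_tails e P : path (@follows n G) e P -> uniq (e :: P) ->
  (forall f, f \in P -> tail G f != tail G e) -> uniq [seq tail G f | f <- e :: P].
Proof.
move=> pP uP ne; rewrite map_inj_in_uniq // => f g.
have pred_ h : h \in P -> exists2 d, head G d = tail G h & exists2 i, i < size P &
    d = nth e (e :: P) i /\ h = nth e P i.
  move=> hP; have iP : index h P < size P by rewrite index_mem.
  exists (nth e (e :: P) (index h P)); first by rewrite (nth_follows e pP iP) /= nth_index.
  by exists (index h P) => //; rewrite nth_index.
rewrite !in_cons => /orP[/eqP->|fP] /orP[/eqP->|gP] //.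
- by move=> E; have := ne g gP; rewrite E eqxx.
- by move=> E; have := ne f fP; rewrite E eqxx.
move=> E; have [d dE [i iP [di fi]]] := pred_ f fP; have [d' dE' [i' iP' [di' gi]]] := pred_ g gP.
case: (in_or_out_unique hG (d := d) (f := d') (c := f) (g := g)) => //.
  by rewrite E.
rewrite di di' => /eqP; rewrite nth_uniq //= ?ltnS; [|exact: ltnW|exact: ltnW].
by rewrite fi gi => /eqP->.
Qed.

Lemma traject_parity (s : edge G -> edge G) y N : path_parity wnd itn y (traject s (s y) N) =
  \big[addb/false]_(i < N) (itn (iter i s y) (+) wnd (iter i s y) (iter i.+1 s y)) (+)
    itn (iter N s y).
Proof.
elim: N y => [|N IH] y /=; first by rewrite big_ord0 addbF.
rewrite IH big_ord_recl /= -iterSr -!addbA; congr (_ (+) (_ (+) (_ (+) _))).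
by apply: eq_bigr => i _; rewrite -!iterSr.
Qed.

Lemma orbit_follows_odd s y : (forall z, z \in porbit s y -> follows z (s z)) ->
  \big[addb/false]_(z in porbit s y) (itn z (+) wnd z (s z)).
Proof.
move=> fol; rewrite porbit_sum; have := card_porbit_neq0 s y.
case N: #|porbit s y| => [//|N'] _; rewrite big_ord_recr /=.
have lastE : s (iter N' s y) = y by rewrite -iterS -N iter_porbit.
have inP z : z \in y :: traject s (s y) N' = (z \in porbit s y).
  by rewrite porbit_traject N.
have uc : uniq (y :: traject s (s y) N') by have := uniq_traject_porbit s y; rewrite N.
have cyc : path.cycle (@follows n G) (y :: traject s (s y) N').
  rewrite /= rcons_path last_traject; apply/andP; split; last first.
    rewrite -[X in follows _ X]lastE; apply: fol; rewrite -inP.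
    by rewrite -last_traject mem_last.
  apply: sub_in_path (fpath_traject s y N').
    by move=> a b /= aP _ /eqP <-; apply: fol; rewrite -inP; exact: aP.
  by apply/allP => z; rewrite inE.
have {cyc} := cycle_odd cyc; rewrite lastE addbA -traject_parity.
rewrite /cycle_parity last_traject; apply; rewrite map_inj_in_uniq // => f g.
rewrite !inP => fO gO E.
have pred_ h : h \in porbit s y -> head G ((s^-1)%g h) = tail G h.
  move=> hO; have := fol ((s^-1)%g h); rewrite -[_ \in _](mem_porbit_step s) permKV.
  by move=> /(_ hO) /eqP.
case: (in_or_out_unique hG (pred_ f fO) (f := (s^-1)%g g) (g := g)) => //.
  by rewrite pred_.
exact: perm_inj.
Qed.

Section ClosedOrbit.
Local Open Scope nat_scope.
Variable s : 'S_(nE G).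
Hypotheses (sP : follows_perm (closed_follows e0 ej) s) (sj : s ej = e0).

Let N := #|porbit s e0|.-1.
Let cardE : #|porbit s e0| = N.+1.
Proof. by rewrite /N prednK // lt0n card_porbit_neq0. Qed.

Definition flow_route : seq (edge G) := traject s (s e0) N.

Lemma mem_flow_route z : (z \in e0 :: flow_route) = (z \in porbit s e0).
Proof. by rewrite porbit_traject cardE. Qed.

Lemma uniq_flow_route : uniq (e0 :: flow_route).
Proof. by have := uniq_traject_porbit s e0; rewrite cardE. Qed.

Let iter_last : iter N s e0 = ej.
Proof. by apply: (@perm_inj _ s); rewrite -iterS -cardE iter_porbit sj. Qed.

Lemma last_flow_route : last e0 flow_route = ej.
Proof. by rewrite last_traject iter_last. Qed.

Let iter_inj i i' : i <= N -> i' <= N -> iter i s e0 = iter i' s e0 -> i = i'.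
Proof.
move=> iN iN' /eqP; have := uniq_traject_porbit s e0; rewrite cardE => u.
have E m : m <= N -> iter m s e0 = nth e0 (traject s e0 N.+1) m by move=> mN; rewrite nth_traject.
by rewrite !E // nth_uniq ?size_traject ?ltnS // => /eqP.
Qed.

Let e0_moved : s e0 != e0.
Proof. by rewrite -{2}sj (inj_eq perm_inj). Qed.

Let iter_follows i : i < N -> follows (iter i s e0) (iter i.+1 s e0).
Proof.
move=> iN; have O : iter i s e0 \in porbit s e0.
  by rewrite porbit_traject cardE; apply/trajectP; exists i => //; exact: ltnW.
have := forallP sP (iter i s e0); rewrite (porbit_moved e0_moved O) /= => /orP[//|].
case/andP => /eqP E _; have iE : i = N by apply: iter_inj; rewrite ?(ltnW iN) // E iter_last.
by rewrite iE ltnn in iN.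
Qed.

Lemma path_flow_route : path (@follows n G) e0 flow_route.
Proof.
apply/(pathP e0) => i; rewrite size_traject => iN.
have -> : nth e0 (e0 :: flow_route) i = iter i s e0.
  by apply: (nth_traject s (n := N.+1)); exact: ltnW.
have -> : nth e0 flow_route i = iter i.+1 s e0.
  by rewrite iterSr (set_nth_default (s e0)) ?size_traject // nth_traject.
exact: iter_follows.
Qed.

Lemma walk_flow_route : walk_from e0 (inl j) (e0 :: flow_route).
Proof. by rewrite /= eqxx path_flow_route last_flow_route sink_ej eqxx. Qed.

Lemma uniq_tails_flow_route : uniq [seq tail G f | f <- e0 :: flow_route].
Proof.
apply: uniq_tails; [exact: path_flow_route|exact: uniq_flow_route|].
move=> f fP; apply: contraTneq fP => E.
have -> : f = e0 by apply: (source_edge_unique hG (s := r)); rewrite ?E.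
by have := uniq_flow_route => /= /andP[].
Qed.

Lemma flow_route_parity : path_parity wnd itn e0 flow_route = par.
Proof.
apply: path_par uniq_tails_flow_route; first exact: path_flow_route.
by rewrite last_flow_route.
Qed.

End ClosedOrbit.

(* The sign of the closing step is chosen so that every closed cycle is odd. *)
Definition closed_twist f g : bool :=
  if (f == ej) && (g == e0) then itn ej (+) ~~ par else itn f (+) wnd f g.

Lemma closed_orbit_odd s y : follows_perm (closed_follows e0 ej) s -> s y != y ->
  \big[addb/false]_(z in porbit s y) closed_twist z (s z).
Proof.
move=> sP sy; have [/andP[/eqP sj ejO]|nclosed] := boolP ((s ej == e0) && (ej \in porbit s y)).
  have -> : porbit s y = porbit s e0.
    by apply/eqP; rewrite eq_sym eq_porbit_mem -sj mem_porbit_step.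
  have := flow_route_parity sP sj; have := @mem_flow_route s.
  have := uniq_flow_route s; have := last_flow_route sj.
  rewrite porbit_sum /flow_route; have := card_porbit_neq0 s e0.
  case: #|_| => // N _; rewrite -pred_Sn last_traject traject_parity => lastE u inP parE.
  (* The steps before the closing one add up to [par] plus [itn ej], and the closing step to
     [itn ej] plus the negation of [par]. *)
  rewrite big_ord_recr /= lastE sj {2}/closed_twist !eqxx /=.
  rewrite (eq_bigr (fun i : 'I_N => itn (iter i s e0) (+) wnd (iter i s e0) (iter i.+1 s e0))).
    by move: parE; rewrite lastE => <-; set S := \big[_/_]_(i < _) _; case: S; case: (itn ej).
  move=> [i iN] _ /=; rewrite /closed_twist; case: eqP => //= iE.
  move: u; rewrite -[e0 :: _]/(traject s e0 N.+1) => u.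
  have : nth e0 (traject s e0 N.+1) i == nth e0 (traject s e0 N.+1) N.
    by rewrite !nth_traject ?ltnS // 1?ltnW // iE lastE.
  by rewrite nth_uniq ?size_traject ?ltnS // 1?ltnW // => /eqP E; rewrite E ltnn in iN.
have tw z : z \in porbit s y -> follows z (s z) && ~~ ((z == ej) && (s z == e0)).
  move=> zO; have := forallP sP z; rewrite (porbit_moved sy zO) /=.
  have ncl : ~~ ((z == ej) && (s z == e0)).
    apply: contra nclosed => /andP[/eqP <- ->]; exact: zO.
  by rewrite /closed_follows (negPf ncl) orbF => ->.
rewrite (eq_bigr (fun z => itn z (+) wnd z (s z))).
  by apply: orbit_follows_odd => z /tw/andP[].
by move=> z /tw/andP[_ /negPf ncl]; rewrite /closed_twist ncl.
Qed.

Lemma open_orbit_odd s y : follows_perm (@follows n G) s -> s y != y ->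
  \big[addb/false]_(z in porbit s y) (itn z (+) wnd z (s z)).
Proof.
move=> sP sy; apply: orbit_follows_odd => z zO.
by have := forallP sP z; rewrite (porbit_moved sy zO).
Qed.

Lemma flow_path_ex F : edge_flow_to e0 j F -> exists P, flow_path e0 j F P.
Proof.
move=> /(edge_flow_perm hG source_e0 sink_ej loopless e0_ej)[s /andP[sP /eqP sj] <-].
exists (e0 :: flow_route s); split; [exact: walk_flow_route|exact: uniq_flow_route|].
(* The orbit of [e0] is the path. Freezing it leaves a permutation without the closing step, whose
   moved edges form the conservative flow. *)
pose h z := if z \in porbit s e0 then z else s z.
have h_inj : injective h.
  move=> z z'; rewrite /h; case: ifP => zO; case: ifP => zO' // E.
  - by move: zO; rewrite E mem_porbit_step zO'.
  - by move: zO'; rewrite -E mem_porbit_step zO.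
  - exact: perm_inj E.
have e0_moved : s e0 != e0 by rewrite -{2}sj (inj_eq perm_inj).
have hj : perm h_inj ej = ej by rewrite permE /h -(mem_porbit_step s) sj porbit_id.
exists (moved (perm h_inj)); split.
- apply: (conservative_moved hG source_e0 sink_ej e0_ej); last by rewrite hj eq_sym.
  apply/forallP => z; rewrite permE /h; case: ifP => _; first by rewrite eqxx.
  exact: (forallP sP z).
- apply/pred0P => z /=; rewrite !inE -in_cons mem_flow_route permE /h.
  by case: ifP => // _; rewrite eqxx.
apply/setP => z; rewrite !inE -in_cons mem_flow_route permE /h.
by case: ifP => [zO|//]; rewrite (porbit_moved e0_moved zO).
Qed.

End Orbits.

(** * Series of signed walks *)

Section Series.
Variables (R : realType) (n : nat) (G : digraph n).
Notation poly := (mpoly (nE G) R).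
Notation mono := (multinom (nE G)).
Implicit Types (p q : poly) (S : series G R) (m u : mono).

Lemma mcoeff_mulX p u m :
  mcoeff m (mpolyX R u * p) = if lem u m then mcoeff (mnm_sub m u) p else 0.
Proof.
rewrite mulrC; case: ifP => [le|nle].
  by rewrite -{1}(submK le) addmC mcoeffMX.
apply: memN_msupp_eq0; rewrite (perm_mem (msuppMX _ _)); apply/negP => /mapP[u' _ E].
by move: nle; rewrite E lem_addr.
Qed.

Lemma mul_series_mcoeff q p m : mul_series q (fun m => mcoeff m p) m = mcoeff m (q * p).
Proof.
rewrite {2}(mpolyE q) mulr_suml linear_sum /= /mul_series big_mkcond.
apply: eq_bigr => u _; rewrite -scalerAl mcoeffZ mcoeff_mulX.
by case: ifP => // _; rewrite mulr0.
Qed.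

Lemma eq_mul_series q S S' m : (forall u, lem u m -> S u = S' u) ->
  mul_series q S m = mul_series q S' m.
Proof.
by move=> E; apply: eq_bigr => u _; rewrite E // lem_subr.
Qed.

(** The coefficient at [m] of a product with a polynomial only involves divisors of [m]. Identities
    for [mul_series] thus reduce to identities between polynomials. *)
Lemma series_truncation S m : exists p, forall u, lem u m -> S u = mcoeff u p.
Proof.
exists (\sum_(u : bmultinom (nE G) (mdeg m).+1) S u *: mpolyX R u) => u um.
have ud : (mdeg u < (mdeg m).+1)%N.
  by rewrite ltnS -(submK um) mdegD leq_addl.
rewrite linear_sum /= (bigD1 (BMultinom ud)) //= mcoeffZ mcoeffX eqxx mulr1.
rewrite big1 ?addr0 // => v vu; rewrite mcoeffZ mcoeffX.
by case: eqP => [E|]; rewrite ?mulr0 //; move: vu; rewrite -val_eqE /= E eqxx.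
Qed.

Lemma mul_seriesA q q' S m : mul_series (q * q') S m = mul_series q (mul_series q' S) m.
Proof.
have [p pE] := series_truncation S m.
rewrite (eq_mul_series _ pE) mul_series_mcoeff -mulrA -mul_series_mcoeff.
apply: eq_mul_series => u um; rewrite -mul_series_mcoeff; apply: eq_mul_series => v vu.
by rewrite pE //; exact: lepm_trans um.
Qed.

Lemma mul_series_suml (J : finType) (q : J -> poly) S m :
  mul_series (\sum_i q i) S m = \sum_i mul_series (q i) S m.
Proof.
have [p pE] := series_truncation S m.
rewrite (eq_mul_series _ pE) mul_series_mcoeff mulr_suml linear_sum /=.
by apply: eq_bigr => i _; rewrite (eq_mul_series _ pE) mul_series_mcoeff.
Qed.

Lemma mul_series_sumr (J : finType) q (S : J -> series G R) m :
  mul_series q (fun u => \sum_i S i u) m = \sum_i mul_series q (S i) m.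
Proof.
rewrite /mul_series exchange_big /=; apply: eq_bigr => u _.
by rewrite mulr_sumr.
Qed.

Lemma mul_series0 S m : mul_series 0 S m = 0.
Proof. by rewrite /mul_series msupp0 big_nil. Qed.

(* Series are only acted upon by polynomials, so Cramer's rule is used in the
   form [\adj A *m A = (\det A)%:M]. *)
Lemma cramer_series N (A : 'M[poly]_N) (S : 'I_N -> series G R) (b : 'I_N -> poly) i m :
  (forall i m, \sum_j mul_series (A i j) (S j) m = mcoeff m (b i)) ->
  mul_series (\det A) (S i) m = mcoeff m (\sum_j (\adj A) i j * b j).
Proof.
move=> sys; transitivity (\sum_j mul_series ((\adj A *m A) i j) (S j) m).
  rewrite mul_adj_mx (bigD1 i) //= big1 ?addr0 => [|j ji]; first by rewrite !mxE eqxx.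
  by rewrite !mxE eq_sym (negPf ji) mul_series0.
transitivity (\sum_l mul_series ((\adj A) i l) (fun u => \sum_j mul_series (A l j) (S j) u) m).
  under [RHS]eq_bigr do rewrite mul_series_sumr.
  rewrite exchange_big /=; apply: eq_bigr => j _; rewrite mxE mul_series_suml.
  by apply: eq_bigr => l _; rewrite mul_seriesA.
rewrite linear_sum /=; apply: eq_bigr => l _; rewrite -mul_series_mcoeff.
by apply: eq_mul_series => u _.
Qed.

(** Multiplying the series by both denominators gives q' p = q p' as polynomials, which can be
    evaluated at [w]. *)
Lemma sums_rationally_unique S (w : edge G -> R) v v' :
  sums_rationally S w v -> sums_rationally S w v' -> v = v'.
Proof.
move=> [p [q [qS q0 ->]]] [p' [q' [qS' q0' ->]]].
have E : q' * p = q * p'.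
  apply/mpolyP => m; rewrite -!mul_series_mcoeff.
  transitivity (mul_series (q' * q) S m).
    by rewrite mul_seriesA; apply: eq_mul_series => u _.
  by rewrite mulrC mul_seriesA; apply: eq_mul_series => u _.
have {}E := congr1 (meval w) E; rewrite !mevalM in E.
by apply/eqP; rewrite eqr_div // mulrC E mulrC.
Qed.

Lemma rational_sumE S (w : edge G -> R) v : sums_rationally S w v -> rational_sum S w = v.
Proof.
move=> Sv; rewrite /rational_sum; case: xgetP => [v' _ Sv'|/(_ v)//].
exact: sums_rationally_unique Sv' Sv.
Qed.

Lemma sums_rationally_scale S (w : edge G -> R) v c :
  sums_rationally S w v -> sums_rationally (fun m => c * S m) w (c * v).
Proof.
move=> [p [q [qS q0 ->]]]; exists (c *: p), q; split => //; last by rewrite mevalZ mulrA.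
move=> m; rewrite mcoeffZ -qS /mul_series mulr_sumr; apply: eq_bigr => u _.
by rewrite mulrCA.
Qed.

Lemma eq_sums_rationally S S' (w : edge G -> R) v :
  S =1 S' -> sums_rationally S w v -> sums_rationally S' w v.
Proof.
move=> E [p [q [qS q0 ->]]]; exists p, q; split => // m.
by rewrite -qS; apply: eq_mul_series => u _.
Qed.

End Series.

Lemma big_tuple_cons (R : nmodType) (T : finType) d (Q : pred (d.+1.-tuple T))
    (F : d.+1.-tuple T -> R) :
  \sum_(P | Q P) F P = \sum_h \sum_(t : d.-tuple T | Q (cons_tuple h t)) F (cons_tuple h t).
Proof.
rewrite pair_big_dep /= (reindex (fun p : T * d.-tuple T => cons_tuple p.1 p.2)) //=.
exists (fun t => (thead t, behead_tuple t)).
  by move=> [h t] _ /=; congr pair; apply: val_inj.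
by move=> t _; rewrite [t in RHS]tuple_eta; apply: val_inj.
Qed.

Section WalkSeries.
Variables (R : realType) (n : nat) (G : digraph n) (y : vertex G).
Variables (wnd : edge G -> edge G -> bool) (itn : edge G -> bool).
Notation mono := (multinom (nE G)).
Implicit Types (f g : edge G) (m : mono).

Definition walk_sign (P : seq (edge G)) : R :=
  if P is f :: P' then (-1) ^+ path_parity wnd itn f P' else 0.

Definition signed_walks f : series G R := walk_series (walk_from f y) walk_sign.

Let unit_mono f : mono := mnm1 (f : 'I_(nE G)).

Lemma walk_monomial_cons f P : walk_monomial (f :: P) = mnm_add (unit_mono f) (walk_monomial P).
Proof.
apply/mnmP => i; rewrite mnmDE mnm1E !multinomE !tnth_mktuple /=.
by [].
Qed.

Lemma walk_monomial_nil : walk_monomial ([::] : seq (edge G)) = @mnm0 (nE G).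
Proof. by apply/mnmP => i; rewrite mnm0E. Qed.

Lemma unit_mono_le f m : lem (unit_mono f) m = (0 < m f)%N.
Proof.
apply/mnm_lepP/idP => [/(_ f)|mf i]; first by rewrite mnm1E eqxx.
by rewrite mnm1E; case: eqP => // <-.
Qed.

(** A walk from [f] is either [f] alone, if it ends at [y], or [f] before a walk from a following
    edge; removing [f] divides the monomial by its variable. *)
Lemma signed_walks_rec f m : signed_walks f m =
  if lem (unit_mono f) m then
    (-1) ^+ itn f * (((head G f == y) && (mnm_sub m (unit_mono f) == @mnm0 (nE G)))%:R +
      \sum_(g | follows f g) (-1) ^+ wnd f g * signed_walks g (mnm_sub m (unit_mono f)))
  else 0.
Proof.
case: ifP => [le|nle]; last first.
  apply: big1 => -[P Psz] /= /andP[wP /eqP Pm]; move: nle; rewrite -Pm unit_mono_le.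
  case: P wP {Psz Pm} => //= g P /andP[/eqP -> _].
  by rewrite walk_monomial_cons mnmDE mnm1E eqxx.
set m' := mnm_sub m _; have mE : m = mnm_add (unit_mono f) m' by rewrite addmC submK.
have dE : mdeg m = (mdeg m').+1 by rewrite mE mdegD mdeg1.
rewrite /signed_walks /walk_series dE big_tuple_cons (bigD1 f) //= [X in _ + X]big1; last first.
  by move=> g gf; apply: big1 => t; rewrite /= (negPf gf).
rewrite addr0 eqxx /=.
(* The one-edge walk becomes the empty tuple in a sum over tuples, so that both cases are compared
   tuple by tuple. *)
have E0 : ((head G f == y) && (m' == @mnm0 (nE G)))%:R =
   \sum_(t : (mdeg m').-tuple (edge G) | walk_monomial t == m')
      ((head G f == y) && nilp t)%:R :> R.
  have [z|nz] := eqVneq m' (@mnm0 (nE G)); last first.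
    rewrite andbF big1 // => t _; rewrite /nilp size_tuple mdeg_eq0.
    by rewrite (negPf nz) andbF.
  rewrite z mdeg0 andbT (big_pred1 [tuple]) ?andbT // => t.
  by rewrite tuple0 /= walk_monomial_nil eqxx; apply/esym/eqP; rewrite tuple0.
have E1 (g : edge G) : \sum_(P : (mdeg m').-tuple (edge G) | walk_from g y P && (walk_monomial P == m'))
      walk_sign P =
   \sum_(t : (mdeg m').-tuple (edge G) | walk_monomial t == m')
     (if walk_from g y t then walk_sign t else 0).
  by rewrite -big_mkcondr; apply: eq_bigl => t; rewrite andbC.
rewrite E0; under [X in _ + X]eq_bigr do rewrite E1 mulr_sumr.
rewrite exchange_big -big_split mulr_sumr /=.
rewrite (eq_bigl (fun t : (mdeg m').-tuple (edge G) => (walk_monomial t == m') &&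
   (path (@follows n G) f t && (head G (last f t) == y)))); last first.
  move=> t; rewrite walk_monomial_cons mE andbC; congr (_ && _).
  by apply/eqP/eqP => [/(congr1 (fun z => mnm_sub z (unit_mono f)))|->//];
    rewrite ![mnm_add (unit_mono f) _]addmC !addmK.
rewrite big_mkcondr; apply: eq_bigr => -[[|g t] tsz] _ /=.
  rewrite andbT addbF big1 ?addr0 => [|g _]; last by rewrite mulr0.
  by case: eqP; rewrite ?mulr1 ?mulr0.
rewrite andbF add0r; have [fg|nfg] := boolP (follows f g); last first.
  rewrite big1 ?mulr0 // => h fh; case: eqP => [hg|]; rewrite ?mulr0 //.
  by rewrite hg fh in nfg.
rewrite (bigD1 g) //= eqxx big1 ?addr0 => [|h /andP[_ hg]]; last first.
  by rewrite eq_sym (negPf hg) /= mulr0.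
by case: ifP; rewrite ?mulr0 // !signr_addb.
Qed.

Lemma mul_seriesB (q q' : mpoly (nE G) R) (S : series G R) m :
  mul_series (q - q') S m = mul_series q S m - mul_series q' S m.
Proof.
have [p pE] := series_truncation S m.
by rewrite !(eq_mul_series _ pE) !mul_series_mcoeff mulrBl linearB.
Qed.

Lemma mul_series1 (S : series G R) m : mul_series 1 S m = S m.
Proof.
have [p pE] := series_truncation S m.
by rewrite (eq_mul_series _ pE) mul_series_mcoeff mul1r -pE // lepm_refl.
Qed.

Lemma mul_series_signX (b : bool) u (S : series G R) m :
  mul_series ((-1) ^+ b * mpolyX R u) S m =
  if lem u m then (-1) ^+ b * S (mnm_sub m u) else 0.
Proof.
have [p pE] := series_truncation S m.
rewrite (eq_mul_series _ pE) mul_series_mcoeff -mulrA.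
have -> : mcoeff m ((-1) ^+ b * (mpolyX R u * p)) = (-1) ^+ b * mcoeff m (mpolyX R u * p).
  by case: b; rewrite ?expr1 ?expr0 ?mulN1r ?mul1r ?linearN.
rewrite mcoeff_mulX; case: ifP => um; last by rewrite mulr0.
by rewrite pE // lem_subr.
Qed.

Definition walk_twist f g := itn f (+) wnd f g.

Definition walk_mx : 'M[mpoly (nE G) R]_(nE G) :=
  1%:M - transfer_mx (fun f => mpolyX R (unit_mono f)) (@follows n G) walk_twist.

Definition last_term f : mpoly (nE G) R :=
  if head G f == y then (-1) ^+ itn f * mpolyX R (unit_mono f) else 0.

Lemma walk_system f m :
  \sum_g mul_series (walk_mx f g) (signed_walks g) m = mcoeff m (last_term f).
Proof.
under eq_bigr do rewrite !mxE mul_seriesB.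
rewrite big_split /= (bigD1 f) //= eqxx mul_series1 big1 => [|g gf]; last first.
  by rewrite eq_sym (negPf gf) mul_series0.
rewrite addr0 signed_walks_rec sumrN.
have -> : \sum_g mul_series (if follows f g then
     (-1) ^+ walk_twist f g * mpolyX R (unit_mono f) else 0) (signed_walks g) m =
   if lem (unit_mono f) m then \sum_(g | follows f g) (-1) ^+ itn f *
      ((-1) ^+ wnd f g * signed_walks g (mnm_sub m (unit_mono f))) else 0.
  rewrite (bigID (follows f)) /= [X in _ + X]big1 ?addr0 => [|g /negPf ->]; last first.
    exact: mul_series0.
  case: ifP => le; last first.
    by apply: big1 => g fg; rewrite fg mul_series_signX le.
  apply: eq_bigr => g fg; rewrite fg mul_series_signX le /walk_twist signr_addb mulrA //.
rewrite -mulr_sumr /last_term; case: ifP => le; last first.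
  rewrite subr0; case: ifP => _; last by rewrite linear0.
  have -> : mcoeff m ((-1) ^+ itn f * mpolyX R (unit_mono f)) = (-1) ^+ itn f * (unit_mono f == m)%:R.
    by rewrite -mcoeffX; case: (itn f); rewrite ?expr1 ?expr0 ?mulN1r ?mul1r ?linearN.
  by case: eqP => [E|_]; rewrite ?mulr0 // -E lepm_refl in le *.
rewrite mulrDr addrK; case: ifP => _; last by rewrite mulr0 linear0.
have -> : (mnm_sub m (unit_mono f) == @mnm0 (nE G)) = (unit_mono f == m).
  apply/eqP/eqP => [E|<-]; first by rewrite -[RHS](submK le) E add0m.
  by apply/mnmP => i; rewrite mnmBE subnn mnm0E.
by rewrite -mcoeffX; case: (itn f); rewrite ?expr1 ?expr0 ?mulN1r ?mul1r ?linearN.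
Qed.

End WalkSeries.

(** * Flows over conservative flows *)

Section Assembly.
Variables (R : realType) (k n : nat) (G : digraph n) (I : 'I_k -> 'I_n).
Implicit Types (e f g c d : edge G) (P L : seq (edge G)) (F S : {set edge G}).
Hypothesis hG : plabic G I.
Variables (wnd : edge G -> edge G -> bool) (itn : edge G -> bool).
Variables (r : 'I_k) (j : 'I_n) (e0 ej : edge G) (par : bool).
Hypothesis source_e0 : tail G e0 = inl (I r).
Hypothesis sink_ej : head G ej = inl j.
Hypothesis loopless : forall e, tail G e != head G e.
Hypothesis e0_ej : e0 != ej.
Hypothesis cycle_odd : forall c P, path.cycle (@follows n G) (c :: P) ->
  uniq [seq tail G f | f <- c :: P] -> cycle_parity wnd itn (c :: P).
Hypothesis path_par : forall P, path (@follows n G) e0 P -> head G (last e0 P) = inl j ->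
  uniq [seq tail G f | f <- e0 :: P] -> path_parity wnd itn e0 P = par.

Let X (f : 'I_(nE G)) : mpoly (nE G) R := mpolyX R (mnm1 f).
Let prodX S : mpoly (nE G) R := \prod_(f in S) X f.
Let A := walk_mx R wnd itn.
Let A' := 1%:M - transfer_mx X (closed_follows e0 ej) (closed_twist wnd itn e0 ej par).

Lemma det_walk_mx : \det A = \sum_(C | conservative_flow C) prodX C.
Proof.
rewrite /A /walk_mx det_transfer; first last.
- by move=> s y sP sy; exact: (open_orbit_odd hG cycle_odd sP sy).
- by move=> f; exact: follows_irr.
apply: sum_over_moved.
- move=> s; rewrite (follows_perm_open hG sink_ej e0_ej) => /andP[sP sj].
  exact: (conservative_moved hG source_e0 sink_ej e0_ej).
- move=> C /(conservative_perm hG source_e0 sink_ej loopless e0_ej)[s sP sC].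
  by exists s => //; rewrite (follows_perm_open hG sink_ej e0_ej).
move=> s s'; rewrite !(follows_perm_open hG sink_ej e0_ej).
move=> /andP[sP /negPf sj] /andP[sP' /negPf sj'] E.
by apply: (moved_inj hG sink_ej sP sP' _ E); rewrite sj sj'.
Qed.

(** Permutations without the closing step give the conservative flows, those with it the edge
    flows. *)
Lemma det_closed : \det A' =
  \sum_(C | conservative_flow C) prodX C + \sum_(F | edge_flow_to e0 j F) prodX F.
Proof.
rewrite /A' det_transfer; first last.
- by move=> s y sP sy; apply: (closed_orbit_odd hG source_e0 sink_ej e0_ej cycle_odd path_par).
- by move=> f; exact: closed_follows_irr.
rewrite (bigID (fun s : 'S__ => s ej != e0)) /=; congr (_ + _).
  rewrite -det_walk_mx /A /walk_mx det_transfer; first last.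
  - by move=> s y sP sy; exact: (open_orbit_odd hG cycle_odd sP sy).
  - by move=> f; exact: follows_irr.
  by apply: eq_bigl => s; rewrite (follows_perm_open hG sink_ej e0_ej).
apply: sum_over_moved.
- move=> s /andP[sP /negPn/eqP sj].
  exact: (edge_flow_moved hG source_e0 sink_ej e0_ej).
- move=> F /(edge_flow_perm hG source_e0 sink_ej loopless e0_ej)[s sP sF].
  by exists s => //; rewrite negbK.
move=> s s' /andP[sP /negPn sj] /andP[sP' /negPn sj'] E.
by apply: (moved_inj hG sink_ej sP sP' _ E); rewrite sj sj'.
Qed.

Lemma closed_column f : A' f e0 = A f e0 + (-1) ^+ par * last_term R (inl j) itn f.
Proof.
rewrite !mxE /closed_follows /closed_twist /last_term eqxx !andbT -addrA; congr (_ + _).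
have nfol g : follows g e0 = false.
  by apply/negbTE/eqP => E; apply: (source_not_head hG (e := g) (s := r)); rewrite E.
rewrite nfol /= oppr0 add0r.
have [->|fj] := eqVneq f ej.
  rewrite sink_ej eqxx /X mulrA -signr_addb -mulNr; congr (_ * _).
  by case: (itn ej); case: par; rewrite ?expr0 ?expr1 ?opprK.
case: eqP => [E|_]; last by rewrite mulr0 oppr0.
by case/eqP: fj; exact: (sink_edge_unique hG E sink_ej).
Qed.

(* Closing up the graph adds a multiple of the right-hand side to one column of
   the matrix, so the numerator is a difference of two determinants. *)
Lemma adj_last_term : \sum_f (\adj A) e0 f * last_term R (inl j) itn f =
  (-1) ^+ par * \sum_(F | edge_flow_to e0 j F) prodX F.
Proof.
(* The two matrices differ only in column [e0], which these cofactors delete. *)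
have cof f : cofactor A' f e0 = cofactor A f e0.
  rewrite /cofactor; congr (_ * \det _); apply/matrixP => a b; rewrite !mxE.
  rewrite /closed_follows /closed_twist.
  by have /negPf-> : lift e0 b != e0; [rewrite eq_sym neq_lift|rewrite !andbF orbF].
have : \det A' = \det A + (-1) ^+ par * \sum_f (\adj A) e0 f * last_term R (inl j) itn f.
  rewrite (expand_det_col A' e0) (expand_det_col A e0) mulr_sumr -big_split /=.
  apply: eq_bigr => f _; rewrite closed_column cof mulrDl; congr (_ + _).
  have -> : (\adj A) e0 f = cofactor A f e0 by rewrite mxE.
  by rewrite -mulrA [cofactor _ _ _ * _]mulrC.
rewrite det_closed det_walk_mx => /addrI ->.
by rewrite mulrA -signr_addb addbb mul1r.
Qed.

Lemma meval_prodX (w : edge G -> R) S : meval w (prodX S) = set_weight w S.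
Proof. by rewrite /prodX rmorph_prod; apply: eq_bigr => f _; rewrite /= mevalXU. Qed.

Lemma sum_conservative_gt0 (w : edge G -> R) : (forall f, 0 < w f) ->
  0 < \sum_(C : {set edge G} | conservative_flow C) set_weight w C.
Proof.
move=> w0; have c0 : conservative_flow (finset.set0 : {set edge G}).
  apply/andP; split; apply/forallP => f; first by rewrite inE.
  by apply/eqP; rewrite /arriving /leaving; apply: eq_card => g; rewrite !inE.
rewrite (bigD1 finset.set0) //= /set_weight big_set0 ltr_pwDl // sumr_ge0 // => C _.
by apply: prodr_ge0 => f _; exact: ltW.
Qed.

Lemma signed_walks_sum (w : edge G -> R) : (forall f, 0 < w f) ->
  sums_rationally (signed_walks R (inl j) wnd itn e0) w
    ((-1) ^+ par * ((\sum_(F : {set edge G} | edge_flow_to e0 j F) set_weight w F)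
                     / (\sum_(C : {set edge G} | conservative_flow C) set_weight w C))).
Proof.
move=> w0; have q0 := sum_conservative_gt0 w0.
have qE : meval w (\det A) = \sum_(C | conservative_flow C) set_weight w C.
  by rewrite det_walk_mx rmorph_sum /=; apply: eq_bigr => C _; exact: meval_prodX.
exists (\sum_f (\adj A) e0 f * last_term R (inl j) itn f), (\det A); split.
- by move=> m; apply: cramer_series => f u; exact: walk_system.
- by rewrite qE gt_eqF.
rewrite qE adj_last_term rmorphM rmorph_sum /= mulrA; congr (_ * _ / _).
  by case: par; rewrite ?expr0 ?expr1 ?rmorphN ?rmorph1.
by apply: eq_bigr => F _; rewrite meval_prodX.
Qed.

Lemma walk_from_source P : walk (inl (I r)) (inl j) P = walk_from e0 (inl j) P.
Proof.
apply/existsP/idP => [[e /andP[/eqP eI wP]]|wP]; last by exists e0; rewrite source_e0 eqxx.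
by rewrite (source_edge_unique hG source_e0 eI).
Qed.

Lemma boundary_signed_walks m :
  boundary_series R (I r) j m = (-1) ^+ par * signed_walks R (inl j) wnd itn e0 m.
Proof.
rewrite /boundary_series /signed_walks /walk_series mulr_sumr.
rewrite (eq_bigl (fun P : (mdeg m).-tuple (edge G) =>
   walk_from e0 (inl j) P && (walk_monomial P == m))); last first.
  by move=> P; rewrite walk_from_source.
apply: eq_bigr => -[[|e P] Psz] //= /andP[/and3P[/eqP eE pP /eqP lP] _].
rewrite eE in pP lP *.
rewrite (walk_parity hG source_e0 loopless cycle_odd path_par pP lP).
by rewrite -signr_addb addbA addbb signr_odd.
Qed.

Lemma flow_path_parity F e P : flow_path e0 j F (e :: P) ->
  e = e0 /\ path_parity wnd itn e0 P = par.
Proof.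
move=> [/and3P[/eqP -> pP /eqP lP] uP _]; split => //; apply: path_par => //.
apply: (uniq_tails hG pP uP) => f fP; apply: contraTneq fP => E.
have -> : f = e0 by apply: (source_edge_unique hG (s := r)); rewrite ?E.
by case/andP: uP.
Qed.

End Assembly.

Lemma exprz_sign (R : realType) (z : int) : (-1 : R) ^ z = (-1) ^+ odd `|z|%N.
Proof.
case: z => m; first by rewrite -exprnP signr_odd.
by rewrite NegzE -exprnN -exprVn invrN1 abszN signr_odd.
Qed.

Lemma eqz_mod2 (z : int) (m : nat) : odd `|z|%N = odd m -> (z = m %[mod 2])%Z.
Proof. by lia. Qed.

Lemma rref_unique (R : realType) k n (I : 'I_k -> 'I_n) (A B : 'M[R]_(k, n)) :
  same_point A B -> colsub I B = 1%:M -> rref I A = B.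
Proof.
move=> [g g0 ->] IB; have gE : colsub I (g *m B) = g by rewrite -mulmx_colsub IB mulmx1.
by rewrite /rref gE mulmxA mulVmx ?mul1mx // unitmxE unitfE gt_eqF.
Qed.

Theorem corollary4p2 (R : realType) (k n : nat) (hk : (0 < k)%N) (hkn : (k < n)%N)
    (G : digraph n) (I : 'I_k -> 'I_n) (hG : plabic G I)
    (D : set (R * R)) (pos : vertex G -> R * R) (hpos : planar_drawing D pos)
    (w : edge G -> R) (hw : forall f : edge G, 0 < w f)
    (l : R * R) (hl : gauge_ray_direction D pos l)
    (M : {set {set 'I_n}}) (hM : matroid_bases k M) (hI : ran I \in M)
    (A : 'M[R]_(k, n)) (hA : positroid_cell M A) (hrep : represents I w A)
    (r : 'I_k) (e : edge G) (he : tail G e = inl (I r))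
    (j : 'I_n) (hj : j \notin ran I) :
  let N := nb_between I (I r) j in
  (forall F : {set edge G}, edge_flow_to e j F ->
     (exists P, flow_path e j F P) /\
     forall P, flow_path e j F P ->
       (wind pos l P + path_int pos l I P = N %[mod 2])%Z) /\
  [/\ sums_rationally (edge_series pos l I e j) w (edge_vector pos l I w e 0 j),
      edge_vector pos l I w e 0 j
      = (-1) ^+ N * ((\sum_(F : {set edge G} | edge_flow_to e j F) set_weight w F)
                     / (\sum_(C : {set edge G} | conservative_flow C)
                          set_weight w C)) &
      edge_vector pos l I w e 0 j = rref I A r j].
Proof.
move=> N.
have [ej sink_ej] : exists ej : edge G, head G ej = inl j.
  have [[_ /(_ j) src] /(_ j) deg _ _ _] := hG.
  have : (0 < indeg (inl j : vertex G))%N.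
    by move: src; rewrite (negPf hj) => /negbT; lia.
  by case/card_gt0P => ej; rewrite inE => /eqP; exists ej.
have loopless f : tail G f != head G f by have [_ _ _ _ [_ + _]] := hpos.
have e_ej : e != ej.
  by apply/eqP => E; apply: (no_boundary_edge hpos hl he (j := j)); rewrite E.
have cyc c P : path.cycle (@follows n G) (c :: P) ->
    uniq [seq tail G f | f <- c :: P] -> cycle_parity (wnd pos l) (itn I pos l) (c :: P).
  exact: (gauge_cycle_odd hG hpos hl).
have pth P : path (@follows n G) e P -> head G (last e P) = inl j ->
    uniq [seq tail G f | f <- e :: P] -> path_parity (wnd pos l) (itn I pos l) e P = odd N.
  by move=> pP lP uP; exact: (gauge_path_odd hG hpos hl pP he lP uP hj).
have sumW := signed_walks_sum hG he sink_ej loopless e_ej cyc pth hw.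
set v := _ * _ in sumW.
have vE : v = (-1) ^+ N * ((\sum_(F : {set edge G} | edge_flow_to e j F) set_weight w F)
                     / (\sum_(C : {set edge G} | conservative_flow C) set_weight w C)).
  by rewrite /v signr_odd.
have sumE : sums_rationally (edge_series pos l I e j) w v.
  apply: eq_sums_rationally sumW => m; apply: eq_bigr => -[[|f P] Psz] //= _.
  by rewrite exprz_sign -path_parity_wind.
have vecE : edge_vector pos l I w e 0 j = v by rewrite mxE; exact: rational_sumE.
split.
  move=> F Fe; split; first exact: (flow_path_ex hG he sink_ej loopless e_ej Fe).
  move=> [[//]|f P] FP; have [fE par] := flow_path_parity hG he pth FP.
  by apply: eqz_mod2; rewrite fE path_parity_wind.
split; rewrite vecE //.
have [B AB [IB BE]] := hrep.
(* The sign in [represents] and the constant ratio between loop signs and gauge signs are both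
   (-1)^N and cancel. *)
rewrite (rref_unique AB IB) BE // (rational_sumE (v := (-1) ^+ odd N * v)).
  by rewrite -/N signr_odd mulrA -exprD -signr_odd oddD addbb mul1r.
apply: eq_sums_rationally (sums_rationally_scale _ sumW) => m.
by rewrite (boundary_signed_walks R hG he loopless cyc pth).
Qed.
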